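(* Suppose that the $\mathbb{D}$-valued resampling mechanism described in the context is given. Assume further that $\boldsymbol S_n = \boldsymbol S_n(\boldsymbol X_n)$ converges weakly (as $n\to\infty$) to some random variable $\boldsymbol S$ in $\mathbb{D}$. Then the following four assertions are equivalent: (a) $\mathbb{P}^{(\boldsymbol S_n, \boldsymbol S_n^{(1)}, \boldsymbol S_n^{(2)})} \leadsto \mathbb{P}^{\boldsymbol S} \otimes \mathbb{P}^{\boldsymbol S} \otimes \mathbb{P}^{\boldsymbol S}$ as $n\to\infty$; (b) $\mathbb{P}^{(\boldsymbol S_n, \boldsymbol S_n^{(1)}, \dots, \boldsymbol S_n^{(M)})} \leadsto (\mathbb{P}^{\boldsymbol S})^{\otimes (M+1)}$ as $n\to\infty$, for any $M\ge 2$; (c) $d_{\mathrm{BL}}\big(\mathbb{P}^{\boldsymbol S_n^{(1)} \mid \boldsymbol X_n}, \mathbb{P}^{\boldsymbol S_n}\big) \to 0$ in probability as $n\to\infty$; (d) $d_{\mathrm{BL}}\big(\hat{\mathbb{P}}_M^{\boldsymbol S_n}, \mathbb{P}^{\boldsymbol S_n}\big) \to 0$ in probability as $n,M\to\infty$. If, additionally, $\mathbb{D}=\mathbb{R}^d$ and the (cumulative) distribution function of $\boldsymbol S$ is continuous, then the preceding four assertions are also equivalent to (e) $d_{K}\big(\mathbb{P}^{\boldsymbol S_n^{(1)} \mid \boldsymbol X_n}, \mathbb{P}^{\boldsymbol S_n}\big) \to 0$ in probability as $n\to\infty$; (f) $d_K\big(\hat{\mathbb{P}}_M^{\boldsymbol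 S_n}, \mathbb{P}^{\boldsymbol S_n}\big) \to 0$ in probability as $n,M\to\infty$.
   Context: Resampling mechanism. $(\mathbb{D},d)$ is a separable metric space with Borel sigma field $\mathcal{D}$, and $(\Omega,\mathcal{A},\mathbb{P})$ is a probability space. For $n\in\mathbb{N}$, $\boldsymbol X_n:\Omega\to\mathcal{X}_n$ is a random variable in some measurable space $\mathcal{X}_n$ (the data), and $\boldsymbol S_n=\boldsymbol S_n(\boldsymbol X_n)$ is a $\mathbb{D}$-valued statistic. Moreover, $\boldsymbol W_n^{(i)}:\Omega\to\mathcal{W}_n$, $i\in\mathbb{N}$, are identically distributed random variables in some measurable space $\mathcal{W}_n$, and $\boldsymbol S_n^{(i)}=\boldsymbol S_n^{(i)}(\boldsymbol X_n,\boldsymbol W_n^{(i)})$, $i\in\mathbb{N}$, are $\mathbb{D}$-valued statistics (to be considered as bootstrap replicates of $\boldsymbol S_n$) that are independent conditionally on $\boldsymbol X_n$. Finally, it is assumed that $\mathbb{P}(\boldsymbol S_n^{(1)}\in\cdot\mid\boldsymbol X_n)$ has a regular version, denoted $\mathbb{P}^{\boldsymbol S_n^{(1)}\mid\boldsymbol X_n}:\mathcal{X}_n\times\mathcal{D}\to\mathbb{R}$ and called the (regular) conditional distribution of $\boldsymbol S_n^{(1)}$ given $\boldsymbol X_n$. Notation. $\mathbb{P}^{Y}$ denotes the law of a random variable $Y$; $\leadsto$ denotes weak convergence. $\mathrm{BL}_1(\mathbb{D})$ is the set of functions $h:\mathbb{D}\to[-1,1]$ with $|h(x)-h(y)|\le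 d(x,y)$ for all $x,y\in\mathbb{D}$. For probability measures $P,Q$ on $(\mathbb{D},\mathcal{D})$, $d_{\mathrm{BL}}(P,Q)=\sup_{f\in\mathrm{BL}_1(\mathbb{D})}|\int f\,dP-\int f\,dQ|$. For probability measures $P,Q$ on $\mathbb{R}^d$, $d_K(P,Q)=\sup_{\boldsymbol x\in\mathbb{R}^d}|P\{(-\boldsymbol\infty,\boldsymbol x]\}-Q\{(-\boldsymbol\infty,\boldsymbol x]\}|$. The empirical distribution of the sample $\boldsymbol S_n^{(1)},\dots,\boldsymbol S_n^{(M)}$ is $\hat{\mathbb{P}}_M^{\boldsymbol S_n}=\frac1M\sum_{i=1}^M\delta_{\boldsymbol S_n^{(i)}}$. Convergence ''as $n,M\to\infty$'' is convergence of the net indexed by $(n,M)\in\mathbb{N}^2$ (both indices tending to infinity).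
   Formalization: It is additionally assumed that all replicates S_n^(i) share the same conditional distribution given X_n, i.e. (X_n,S_n^(i)) and (X_n,S_n^(1)) have equal laws; identically distributed weights alone do not suffice (W^(2) could equal the data). *)

(* Defs.v *)
From HB Require Import structures.
From mathcomp Require Import all_boot all_order all_algebra finmap ring.
From mathcomp Require Import all_classical all_reals all_analysis.

Set Implicit Arguments.
Unset Strict Implicit.
Unset Printing Implicit Defensive.

Import Order.TTheory GRing.Theory Num.Theory.
Import numFieldNormedType.Exports.

Local Open Scope classical_set_scope.
Local Open Scope ring_scope.

#[short(type="topMeasurableType")]
HB.structure Definition TopMeasurable d :=
  {T of Topological T & Measurable d T}.

HB.mixin Record Metric_isBorel d (R : realType) T
    & Metric R T & Measurable d T := {
  measurable_borel : @measurable d T = <<s @open T >>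
}.

#[short(type="borelMetricType")]
HB.structure Definition BorelMetric d (R : realType) :=
  {T of Metric R T & Measurable d T & Metric_isBorel d R T}.

Definition separable (T : topologicalType) :=
  exists2 A : set T, countable A & dense A.

(* The library gives tuples the product sigma-algebra; here they get the
   product topology. When T is separable metric with its Borel sigma-algebra,
   the former is the Borel sigma-algebra of the latter. *)
HB.instance Definition _ n (T : topologicalType) :=
  Topological.copy (n.-tuple T)
    (initial_topology
       (fun t : n.-tuple T => (tnth t : prod_topology (fun _ : 'I_n => T)))).

HB.instance Definition _ d n (T : topMeasurableType d) :=
  Measurable.on (n.-tuple T).

(* R^k with the Euclidean distance; the library equips 'rV[R]_k with the
   max-norm instead. *)
Definition euclid (R : realType) (k : nat) := 'rV[R]_k.

Section euclid_metric.
Context {R : realType} {k : nat}.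
Implicit Types x y z : euclid R k.

Definition euclid_dist x y : R :=
  Num.sqrt (\sum_(i < k) (x ord0 i - y ord0 i) ^+ 2).

Let euclid_dist_sum_ge0 x y :
  0 <= \sum_(i < k) (x ord0 i - y ord0 i) ^+ 2 :> R.
Proof. by apply: sumr_ge0 => i _; exact: sqr_ge0. Qed.

Lemma euclid_distxx x : euclid_dist x x = 0.
Proof.
by rewrite /euclid_dist big1 ?sqrtr0// => i _; rewrite subrr expr0n.
Qed.

Lemma euclid_dist_eq0 x y : euclid_dist x y = 0 -> x = y.
Proof.
move=> /eqP; rewrite sqrtr_eq0 => le0.
have /eqP : \sum_(i < k) (x ord0 i - y ord0 i) ^+ 2 = 0 :> R.
  by apply/eqP; rewrite eq_le le0 euclid_dist_sum_ge0.
rewrite psumr_eq0; last by move=> i _; exact: sqr_ge0.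
move=> /allP xy; apply/rowP => i; apply/eqP.
by have := xy i (mem_index_enum i); rewrite /= sqrf_eq0 subr_eq0.
Qed.

Lemma euclid_dist_sym x y : euclid_dist x y = euclid_dist y x.
Proof.
by congr Num.sqrt; apply: eq_bigr => i _; rewrite -sqrrN opprB.
Qed.

Let cauchy_schwarz (a b : 'I_k -> R) :
  (\sum_i a i * b i) ^+ 2 <= (\sum_i a i ^+ 2) * (\sum_i b i ^+ 2).
Proof.
have : 0 <= \sum_i \sum_j (a i * b j - a j * b i) ^+ 2.
  by apply: sumr_ge0 => i _; apply: sumr_ge0 => j _; exact: sqr_ge0.
have -> : \sum_i \sum_j (a i * b j - a j * b i) ^+ 2 =
    ((\sum_i a i ^+ 2) * (\sum_i b i ^+ 2) - (\sum_i a i * b i) ^+ 2) *+ 2.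
  transitivity (\sum_i \sum_j (a i ^+ 2 * b j ^+ 2)
      + \sum_i \sum_j (b i ^+ 2 * a j ^+ 2)
      - (\sum_i \sum_j ((a i * b i) * (a j * b j))) *+ 2).
    rewrite -sumrMnl -big_split -sumrB; apply: eq_bigr => i _ /=.
    rewrite -sumrMnl -big_split -sumrB; apply: eq_bigr => j _ /=; ring.
  by rewrite -!big_distrlr /=; ring.
by rewrite pmulrn_lge0// subr_ge0.
Qed.

Lemma euclid_dist_triangle y x z :
  euclid_dist x z <= euclid_dist x y + euclid_dist y z.
Proof.
pose a i := x ord0 i - y ord0 i; pose b i := y ord0 i - z ord0 i.
rewrite -[leRHS]ger0_norm ?addr_ge0 ?sqrtr_ge0// -sqrtr_sqr.
apply: ler_wsqrtr; rewrite sqrrD !sqr_sqrtr ?euclid_dist_sum_ge0//.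
have -> : \sum_(i < k) (x ord0 i - z ord0 i) ^+ 2 =
    \sum_i a i ^+ 2 + (\sum_i a i * b i) *+ 2 + \sum_i b i ^+ 2.
  rewrite -sumrMnl -!big_split; apply: eq_bigr => i _ /=; rewrite /a /b; ring.
rewrite lerD2r lerD2l lerMn2r /= -sqrtrM ?euclid_dist_sum_ge0//.
apply: (le_trans (ler_norm _)); rewrite -sqrtr_sqr.
exact/ler_wsqrtr/cauchy_schwarz.
Qed.

HB.instance Definition _ := Choice.on (euclid R k).
HB.instance Definition _ := isPointed.Build (euclid R k) (0 : 'rV[R]_k).
HB.instance Definition _ := isMetric.Build R (euclid R k)
  euclid_distxx euclid_dist_eq0 euclid_dist_sym euclid_dist_triangle.
HB.instance Definition _ := Measurable.copy (euclid R k)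
  (g_sigma_algebraType (@open (euclid R k))).
HB.instance Definition _ :=
  Metric_isBorel.Build _ R (euclid R k) erefl.

End euclid_metric.

Section distances.
Context {R : realType}.

Definition weak_cvg d (T : topMeasurableType d)
    (mu_ : nat -> probability T R) (mu : probability T R) :=
  forall f : T -> R, continuous f -> [bounded f x | x in [set: T]] ->
    (\int[mu_ n]_x (f x)%:E)%E @[n --> \oo] --> (\int[mu]_x (f x)%:E)%E.

Definition BL1 (D : metricType R) : set (D -> R) :=
  [set h | (forall x, -1 <= h x <= 1) /\
           (forall x y, `|h x - h y| <= mdist x y)].

Definition dBL d (D : borelMetricType d R)
    (P Q : {measure set D -> \bar R}) : \bar R :=
  ereal_sup [set `| \int[P]_x (h x)%:E - \int[Q]_x (h x)%:E |%E
            | h in @BL1 D].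

Definition lower_orthant k (x : euclid R k) : set (euclid R k) :=
  [set y | forall i, y ord0 i <= x ord0 i].

Definition dK k (P Q : {measure set (euclid R k) -> \bar R}) : \bar R :=
  ereal_sup [set `| P (lower_orthant x) - Q (lower_orthant x) |%E
            | x in [set: euclid R k]].

Definition joint_cdf k (P : probability (euclid R k) R) (x : euclid R k) : R :=
  fine (P (lower_orthant x)).

End distances.

(* Convergence in probability of Y to 0 along the filter F. For the distances
   below the event is measurable because the space is separable. *)
Definition cvg_in_probability0 d (Omega : measurableType d) (R : realType)
    (P : probability Omega R) I (F : set_system I)
    (Y : I -> Omega -> \bar R) :=
  forall e : R, 0 < e ->
    P [set w | (e%:E < `| Y i w |)%E] @[i --> F] --> 0%E.

Section power.
Context d (T : measurableType d) (R : realType) (P : probability T R).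

Definition cons_pair n (p : T * n.-tuple T) : n.+1.-tuple T :=
  [tuple of p.1 :: p.2].

Let measurable_cons_pair n :
  measurable_fun [set: T * n.-tuple T] (@cons_pair n).
Proof. exact: measurable_cons. Qed.

HB.instance Definition _ n :=
  isMeasurableFun.Build _ _ _ _ (@cons_pair n) (@measurable_cons_pair n).

(* the n-fold product measure of P *)
Fixpoint power_prob n : probability (n.-tuple T) R :=
  match n with
  | 0 => \d_[tuple]
  | m.+1 => distribution (P \x power_prob m)%E (@cons_pair m)
  end.

End power.

Section conditioning.
Context d (Omega : measurableType d) (R : realType) (P : probability Omega R).
Context d' (X : measurableType d') (Z : {RV P >-> X}).

(* x |-> g x is a version of P(A | Z = x) *)
Definition is_cond_prob (A : set Omega) (g : X -> R) :=
  [/\ measurable_fun [set: X] g,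
      P.-integrable [set: Omega] (fun w => (g (Z w))%:E) &
      forall C, measurable C ->
        (\int[P]_(w in Z @^-1` C) (g (Z w))%:E)%E = P (A `&` Z @^-1` C)].

Definition cond_independent d'' (D : measurableType d'')
    (Y : nat -> Omega -> D) :=
  forall (J : {fset nat}) (B : nat -> set D) (g : nat -> X -> R),
    (forall j, j \in J -> measurable (B j)) ->
    (forall j, j \in J -> is_cond_prob (Y j @^-1` B j) (g j)) ->
    is_cond_prob (\bigcap_(j in [set` J]) (Y j @^-1` B j))
                 (fun x => \prod_(j <- J) g j x).

End conditioning.

(* Replicates and weights are indexed from 0: index 0 is the superscript (1). *)
Record resampling_mechanism d (Omega : measurableType d) (R : realType)
    (P : probability Omega R) d' (D : borelMetricType d' R) := {
  data_disp : nat -> measure_display;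
  data_type : forall n, measurableType (data_disp n);
  weight_disp : nat -> measure_display;
  weight_type : forall n, measurableType (weight_disp n);
  data : forall n, {RV P >-> data_type n};
  weight : forall n, nat -> {RV P >-> weight_type n};
  weight_ident : forall n i A, measurable A ->
    P (weight n i @^-1` A) = P (weight n 0 @^-1` A);
  stat_fun : forall n, {mfun data_type n >-> D};
  rep_fun : forall n, nat -> {mfun (data_type n * weight_type n)%type >-> D};
  (* (X_n, S_n^(i)) and (X_n, S_n^(1)) have the same law, that is, the replicates
     share one conditional distribution given the data. [weight_ident] does
     not imply it: a weight may depend on the data. *)
  rep_ident : forall n i A B, measurable A -> measurable B ->
    P (data n @^-1` A `&`
       [set w | B (rep_fun n i (data n w, weight n i w))]) =
    P (data n @^-1` A `&`
       [set w | B (rep_fun n 0 (data n w, weight n 0 w))]);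
  rep_cond_independent : forall n, cond_independent (data n)
    (fun i w => rep_fun n i (data n w, weight n i w));
  (* regular conditional distribution of the first replicate given the data *)
  cond_dist : forall n, R.-pker data_type n ~> D;
  cond_distE : forall n A B, measurable A -> measurable B ->
    (\int[P]_(w in data n @^-1` A) cond_dist n (data n w) B)%E =
    P (data n @^-1` A `&`
       [set w | B (rep_fun n 0 (data n w, weight n 0 w))])
}.

Section statistics.
Context d (Omega : measurableType d) (R : realType) (P : probability Omega R).
Context d' (D : borelMetricType d' R) (rm : resampling_mechanism P D).

Definition stat n : Omega -> D := fun w => stat_fun rm n (data rm n w).

Definition rep n i : Omega -> D :=
  fun w => rep_fun rm n i (data rm n w, weight rm n i w).

Definition stat_rep M n : Omega -> M.+1.-tuple D :=
  fun w => [tuple of stat n w :: [tuple rep n (val i) w | i < M]].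

Let measurable_stat n : measurable_fun [set: Omega] (stat n).
Proof. by apply: measurableT_comp; exact: measurable_funPT. Qed.

HB.instance Definition _ n :=
  isMeasurableFun.Build _ _ _ _ (stat n) (measurable_stat n).

Let measurable_rep n i : measurable_fun [set: Omega] (rep n i).
Proof.
apply: (measurableT_comp (measurable_funPT (rep_fun rm n i))).
by apply: measurable_fun_pair; exact: measurable_funPT.
Qed.

HB.instance Definition _ n i :=
  isMeasurableFun.Build _ _ _ _ (rep n i) (measurable_rep n i).

Let measurable_stat_rep M n : measurable_fun [set: Omega] (stat_rep M n).
Proof.
apply: measurable_cons; first exact: measurable_stat.
apply/measurable_fun_tnthP => i.
apply: (eq_measurable_fun (rep n (val i))); last exact: measurable_rep.
by move=> w _; rewrite /= tnth_mktuple.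
Qed.

HB.instance Definition _ M n :=
  isMeasurableFun.Build _ _ _ _ (stat_rep M n) (@measurable_stat_rep M n).

Definition empirical n M (w : Omega) : {measure set D -> \bar R} :=
  mscale (M%:R^-1)%:nng (msum (fun i => \d_(rep n i w)) M).

Definition stat_weak_cvg (Q : probability D R) :=
  weak_cvg (fun n => distribution P (stat n)) Q.

Definition joint_weak_cvg (Q : probability D R) M :=
  weak_cvg (fun n => distribution P (stat_rep M n)) (power_prob Q M.+1).

Definition cond_cvg_BL :=
  cvg_in_probability0 P \oo
    (fun n w => dBL (cond_dist rm n (data rm n w)) (distribution P (stat n))).

Definition empirical_cvg_BL :=
  cvg_in_probability0 P (filter_prod \oo \oo)
    (fun nM w => dBL (empirical nM.1 nM.2 w) (distribution P (stat nM.1))).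

End statistics.

Section kolmogorov.
Context d (Omega : measurableType d) (R : realType) (P : probability Omega R).
Context k (rm : resampling_mechanism P (euclid R k)).

Definition cond_cvg_K :=
  cvg_in_probability0 P \oo
    (fun n w => dK (cond_dist rm n (data rm n w)) (distribution P (stat rm n))).

Definition empirical_cvg_K :=
  cvg_in_probability0 P (filter_prod \oo \oo)
    (fun nM w => dK (empirical rm nM.1 nM.2 w) (distribution P (stat rm nM.1))).

End kolmogorov.

(* Main.v *)
Require Import Defs.
From HB Require Import structures.
From mathcomp Require Import all_boot all_order all_algebra finmap.
From mathcomp Require Import all_classical all_reals all_analysis.
From mathcomp Require Import measurable_realfun ring lra.

Set Implicit Arguments.
Unset Strict Implicit.
Unset Printing Implicit Defensive.

Import Order.TTheory GRing.Theory Num.Theory.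
Import numFieldNormedType.Exports.

Local Open Scope classical_set_scope.
Local Open Scope ring_scope.

(* Write K_n for the conditional law of a replicate given the data, Q for the
   law of S, and, for a class G of functions into [0, 1], let C(G) be the
   property that E |K_n g - Q g| -> 0 for every g in G.

   The metrics d_BL and d_K are suprema of |P h - P' h| over a class H. Up to
   a small error, this supremum is controlled by finitely many functions of a
   suitable class G, uniformly in P and P': for d_BL, G consists of Lipschitz
   functions forming a partition of unity off a set of small Q-mass (no
   tightness is needed), or, in R^k, of indicators of cubes; for d_K, of
   indicators of lower orthants, by compactness of a large cube and continuity
   of the distribution function. Hence C(G) implies that the H-distance of K_n
   to the law of S_n tends to 0 in probability, and conversely this implies
   C(H). For the empirical measure of M replicates, conditional independence
   gives |E (emp h - c)^2 - E (K_n h - c)^2| <= 1 / M, so that empirical and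
   conditional convergence are equivalent to the same property C.

   The joint convergence of (S_n, S_n^(1), S_n^(2)) yields C(Lipschitz) by
   expanding E (K_n h - Q h)^2; conversely C(Lipschitz) yields the convergence
   of expectations of products of Lipschitz functions, hence, by partitions of
   unity, of Lipschitz functions of tuples and then of all bounded continuous
   ones. In R^k, C(Lipschitz) implies C(orthants) by sandwiching when the
   distribution function is continuous, and C(orthants) implies C(cubes) by
   inclusion-exclusion. *)

(** * Bounded measurable functions *)

(** Everything is compared with the fixed law Q rather than with the law of S_n, because a partition
    or a grid can be fitted to one measure only; the weak convergence of S_n then brings the law of
    S_n back to Q. Once the finite family is chosen no supremum is left, and for bounded variables
    convergence in probability, in L1 and in L2 are the same.

    Test functions take values in [0, 1] so that a product changes by at most the sum of the changes
    of its factors. This serves both the passage from sets to functions in conditional independence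
    and the limit of joint expectations; it also keeps the diagonal terms of the second moment below
    1.

    Two measurability obstacles shape the proof. Monotonicity and Markov's inequality are applied to
    events about d_BL and d_K, suprema over uncountable classes, which must first be rewritten as
    countable suprema. On tuples the topology and the sigma-algebra are given separately, so that
    even a continuous function has to be proved measurable. *)

Definition bounded_measurable d (T : measurableType d) (R : realType)
    (f : T -> R) :=
  measurable_fun [set: T] f /\ exists B, forall x, `|f x| <= B.

Section bounded_measurable.
Context d (T : measurableType d) (R : realType).
Implicit Types f g : T -> R.
Local Notation bm := (@bounded_measurable d T R).

Lemma bounded_measurable_cst (c : R) : bm (fun=> c).
Proof. by split; [exact: measurable_cst|exists `|c|]. Qed.

Lemma bounded_measurableD f g : bm f -> bm g -> bm (fun x => f x + g x).
Proof.
move=> [mf [B fB]] [mg [C gC]]; split; first exact: measurable_funD.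
by exists (B + C) => x; rewrite (le_trans (ler_normD _ _))// lerD.
Qed.

Lemma bounded_measurableM f g : bm f -> bm g -> bm (fun x => f x * g x).
Proof.
move=> [mf [B fB]] [mg [C gC]]; split; first exact: measurable_funM.
by exists (B * C) => x; rewrite normrM ler_pM.
Qed.

Lemma bounded_measurableN f : bm f -> bm (fun x => - f x).
Proof.
by move=> [mf [B fB]]; split; [exact: measurableT_comp|exists B => x; rewrite normrN].
Qed.

Lemma bounded_measurableB f g : bm f -> bm g -> bm (fun x => f x - g x).
Proof. by move=> bf bg; apply/bounded_measurableD/bounded_measurableN. Qed.

Lemma bounded_measurable_norm f : bm f -> bm (fun x => `|f x|).
Proof.
move=> [mf [B fB]]; split; first exact: measurableT_comp.
by exists B => x; rewrite normr_id.
Qed.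

Lemma bounded_measurableX f n : bm f -> bm (fun x => f x ^+ n).
Proof.
move=> bf; elim: n => [|n ih].
  by rewrite [X in bm X](_ : _ = fun=> 1);
    [exact: bounded_measurable_cst|apply/funext => x; rewrite expr0].
rewrite [X in bm X](_ : _ = fun x => f x * f x ^+ n).
  exact: bounded_measurableM.
by apply/funext => x; rewrite exprS.
Qed.

Lemma bounded_measurable_sum I (s : seq I) (F : I -> T -> R) :
  (forall i, bm (F i)) -> bm (fun x => \sum_(i <- s) F i x).
Proof.
move=> bF; elim: s => [|i s ih].
  by rewrite [X in bm X](_ : _ = fun=> 0);
    [exact: bounded_measurable_cst|apply/funext => x; rewrite big_nil].
rewrite [X in bm X](_ : _ = fun x => F i x + \sum_(i <- s) F i x).
  exact: bounded_measurableD.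
by apply/funext => x; rewrite big_cons.
Qed.

Lemma bounded_measurable_prod I (s : seq I) (F : I -> T -> R) :
  (forall i, bm (F i)) -> bm (fun x => \prod_(i <- s) F i x).
Proof.
move=> bF; elim: s => [|i s ih].
  by rewrite [X in bm X](_ : _ = fun=> 1);
    [exact: bounded_measurable_cst|apply/funext => x; rewrite big_nil].
rewrite [X in bm X](_ : _ = fun x => F i x * \prod_(i <- s) F i x).
  exact: bounded_measurableM.
by apply/funext => x; rewrite big_cons.
Qed.

Lemma bounded_measurable_indic (A : set T) : measurable A -> bm \1_A.
Proof.
move=> mA; split; first exact: measurable_indic.
by exists 1 => x; rewrite indicE; case: (x \in A); rewrite ?normr1// normr0.
Qed.

Lemma bounded_measurable_comp d' (T' : measurableType d') (g : T' -> T) f :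
  measurable_fun setT g -> bm f -> bounded_measurable (fun x => f (g x)).
Proof.
by move=> mg [mf [B fB]]; split; [exact: (measurableT_comp mf)|exists B].
Qed.

Lemma bounded_measurable01 f :
  measurable_fun setT f -> (forall x, 0 <= f x <= 1) -> bm f.
Proof.
move=> mf f01; split=> //; exists 1 => x.
by have /andP[f0 f1] := f01 x; rewrite ger0_norm.
Qed.

End bounded_measurable.

(** Base points, such as those that the dense sequences start from, are drawn from the total
    mass. *)
Lemma nonempty_of_probability d (T : measurableType d) (R : realType)
    (mu : {measure set T -> \bar R}) : mu [set: T] = 1%E -> [set: T] !=set0.
Proof.
move=> mu1; apply/set0P/eqP => T0; move: mu1.
by rewrite T0 measure0 => /eqP; rewrite eqe eq_sym oner_eq0.
Qed.

Section probability_integral.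
Context d (T : measurableType d) (R : realType).
Variable mu : {measure set T -> \bar R}.
Hypothesis mu1 : mu [set: T] = 1%E.
Implicit Types f g : T -> R.
Local Notation bm := (@bounded_measurable d T R).
Local Notation E f := (Rintegral mu setT f).

Lemma bounded_measurable_integrable f : bm f -> mu.-integrable setT (EFin \o f).
Proof.
move=> [mf [B fB]]; apply: measurable_bounded_integrable => //.
  by rewrite mu1 ltry.
by exists B; split=> [|M BM x _]; [exact: num_real|rewrite /= (le_trans (fB x))// ltW].
Qed.

Lemma Rintegral_EFin f : bm f -> (\int[mu]_x (f x)%:E)%E = (E f)%:E.
Proof.
move=> bf; rewrite /Rintegral fineK//.
exact: integrable_fin_num (bounded_measurable_integrable bf).
Qed.

Lemma bmRintegralD f g : bm f -> bm g -> E (fun x => f x + g x) = E f + E g.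
Proof. by move=> bf bg; rewrite RintegralD//; exact: bounded_measurable_integrable. Qed.

Lemma bmRintegralB f g : bm f -> bm g -> E (fun x => f x - g x) = E f - E g.
Proof. by move=> bf bg; rewrite RintegralB//; exact: bounded_measurable_integrable. Qed.

Lemma bmRintegralZ c f : bm f -> E (fun x => c * f x) = c * E f.
Proof. by move=> bf; rewrite RintegralZl//; exact: bounded_measurable_integrable. Qed.

Lemma bmRintegral_cst c : E (fun=> c) = c.
Proof. by rewrite Rintegral_cst// mu1 mulr1. Qed.

Lemma bmRintegral_sum I (s : seq I) (F : I -> T -> R) : (forall i, bm (F i)) ->
  E (fun x => \sum_(i <- s) F i x) = \sum_(i <- s) E (F i).
Proof.
move=> bF; elim: s => [|i s ih].
  rewrite big_nil -[RHS]bmRintegral_cst; congr (Rintegral _ _ _).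
  by apply/funext => x; rewrite big_nil.
rewrite big_cons -ih -bmRintegralD//; last exact: bounded_measurable_sum.
by congr (Rintegral _ _ _); apply/funext => x; rewrite big_cons.
Qed.

Lemma le_bmRintegral f g : bm f -> bm g -> (forall x, f x <= g x) -> E f <= E g.
Proof.
move=> bf bg fg.
by apply: le_Rintegral => //; exact: bounded_measurable_integrable.
Qed.

Lemma le_norm_bmRintegral f : bm f -> `|E f| <= E (fun x => `|f x|).
Proof.
move=> bf.
by apply: le_normr_Rintegral => //; exact: bounded_measurable_integrable.
Qed.

Lemma bmRintegral_bound f B : bm f -> (forall x, `|f x| <= B) -> `|E f| <= B.
Proof.
move=> bf fB; rewrite (le_trans (le_norm_bmRintegral bf))//.
rewrite -[leRHS]bmRintegral_cst le_bmRintegral//.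
- exact: bounded_measurable_norm.
- exact: bounded_measurable_cst.
Qed.

Lemma bmRintegral01 f : bm f -> (forall x, 0 <= f x <= 1) -> 0 <= E f <= 1.
Proof.
move=> bf f01; apply/andP; split.
  by apply: Rintegral_ge0 => x _; have /andP[] := f01 x.
rewrite -[leRHS]bmRintegral_cst le_bmRintegral//.
- exact: bounded_measurable_cst.
- by move=> x; have /andP[] := f01 x.
Qed.

Lemma le_dist_bmRintegral f g B : bm f -> bm g ->
  (forall x, `|f x - g x| <= B) -> `|E f - E g| <= B.
Proof.
move=> bf bg fgB; rewrite -bmRintegralB//.
by apply: bmRintegral_bound => //; exact: bounded_measurableB.
Qed.

Lemma Rintegral_indic (A : set T) : measurable A -> E \1_A = fine (mu A).
Proof. by move=> mA; rewrite /Rintegral integral_indic// setIT. Qed.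

End probability_integral.

(** * Integral probability metrics *)

(* [dBL] and [dK] are both of this form. *)
Definition ipm d (T : measurableType d) (R : realType) (H : set (T -> R))
    (P Q : {measure set T -> \bar R}) : \bar R :=
  ereal_sup [set `| \int[P]_x (h x)%:E - \int[Q]_x (h x)%:E |%E | h in H].

(** The family [g] does not depend on any measure. By dominated convergence the supremum in [ipm]
    can be taken over it for all pairs of probability measures at once, which makes [ipm H (mu w) Q]
    measurable in [w]. *)
Definition pointwise_separable T (R : realType) (H : set (T -> R)) :=
  exists2 g : nat -> T -> R, forall n, H (g n) &
    forall h, H h -> exists s : nat -> nat,
      forall x, g (s m) x @[m --> \oo] --> h x.

(** Covers both the conditional law and the empirical measure. The latter has mass 0 when [M = 0],
    so later statements ask for this property only eventually along the filter. *)
Definition random_probability d (Omega : measurableType d) d'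
    (T : measurableType d') (R : realType)
    (mu : Omega -> {measure set T -> \bar R}) :=
  (forall w, mu w [set: T] = 1%E) /\
  (forall h, bounded_measurable h ->
     measurable_fun [set: Omega] (fun w => \int[mu w]_x h x)).

Section ipm.
Context d (T : measurableType d) (R : realType) (H : set (T -> R)).
Hypothesis mH : forall h, H h -> measurable_fun [set: T] h.
Hypothesis H1 : forall h, H h -> forall x, `|h x| <= 1.

Lemma ipm_bounded_measurable h : H h -> bounded_measurable h.
Proof. by move=> Hh; split; [exact: mH|exists 1; exact: H1]. Qed.

Lemma ipm_ge (P Q : {measure set T -> \bar R}) h : H h ->
  P setT = 1%E -> Q setT = 1%E ->
  ((`|\int[P]_x h x - \int[Q]_x h x|)%:E <= ipm H P Q)%E.
Proof.
move=> Hh P1 Q1; apply: ereal_sup_ubound; exists h => //.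
by rewrite !Rintegral_EFin//; exact: ipm_bounded_measurable.
Qed.

Lemma ipm_le (P Q : {measure set T -> \bar R}) (c : R) :
  P setT = 1%E -> Q setT = 1%E ->
  (forall h, H h -> `|\int[P]_x h x - \int[Q]_x h x| <= c) ->
  (ipm H P Q <= c%:E)%E.
Proof.
move=> P1 Q1 Hc; apply: ge_ereal_sup => _ [h Hh <-].
by rewrite !Rintegral_EFin//; [exact: Hc|exact: ipm_bounded_measurable..].
Qed.

Lemma cvg_bmRintegral (P : {measure set T -> \bar R}) (f : nat -> T -> R) g B :
  P setT = 1%E ->
  (forall n, measurable_fun setT (f n)) -> (forall n x, `|f n x| <= B) ->
  (forall x, f n x @[n --> \oo] --> g x) ->
  \int[P]_x f n x @[n --> \oo] --> \int[P]_x g x.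
Proof.
move=> P1 mf f1 fg.
have mg : measurable_fun setT g by apply: (measurable_fun_cvg mf) => x _; exact: fg.
have g1 x : `|g x| <= B.
  have cg : `|f n x| @[n --> \oo] --> `|g x| by apply: cvg_norm; exact: fg.
  rewrite -(cvg_lim _ cg)//.
  apply: limr_le; last by apply: nearW => n; exact: f1.
  by apply/cvg_ex; eexists; exact: cg.
have bg : bounded_measurable g by split=> //; exists B.
have bf n : bounded_measurable (f n) by split=> //; exists B.
have [|||||_ _] := @dominated_convergence _ _ _ P setT measurableT
  (fun n x => (f n x)%:E) (fun x => (g x)%:E) (fun=> B%:E).
- by move=> n; apply/measurable_EFinP.
- exact/measurable_EFinP.
- by apply: aeW => x _; apply: cvg_EFin; [exact: nearW|exact: fg].
- exact: (bounded_measurable_integrable P1 (bounded_measurable_cst _ B)).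
- by apply: aeW => x n _; rewrite lee_fin.
by rewrite Rintegral_EFin// => Pfg; apply: fine_cvg; exact: Pfg.
Qed.

Lemma ipm_pointwise_separable (P Q : {measure set T -> \bar R}) g :
  P setT = 1%E -> Q setT = 1%E -> (forall n, H (g n)) ->
  (forall h, H h -> exists s : nat -> nat,
      forall x, g (s m) x @[m --> \oo] --> h x) ->
  ipm H P Q =
  ereal_sup (range (fun n => (`|\int[P]_x g n x - \int[Q]_x g n x|)%:E)).
Proof.
move=> P1 Q1 Hg gH; apply/eqP; rewrite eq_le; apply/andP; split; last first.
  by apply: ge_ereal_sup => _ [n _ <-]; exact: ipm_ge.
apply: ge_ereal_sup => _ [h Hh <-].
have bh := ipm_bounded_measurable Hh.
rewrite !Rintegral_EFin//=.
have [s gs] := gH _ Hh.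
have cv (M : {measure set T -> \bar R}) : M setT = 1%E ->
    \int[M]_x g (s n) x @[n --> \oo] --> \int[M]_x h x.
  move=> M1; apply: (cvg_bmRintegral (B := 1)) => // n; first exact: mH.
  exact: H1.
have cE : (`|\int[P]_x g (s n) x - \int[Q]_x g (s n) x|)%:E @[n --> \oo] -->
    (`|\int[P]_x h x - \int[Q]_x h x|)%:E.
  by apply: cvg_EFin; [exact: nearW|apply: cvg_norm; apply: cvgB; exact: cv].
rewrite -(cvg_lim _ cE)//.
apply: lime_le; first by apply/cvg_ex; eexists; exact: cE.
by apply: nearW => n; apply: ereal_sup_ubound; exists (s n).
Qed.

Lemma ipm_measurable d' (Omega : measurableType d')
    (mu : Omega -> {measure set T -> \bar R}) (Q : {measure set T -> \bar R}) (e : R) :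
  pointwise_separable H -> random_probability mu -> Q setT = 1%E ->
  measurable [set w | (e%:E < `|ipm H (mu w) Q|)%E].
Proof.
move=> [g Hg gH] [mu1 mmu] Q1.
pose f n w := (`|\int[mu w]_x g n x - \int[Q]_x g n x|)%:E : \bar R.
have fE w : ipm H (mu w) Q = ereal_sup (range (f ^~ w)).
  exact: ipm_pointwise_separable.
have mf : measurable_fun setT (fun w => `|ipm H (mu w) Q|%E).
  apply: measurableT_comp => //.
  rewrite [X in measurable_fun _ X](_ : _ = fun w => esups (f ^~ w) 0%N).
    apply: measurable_fun_esups => n; apply/measurable_EFinP.
    apply: measurableT_comp => //; apply: measurable_funB => //.
    exact/mmu/ipm_bounded_measurable.
  apply/funext => w; rewrite fE /esups; congr ereal_sup.
  by apply/seteqP; split=> [_ [n _ <-]|_ [n _ <-]]; exists n.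
rewrite -[X in measurable X]setTI.
by apply: (emeasurable_fun_o_infty measurableT mf).
Qed.

End ipm.

Definition L1_cvg d (Omega : measurableType d) (R : realType)
    (P : probability Omega R) I (F : set_system I) d' (T : measurableType d')
    (mu : I -> Omega -> {measure set T -> \bar R})
    (Q : {measure set T -> \bar R}) (h : T -> R) :=
  \int[P]_w `|\int[mu i w]_x h x - \int[Q]_x h x| @[i --> F] --> (0 : R).

(** * Means and tail probabilities of bounded variables *)

Section truncation.
Context d (Omega : measurableType d) (R : realType) (P : probability Omega R).
Implicit Types (Z : Omega -> R).

Let measurable_gt Z c : bounded_measurable Z -> measurable [set w | c < Z w].
Proof.
move=> [mZ _]; rewrite -[X in measurable X]setTI.
by rewrite -preimage_itvoy; apply: mZ => //; exact: measurable_itv.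
Qed.

Lemma bounded_markov Z c : bounded_measurable Z -> (forall w, 0 <= Z w) ->
  c * fine (P [set w | c < Z w]) <= \int[P]_w Z w.
Proof.
move=> bZ Z0; have mA := measurable_gt c bZ.
have P1 : P setT = 1%E := probability_setT P.
have bA := bounded_measurable_indic R mA.
rewrite -Rintegral_indic// -(bmRintegralZ P1)//.
apply: (le_bmRintegral P1) => //.
  by apply: bounded_measurableM => //; exact: bounded_measurable_cst.
move=> w; rewrite indicE; have [|_] := boolP (w \in _); last by rewrite mulr0.
by rewrite inE/= mulr1 => /ltW.
Qed.

(** The converse of Markov's inequality for bounded variables: [Z] is at most [c], except on the
    event where it exceeds [c], and there it is at most [B]. *)
Lemma bounded_integral_le Z c B : bounded_measurable Z -> 0 <= B -> 0 <= c ->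
  (forall w, Z w <= B) ->
  \int[P]_w Z w <= c + B * fine (P [set w | c < Z w]).
Proof.
move=> bZ B0 c0 ZB; have mA := measurable_gt c bZ.
have P1 : P setT = 1%E := probability_setT P.
have bA := bounded_measurable_indic R mA.
have bBA : bounded_measurable (fun w => B * \1_[set w | c < Z w] w).
  by apply: bounded_measurableM => //; exact: bounded_measurable_cst.
rewrite -Rintegral_indic// -(bmRintegralZ P1)// -{1}(bmRintegral_cst P1 c).
rewrite -(bmRintegralD P1)//; last exact: bounded_measurable_cst.
apply: (le_bmRintegral P1) => //.
  by apply: bounded_measurableD => //; exact: bounded_measurable_cst.
move=> w; rewrite indicE; have [|] := boolP (w \in _).
  by rewrite mulr1 => _; rewrite (le_trans (ZB w))// lerDr.
by rewrite notin_setE/= mulr0 addr0 => /negP; rewrite -leNgt.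
Qed.

Lemma le_probability_fine (A B : set Omega) : measurable A -> measurable B ->
  A `<=` B -> fine (P A) <= fine (P B).
Proof.
move=> mA mB AB; apply: fine_le; rewrite ?fin_num_measure//.
by apply: le_measure => //; rewrite inE.
Qed.

Lemma probability_cvg0 I (F : set_system I) (FF : Filter F) (A : I -> set Omega) :
  (\forall i \near F, measurable (A i)) ->
  P (A i) @[i --> F] --> 0%E <-> fine (P (A i)) @[i --> F] --> (0 : R).
Proof.
move=> mA; split=> [PA|PA]; first exact: fine_cvg.
have : (fine (P (A i)))%:E @[i --> F] --> (0 : R)%:E.
  by apply: cvg_EFin; [exact: nearW|exact: PA].
apply: cvg_trans; apply: near_eq_cvg.
by near=> i; rewrite fineK// fin_num_measure//; near: i.
Unshelve. all: by end_near. Qed.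

End truncation.

Lemma ge0_cvg0P I (F : set_system I) (FF : Filter F) (R : realType) (u : I -> R) :
  (forall i, 0 <= u i) ->
  u i @[i --> F] --> (0 : R) <->
  forall e, 0 < e -> \forall i \near F, u i <= e.
Proof.
move=> u0; split=> [/cvgrPdist_le uc e e0|ue].
  by near do rewrite -[u _]ger0_norm// -normrN -sub0r; exact: uc.
apply/cvgrPdist_le => e e0.
by near do rewrite sub0r normrN ger0_norm//; exact: ue.
Unshelve. all: by end_near. Qed.

Lemma cvg_rsum I (F : set_system I) (FF : Filter F) (R : realType) (K : Type)
    (s : seq K) (u : K -> I -> R) (l : K -> R) :
  (forall k, u k i @[i --> F] --> l k) ->
  \sum_(k <- s) u k i @[i --> F] --> \sum_(k <- s) l k.
Proof.
by move=> ul; apply: cvg_big => [|k _]; [exact: add_continuous|exact: ul].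
Qed.

(** The family and [C] are chosen before [P] and [h], so they serve every realization of a random
    measure. One argument is frozen at [Q]; two varying measures are compared through [Q]. *)
Definition finitely_controlled d (T : measurableType d) (R : realType)
    (H G : set (T -> R)) (Q : {measure set T -> \bar R}) :=
  forall e : R, 0 < e ->
  exists (K : finType) (phi : K -> T -> R) (C : R),
    [/\ 0 <= C, forall k, G (phi k) &
      forall P : {measure set T -> \bar R}, P setT = 1%E ->
      forall h, H h ->
        `|\int[P]_x h x - \int[Q]_x h x| <=
        e + C * \sum_k `|\int[P]_x phi k x - \int[Q]_x phi k x|].

(** * From finitely many test functions to integral probability metrics, and back *)

Section ipm_convergence.
Context d (Omega : measurableType d) (R : realType) (P : probability Omega R).
Context I (F : set_system I) {FF : Filter F} d' (T : measurableType d').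
Variables (mu : I -> Omega -> {measure set T -> \bar R}).
Hypothesis rmu : \forall i \near F, random_probability (mu i).
Variable Q : probability T R.
Implicit Types h : T -> R.

Let Q1 : Q setT = 1%E := probability_setT Q.
Let P1 : P setT = 1%E := probability_setT P.

Lemma L1_cvgP h : L1_cvg P F mu Q h <-> forall e, 0 < e ->
  \forall i \near F, \int[P]_w `|\int[mu i w]_x h x - \int[Q]_x h x| <= e.
Proof. by apply: ge0_cvg0P => i; exact: Rintegral_ge0. Qed.

Lemma bounded_measurable_random (m : Omega -> {measure set T -> \bar R}) h :
  random_probability m -> bounded_measurable h ->
  bounded_measurable (fun w => \int[m w]_x h x).
Proof.
move=> [m1 mm] bh; split; first exact: mm.
by have [_ [B hB]] := bh; exists B => w; exact: bmRintegral_bound.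
Qed.

Lemma bounded_measurable_random_dist (m : Omega -> {measure set T -> \bar R}) h c :
  random_probability m -> bounded_measurable h ->
  bounded_measurable (fun w => `|\int[m w]_x h x - c|).
Proof.
move=> rm bh; apply/bounded_measurable_norm/bounded_measurableB.
  exact: bounded_measurable_random.
exact: bounded_measurable_cst.
Qed.

Lemma L1_cvg_sum (K : finType) (phi : K -> T -> R) :
  (forall k, bounded_measurable (phi k)) ->
  (forall k, L1_cvg P F mu Q (phi k)) ->
  \int[P]_w \sum_k `|\int[mu i w]_x phi k x - \int[Q]_x phi k x| @[i --> F]
    --> (0 : R).
Proof.
move=> bphi cphi.
have : \sum_k \int[P]_w `|\int[mu i w]_x phi k x - \int[Q]_x phi k x| @[i --> F]
    --> \sum_(k : K) (0 : R).
  by apply: cvg_rsum => k; exact: cphi.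
rewrite big1_eq; apply: cvg_trans; apply: near_eq_cvg.
near=> i; rewrite (bmRintegral_sum P1)// => k.
by apply: bounded_measurable_random_dist => //; near: i.
Unshelve. all: by end_near. Qed.

(** Serves twice: to undo the scaling of a Lipschitz function into [BL1], and to pass from orthants
    to cubes. *)
Lemma L1_cvg_lincomb (K : finType) (phi : K -> T -> R) (c : K -> R) h :
  (forall k, bounded_measurable (phi k)) ->
  (forall x, h x = \sum_k c k * phi k x) ->
  (forall k, L1_cvg P F mu Q (phi k)) -> L1_cvg P F mu Q h.
Proof.
move=> bphi hE cphi; have -> : h = (fun x => \sum_k c k * phi k x) by exact/funext.
have bc k : bounded_measurable (fun x => c k * phi k x).
  exact: (bounded_measurableM (bounded_measurable_cst _ _) (bphi k)).
have cc k : L1_cvg P F mu Q (fun x => c k * phi k x).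
  have : `|c k| * \int[P]_w `|\int[mu i w]_x phi k x - \int[Q]_x phi k x| @[i --> F]
      --> `|c k| * 0.
    by apply: cvgM; [exact: cvg_cst|exact: cphi].
  rewrite mulr0; apply: cvg_trans; apply: near_eq_cvg.
  near=> i; have ri : random_probability (mu i) by near: i.
  rewrite -(bmRintegralZ P1); last exact: bounded_measurable_random_dist.
  apply: eq_Rintegral => w _; rewrite !bmRintegralZ//; last exact: ri.1.
  by rewrite -mulrBr normrM.
apply/L1_cvgP => e e0.
have /ge0_cvg0P /(_ _ e0) := L1_cvg_sum bc cc.
have s0 i : 0 <= \int[P]_w \sum_k
    `|\int[mu i w]_x (c k * phi k x) - \int[Q]_x (c k * phi k x)|.
  by apply: Rintegral_ge0 => w _; apply: sumr_ge0.
move=> /(_ s0); apply: filterS2 rmu => i ri; apply: le_trans.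
apply: (le_bmRintegral P1).
- by apply: bounded_measurable_random_dist => //; exact: bounded_measurable_sum.
- by apply: bounded_measurable_sum => k; exact: bounded_measurable_random_dist.
move=> w; rewrite !bmRintegral_sum//; last exact: ri.1.
by rewrite -sumrB; exact: ler_norm_sum.
Unshelve. all: by end_near. Qed.

Variable nu : I -> probability T R.
Variable H : set (T -> R).
Hypothesis mH : forall h, H h -> measurable_fun [set: T] h.
Hypothesis H1 : forall h, H h -> forall x, `|h x| <= 1.
Hypothesis sH : pointwise_separable H.

Lemma ipm_cvg (G : set (T -> R)) :
  finitely_controlled H G Q ->
  (forall phi, G phi -> bounded_measurable phi) ->
  (forall phi, G phi -> L1_cvg P F mu Q phi) ->
  (forall phi, G phi ->
    \int[nu i]_x phi x @[i --> F] --> \int[Q]_x phi x) ->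
  cvg_in_probability0 P F (fun i w => ipm H (mu i w) (nu i)).
Proof.
move=> cH bG muG nuG e e0.
have nu1 i : nu i setT = 1%E := probability_setT (nu i).
have mE : \forall i \near F, measurable [set w | (e%:E < `|ipm H (mu i w) (nu i)|)%E].
  apply: filterS rmu => i ri.
  exact: (@ipm_measurable _ _ _ H mH H1 _ _ (mu i) (nu i) _ sH ri (nu1 i)).
apply/probability_cvg0 => //; apply/ge0_cvg0P => [i|d0 d0_gt0].
  by rewrite fine_ge0.
have e4 : 0 < e / 4 by rewrite divr_gt0.
have [K [phi [C [C0 Gphi Hphi]]]] := cH _ e4.
have cmu := L1_cvg_sum (fun k => bG _ (Gphi k)) (fun k => muG _ (Gphi k)).
have cnu : \sum_k `|\int[nu i]_x phi k x - \int[Q]_x phi k x| @[i --> F] --> (0 : R).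
  have : \sum_k `|\int[nu i]_x phi k x - \int[Q]_x phi k x| @[i --> F] -->
      \sum_(k : K) `|\int[Q]_x phi k x - \int[Q]_x phi k x|.
    apply: cvg_rsum => k; apply: cvg_norm; apply: cvgB; last exact: cvg_cst.
    exact/nuG.
  by under [X in _ --> X]eq_bigr do rewrite subrr normr0; rewrite big1_eq.
pose Z i w := \sum_k `|\int[mu i w]_x phi k x - \int[Q]_x phi k x|.
have Z0 i w : 0 <= Z i w by apply: sumr_ge0.
pose z i := \sum_k `|\int[nu i]_x phi k x - \int[Q]_x phi k x|.
have z0 i : 0 <= z i by apply: sumr_ge0.
(* Finite control is used for [mu i w] and for [nu i], at a cost of [e / 4] each; keeping [Z] and
   [z] below [c] costs [C * c <= e / 4] each, in total [e]. The divisor [C + 1] is positive even if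
   [C = 0]. *)
pose c := e / 4 / (C + 1).
have C10 : 0 < C + 1 by rewrite ltr_wpDl.
have c0 : 0 < c by rewrite divr_gt0.
have cE : C * c <= e / 4.
  by rewrite /c mulrCA ler_piMr ?(ltW e4)// ler_pdivrMr// mul1r lerDl.
(* A mean of at most [c * d0] makes Markov's inequality at level [c] yield the probability [d0]. *)
have /ge0_cvg0P /(_ _ (mulr_gt0 c0 d0_gt0)) := cmu.
move=> /(_ (fun i => Rintegral_ge0 P (fun w _ => Z0 i w))) cZ.
have /ge0_cvg0P /(_ _ c0) := cnu; move=> /(_ z0) cz.
near=> i; have ri : random_probability (mu i) by near: i.
have bZ : bounded_measurable (Z i).
  apply: bounded_measurable_sum => k; apply: bounded_measurable_random_dist => //.
  exact: bG.
have mZ : measurable [set w | c < Z i w].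
  rewrite -[X in measurable X]setTI -preimage_itvoy.
  by apply: (bZ.1) => //; exact: measurable_itv.
apply: (@le_trans _ _ (fine (P [set w | c < Z i w]))).
  apply: le_probability_fine => //; first by near: i.
  move=> w /=; apply: contraPP => /negP; rewrite -leNgt => Zc; apply/negP.
  have ub : (ipm H (mu i w) (nu i) <= e%:E)%E.
    apply: (ipm_le mH H1 (ri.1 w) (nu1 i)).
    move=> h Hh; rewrite (le_trans (ler_distD (\int[Q]_x h x) _ _))//.
    rewrite [X in _ + X]distrC.
    have h1 := Hphi _ (ri.1 w) _ Hh; have h2 := Hphi _ (nu1 i) _ Hh.
    have h3 : C * Z i w <= C * c by rewrite ler_wpM2l.
    have h4 : C * z i <= C * c by rewrite ler_wpM2l//; near: i.
    rewrite -/(Z i w) in h1; rewrite -/(z i) in h2; lra.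
  rewrite -leNgt gee0_abs//.
  have [g Hg _] := sH; apply: le_trans (ipm_ge mH H1 (Hg 0%N) (ri.1 w) (nu1 i)).
  by rewrite lee_fin.
rewrite -(ler_pM2l c0); apply: (le_trans (bounded_markov P c bZ (Z0 i))).
by near: i.
Unshelve. all: by end_near. Qed.

Lemma ipm_cvg_L1_cvg h : H h ->
  cvg_in_probability0 P F (fun i w => ipm H (mu i w) (nu i)) ->
  \int[nu i]_x h x @[i --> F] --> \int[Q]_x h x -> L1_cvg P F mu Q h.
Proof.
move=> Hh cH nuh; apply/L1_cvgP => e e0.
have nu1 i : nu i setT = 1%E := probability_setT (nu i).
(* The gap between [nu i] and [Q] takes [e / 4]. The rest is [e / 4 + 2 * (e / 4)]: [Z] is at most 2
   and exceeds [e / 4] with probability at most [e / 4]. *)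
have e4 : 0 < e / 4 by rewrite divr_gt0.
have bh := ipm_bounded_measurable mH H1 Hh.
have mE : \forall i \near F,
    measurable [set w | ((e / 4)%:E < `|ipm H (mu i w) (nu i)|)%E].
  apply: filterS rmu => i ri.
  exact: (@ipm_measurable _ _ _ H mH H1 _ _ (mu i) (nu i) _ sH ri (nu1 i)).
have /probability_cvg0 := cH _ e4.
move=> /(_ mE) cP.
have {}cP := (ge0_cvg0P FF (fun i => fine_ge0 (measure_ge0 P _))).1 cP _ e4.
have {}nuh : \forall i \near F, `|\int[Q]_x h x - \int[nu i]_x h x| <= e / 4.
  by have /cvgrPdist_le := nuh; apply.
near=> i; have ri : random_probability (mu i) by near: i.
pose Z w := `|\int[mu i w]_x h x - \int[nu i]_x h x|.
have bZ : bounded_measurable Z by exact: bounded_measurable_random_dist.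
have Z2 w : Z w <= 2.
  rewrite (le_trans (ler_normB _ _))// -[leRHS]/(1 + 1) lerD//.
    exact: (bmRintegral_bound (ri.1 w) bh (H1 Hh)).
  exact: (bmRintegral_bound (nu1 i) bh (H1 Hh)).
apply: (@le_trans _ _ (\int[P]_w (Z w + e / 4))).
  apply: (le_bmRintegral P1).
  - exact: bounded_measurable_random_dist.
  - by apply: bounded_measurableD => //; exact: bounded_measurable_cst.
  move=> w; rewrite (le_trans (ler_distD (\int[nu i]_x h x) _ _))// lerD2l distrC.
  by near: i.
rewrite (bmRintegralD P1)//; last exact: bounded_measurable_cst.
rewrite (bmRintegral_cst P1).
have := bounded_integral_le P bZ (ler0n _ 2) (ltW e4) Z2.
have : fine (P [set w | e / 4 < Z w]) <=
    fine (P [set w | ((e / 4)%:E < `|ipm H (mu i w) (nu i)|)%E]).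
  apply: le_probability_fine => //.
  - rewrite -[X in measurable X]setTI -preimage_itvoy.
    by apply: (bZ.1) => //; exact: measurable_itv.
  - by near: i.
  move=> w /= eZ; rewrite (lt_le_trans _ (lee_abs _))//.
  by rewrite (lt_le_trans _ (ipm_ge mH H1 Hh (ri.1 w) (nu1 i)))// lte_fin.
have : fine (P [set w | ((e / 4)%:E < `|ipm H (mu i w) (nu i)|)%E]) <= e / 4.
  by near: i.
lra.
Unshelve. all: by end_near. Qed.

End ipm_convergence.

(** * Conditional independence of the replicates *)

Section unit_interval.
Context (R : realType).

Lemma prodr01 I (s : seq I) (a : I -> R) :
  (forall i, 0 <= a i <= 1) -> 0 <= \prod_(i <- s) a i <= 1.
Proof.
move=> a01; apply/andP; split.
  by apply: prodr_ge0 => i _; have /andP[] := a01 i.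
by apply: prodr_ile1 => i _; exact: a01.
Qed.

(** The factors are exchanged one at a time, all the others having absolute value at most 1. *)
Lemma dist_prod_le I (s : seq I) (a b : I -> R) :
  (forall i, 0 <= a i <= 1) -> (forall i, 0 <= b i <= 1) ->
  `|\prod_(i <- s) a i - \prod_(i <- s) b i| <= \sum_(i <- s) `|a i - b i|.
Proof.
move=> a01 b01; elim: s => [|i s ih]; first by rewrite !big_nil subrr normr0.
rewrite !big_cons.
have -> : a i * \prod_(j <- s) a j - b i * \prod_(j <- s) b j =
    (a i - b i) * \prod_(j <- s) a j +
    b i * (\prod_(j <- s) a j - \prod_(j <- s) b j) by ring.
rewrite (le_trans (ler_normD _ _))// lerD// normrM.
  have /andP[p0 p1] := prodr01 s a01.
  by rewrite ler_piMr// ger0_norm.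
have /andP[b0 b1] := b01 i.
by rewrite (le_trans _ ih)// ler_piMl// ger0_norm.
Qed.

Lemma exists_natdiv_le (c e : R) : 0 < e ->
  exists2 N : nat, (0 < N)%N & c / N%:R <= e.
Proof.
move=> e0; exists (Num.truncn (c / e)).+1 => //.
rewrite ler_pdivrMr ?ltr0n// mulrC -ler_pdivrMr//.
exact/ltW/truncnS_gt.
Qed.

End unit_interval.

(** * Uniform approximation by step functions *)

Section level_sets.
Context d (T : measurableType d) (R : realType).
Implicit Types h : T -> R.

Definition level (N : nat) h (i : nat) : set T :=
  [set x | i.+1%:R <= N%:R * h x].

Lemma measurable_level N h i : measurable_fun setT h -> measurable (level N h i).
Proof.
move=> mh; rewrite -[X in measurable X]setTI /level.
have mNh : measurable_fun setT (fun x => N%:R * h x).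
  by apply: measurable_funM => //; exact: measurable_cst.
by rewrite -preimage_itvcy; apply: mNh => //; exact: measurable_itv.
Qed.

(** For [h] with values in [0, 1] this is floor(N h) / N, in layer-cake form. The coefficients do
    not depend on [h], so the same ones serve all the factors of a product. *)
Definition level_sum N h x : R := \sum_(i < N) N%:R^-1 * \1_(level N h i) x.

Lemma level_sum01 N h x : (0 < N)%N -> 0 <= level_sum N h x <= 1.
Proof.
move=> N0; have N0R : 0 < N%:R :> R by rewrite ltr0n.
have iN0 : 0 <= N%:R^-1 :> R by rewrite invr_ge0 ltW.
apply/andP; split; first by apply: sumr_ge0 => i _; rewrite mulr_ge0.
have -> : 1 = \sum_(i < N) N%:R^-1 :> R.
  by rewrite sumr_const card_ord -[RHS]mulr_natl divff// gt_eqF.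
by apply: ler_sum => i _; rewrite ler_piMr// indicE; case: (_ \in _).
Qed.

Lemma bounded_measurable_level_sum N h : measurable_fun setT h ->
  bounded_measurable (level_sum N h).
Proof.
move=> mh; apply: bounded_measurable_sum => i; apply: bounded_measurableM.
  exact: bounded_measurable_cst.
exact/bounded_measurable_indic/measurable_level.
Qed.

Lemma dist_level_sum N h x : (0 < N)%N -> 0 <= h x <= 1 ->
  `|h x - level_sum N h x| <= N%:R^-1.
Proof.
move=> N0 /andP[h0 h1]; rewrite /level_sum; set z := N%:R * h x.
have N0R : 0 < N%:R :> R by rewrite ltr0n.
have z0 : 0 <= z by rewrite mulr_ge0// ltW.
pose s M := \sum_(i < M) \1_(level N h i) x : R.
(* Invariant of the count: either all of the first [M] levels are reached, or [z] has been passed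
   and the count is frozen at the integer part of [z]. *)
have sP M : (M%:R <= z /\ s M = M%:R) \/ (z < M%:R /\ z - 1 <= s M <= z).
  elim: M => [|M ih]; first by left; split=> //; rewrite /s big_ord0.
  rewrite /s big_ord_recr/= -/(s M) indicE.
  have [zM|zM] := leP M.+1%:R z.
    left; split=> //; rewrite mem_set//.
    case: ih => [[_ ->]|[]]; first by rewrite natr1.
    by rewrite ltNge (le_trans _ zM)// ler_nat.
  right; split=> //; rewrite memNset ?addr0; last first.
    by apply/negP; rewrite -ltNge.
  case: ih => [[Mz ->]|[_ //]]; rewrite Mz andbT.
  by rewrite -natr1 in zM; lra.
have sN : z - 1 <= s N <= z.
  case: (sP N) => [[Nz ->]|[_ //]]; rewrite Nz andbT.
  by have : z <= N%:R; [rewrite /z ler_piMr// ltW|lra].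
rewrite -big_distrr/= -/(s N).
rewrite -(ler_pM2l N0R) -[X in X * `|_|]ger0_norm ?(ltW N0R)// -normrM.
rewrite mulfV ?gt_eqF// mulrBr mulVKf ?gt_eqF// -/z.
rewrite ler_norml; lra.
Qed.

End level_sets.

Section mechanism.
Context dO (Omega : measurableType dO) (R : realType) (P : probability Omega R).
Context dD (D : borelMetricType dD R) (rm : resampling_mechanism P D).
Implicit Types h : D -> R.

Let P1 : P setT = 1%E := probability_setT P.

Definition cond_mean n h (x : data_type rm n) : R :=
  \int[cond_dist rm n x]_y h y.

Arguments cond_mean : clear implicits.

Lemma cond_dist1 n x : cond_dist rm n x setT = 1%E.
Proof. exact: prob_kernel. Qed.

Lemma bounded_measurable_cond_mean n h :
  bounded_measurable h -> bounded_measurable (cond_mean n h).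
Proof.
move=> bh; have [mh [B hB]] := bh; split; last first.
  by exists B => x; apply: bmRintegral_bound => //; exact: cond_dist1.
(* The shift by the bound makes the integrand nonnegative, as measurability of integrals against a
   kernel requires. *)
have bhB : bounded_measurable (fun y => h y + B).
  exact: bounded_measurableD (bounded_measurable_cst _ _).
rewrite [X in measurable_fun _ X](_ : _ =
    (fun x => fine (\int[cond_dist rm n x]_y (h y + B)%:E)%E - B)); last first.
  apply/funext => x; rewrite -[fine _]/(\int[cond_dist rm n x]_y (h y + B)).
  rewrite bmRintegralD//; [|exact: cond_dist1|exact: bounded_measurable_cst].
  by rewrite bmRintegral_cst ?addrK//; exact: cond_dist1.
apply: measurable_funB; last exact: measurable_cst.
apply: measurableT_comp => //.
apply: (measurable_fun_integral_kernel (fun U mU => measurable_kernel _ U mU)).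
  by move=> y; rewrite lee_fin -lerBlDr sub0r; have := hB y; rewrite ler_norml => /andP[].
exact/measurable_EFinP/bhB.1.
Qed.

Lemma random_probability_cond n :
  random_probability (fun w => cond_dist rm n (data rm n w)).
Proof.
split=> [w|h bh]; first exact: cond_dist1.
have [mc _] := bounded_measurable_cond_mean n bh.
exact: (measurableT_comp mc).
Qed.

(** [cond_dist] is tied to the replicate of index 0 only; [rep_ident] carries it over to every
    index. *)
Lemma is_cond_prob_rep n i B : measurable B ->
  is_cond_prob (data rm n) (rep rm n i @^-1` B)
    (fun x => fine (cond_dist rm n x B)).
Proof.
move=> mB; have bB := bounded_measurable_indic R mB.
have gE x : fine (cond_dist rm n x B) = cond_mean n \1_B x.
  by rewrite /cond_mean Rintegral_indic.
have bg := bounded_measurable_cond_mean n bB.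
split; first by under eq_fun do rewrite gE; exact: bg.1.
  under eq_fun do rewrite gE; apply: (bounded_measurable_integrable P1).
  exact: bounded_measurable_comp.
move=> C mC; rewrite setIC -[LHS]/(\int[P]_(w in data rm n @^-1` C) _)%E.
rewrite [RHS](@rep_ident _ _ _ _ _ _ rm n i C B mC mB).
rewrite -(@cond_distE _ _ _ _ _ _ rm n C B mC mB).
apply: eq_integral => w _; rewrite fineK// ge0_fin_numE//.
apply: (@le_lt_trans _ _ 1%E); last by rewrite ltry.
by rewrite -(cond_dist1 (data rm n w)) le_measure// inE.
Qed.

Lemma rep_cond_independent_indic n M (C : set (data_type rm n)) (B : 'I_M -> set D) :
  measurable C -> (forall j, measurable (B j)) ->
  \int[P]_w (\1_C (data rm n w) * \prod_j \1_(B j) (rep rm n j w)) =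
  \int[P]_w (\1_C (data rm n w) * \prod_j cond_mean n \1_(B j) (data rm n w)).
Proof.
move=> mC mB.
pose J : {fset nat} := [fset k in iota 0 M]%fset.
have JP k : (k \in J) = (k < M)%N by rewrite inE/= mem_iota.
(* Conditional independence is stated for families indexed by all naturals; indices from [M] on
   receive the whole space. *)
pose B' k := if insub k is Some j then B j else setT.
have mB' k : measurable (B' k) by rewrite /B'; case: insubP.
have B'E (j : 'I_M) : B' j = B j by rewrite /B' valK.
have bigJ (F : nat -> R) : \prod_(j <- J) F j = \prod_(j < M) F j.
  rewrite -(big_mkord xpredT) /index_iota subn0; apply: perm_big.
  by apply: uniq_perm; [exact: fset_uniq|exact: iota_uniq|
    move=> k; rewrite JP mem_iota].
have := @rep_cond_independent _ _ _ _ _ _ rm n J B'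
  (fun j x => fine (cond_dist rm n x (B' j))).
move=> /(_ (fun j _ => mB' j)).
move=> /(_ (fun j _ => is_cond_prob_rep n j (mB' j))) [_ _ /(_ C mC)].
set A := (X in P (X `&` _)) => /(congr1 fine).
have mA : measurable (A `&` data rm n @^-1` C).
  apply: measurableI; last exact: measurable_funPTI.
  apply: bigcap_measurableType => // j _.
  exact: (measurable_funPTI (rep rm n j) (mB' j)).
rewrite -(Rintegral_indic P mA) -[LHS]/(Rintegral _ _ _) Rintegral_mkcond => h.
transitivity (\int[P]_w (\1_(A `&` data rm n @^-1` C) w : R)).
  apply: eq_Rintegral => w _; rewrite indicI mulrC; congr (_ * _).
  rewrite /A !indicE; have [|] := boolP (w \in _).
    rewrite inE => Aw; rewrite big1// => j _; rewrite indicE mem_set//.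
    by rewrite -B'E; apply: Aw; rewrite /= JP.
  rewrite notin_setE => Aw; apply/eqP/prodf_eq0; apply: contrapT => Bw.
  apply: Aw => k /=; rewrite JP => kM; apply: contrapT => Bk; apply: Bw.
  by exists (Ordinal kM) => //; rewrite indicE memNset// -B'E.
rewrite -h; apply: eq_Rintegral => w _; rewrite patchE indicE.
case: (boolP (w \in _)); rewrite ?inE ?notin_setE/= => Cw; last first.
  by rewrite memNset// mul0r.
rewrite mem_set// mul1r bigJ; apply: eq_bigr => j _.
by rewrite B'E /cond_mean Rintegral_indic.
Qed.

(** Distributivity turns the product of sums into a sum over choice functions [m]. Both sides of
    conditional independence for step functions expand with the same coefficients, which leaves the
    case of indicators. *)
Let integral_expand M (K : finType) (a b : K -> R) (c : K -> Omega -> R)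
    (v : 'I_M -> K -> Omega -> R) :
  (forall k, bounded_measurable (c k)) ->
  (forall j k, bounded_measurable (v j k)) ->
  \int[P]_w ((\sum_k a k * c k w) * \prod_j \sum_k b k * v j k w) =
  \sum_k \sum_(m : {ffun 'I_M -> K}) (a k * \prod_j b (m j)) *
     \int[P]_w (c k w * \prod_j v j (m j) w).
Proof.
move=> bc bv.
have bcv k (m : {ffun 'I_M -> K}) :
    bounded_measurable (fun w => c k w * \prod_j v j (m j) w).
  by apply: bounded_measurableM => //; exact: bounded_measurable_prod.
have bkm k (m : {ffun 'I_M -> K}) : bounded_measurable
    (fun w => (a k * \prod_j b (m j)) * (c k w * \prod_j v j (m j) w)).
  by apply: bounded_measurableM => //; exact: bounded_measurable_cst.
transitivity (\int[P]_w \sum_k \sum_(m : {ffun 'I_M -> K})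
    (a k * \prod_j b (m j)) * (c k w * \prod_j v j (m j) w)).
  apply: eq_Rintegral => w _; rewrite bigA_distr_bigA/= big_distrl/=.
  apply: eq_bigr => k _; rewrite big_distrr/=; apply: eq_bigr => m _.
  by rewrite big_split/= mulrACA.
rewrite (bmRintegral_sum P1); last first.
  by move=> k; exact: bounded_measurable_sum.
apply: eq_bigr => k _; rewrite (bmRintegral_sum P1)//.
by apply: eq_bigr => m _; rewrite (bmRintegralZ P1).
Qed.

Let cond_independent_step n M (K : finType) (a b : K -> R)
    (C : K -> set (data_type rm n)) (B : 'I_M -> K -> set D) :
  (forall k, measurable (C k)) -> (forall j k, measurable (B j k)) ->
  \int[P]_w ((\sum_k a k * \1_(C k) (data rm n w)) *
             \prod_j \sum_k b k * \1_(B j k) (rep rm n j w)) =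
  \int[P]_w ((\sum_k a k * \1_(C k) (data rm n w)) *
     \prod_j cond_mean n (fun y => \sum_k b k * \1_(B j k) y) (data rm n w)).
Proof.
move=> mC mB; have bB j k := bounded_measurable_indic R (mB j k).
have bbB j k : bounded_measurable (fun y => b k * \1_(B j k) y).
  by apply: bounded_measurableM => //; exact: bounded_measurable_cst.
have bC k : bounded_measurable (fun w => \1_(C k) (data rm n w) : R).
  apply: (bounded_measurable_comp (measurable_funPT (data rm n))).
  exact: bounded_measurable_indic.
under [RHS]eq_Rintegral => w _.
  under [X in _ * X]eq_bigr => j _.
    rewrite /cond_mean bmRintegral_sum//; last exact: cond_dist1.
    under eq_bigr do rewrite bmRintegralZ ?cond_dist1//.
    over.
  over.
rewrite (integral_expand a b bC); last first.
  move=> j k; apply: (bounded_measurable_comp (measurable_funPT (rep rm n j))).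
  exact: bB.
rewrite (integral_expand a b bC (v := fun j k w =>
    cond_mean n \1_(B j k) (data rm n w))); last first.
  move=> j k; apply: (bounded_measurable_comp (measurable_funPT (data rm n))).
  exact: bounded_measurable_cond_mean.
apply: eq_bigr => k _; apply: eq_bigr => m _; congr (_ * _).
exact: rep_cond_independent_indic.
Qed.

(* Extends [rep_cond_independent] from sets to functions, by uniform
   approximation with the step functions [level_sum]. *)
Lemma rep_cond_independentE n M (f : data_type rm n -> R) (h : 'I_M -> D -> R) :
  measurable_fun setT f -> (forall x, 0 <= f x <= 1) ->
  (forall j, measurable_fun setT (h j)) -> (forall j y, 0 <= h j y <= 1) ->
  \int[P]_w (f (data rm n w) * \prod_j h j (rep rm n j w)) =
  \int[P]_w (f (data rm n w) * \prod_j cond_mean n (h j) (data rm n w)).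
Proof.
move=> mf f01 mh h01.
pose fN N := level_sum N f.
pose hN N j := level_sum N (h j).
have step N : \int[P]_w (fN N (data rm n w) * \prod_j hN N j (rep rm n j w)) =
    \int[P]_w (fN N (data rm n w) * \prod_j cond_mean n (hN N j) (data rm n w)).
  apply: cond_independent_step => [k|j k]; exact: measurable_level.
have bf : bounded_measurable f by exact: bounded_measurable01.
have bh j : bounded_measurable (h j) by exact: bounded_measurable01.
have bfN N : bounded_measurable (fN N) by exact: bounded_measurable_level_sum.
have bhN N j : bounded_measurable (hN N j) by exact: bounded_measurable_level_sum.
have mX := measurable_funPT (data rm n).
have mS j := measurable_funPT (rep rm n j).
(* There are [M.+1] factors, [f] and the [M] functions [h j], each approximated within [1 / N]. *)
pose err N : R := M.+1%:R * N%:R^-1.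
have bprodS (g : 'I_M -> D -> R) u : bounded_measurable u ->
    (forall j, bounded_measurable (g j)) -> bounded_measurable
    (fun w => u (data rm n w) * \prod_j g j (rep rm n j w)).
  move=> bu bg; apply: bounded_measurableM; first exact: bounded_measurable_comp.
  apply: bounded_measurable_prod => j.
  exact: (bounded_measurable_comp (mS j) (bg j)).
have bprodX (g : 'I_M -> D -> R) u : bounded_measurable u ->
    (forall j, bounded_measurable (g j)) -> bounded_measurable
    (fun w => u (data rm n w) * \prod_j cond_mean n (g j) (data rm n w)).
  move=> bu bg; apply: bounded_measurableM; first exact: bounded_measurable_comp.
  apply: bounded_measurable_prod => j.
  exact: (bounded_measurable_comp mX (bounded_measurable_cond_mean n (bg j))).
have mean01 g x : bounded_measurable g -> (forall y, 0 <= g y <= 1) ->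
    0 <= cond_mean n g x <= 1.
  by move=> bg g01; apply: bmRintegral01 => //; exact: cond_dist1.
have distP (u u' : R) (p p' : 'I_M -> R) N : 0 <= u <= 1 -> 0 <= u' <= 1 ->
    (forall j, 0 <= p j <= 1) -> (forall j, 0 <= p' j <= 1) ->
    `|u - u'| <= N%:R^-1 -> (forall j, `|p j - p' j| <= N%:R^-1) ->
    `|u * \prod_j p j - u' * \prod_j p' j| <= err N.
  move=> u01 u'01 p01 p'01 uu' pp'.
  (* Indexing by [option] makes the leading factor [u] one more factor of the product, with index
     [None]. *)
  pose q i := oapp p u i; pose q' i := oapp p' u' i.
  have := @dist_prod_le R _ (None :: map some (index_enum 'I_M)) q q'.
  rewrite !big_cons !big_map/= => H.
  apply: (le_trans (H _ _)); try by case.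
  rewrite /err -natr1 mulrDl mul1r addrC lerD//.
  rewrite (le_trans (ler_sum _ (fun j _ => pp' j)))//.
  by rewrite sumr_const card_ord -[leLHS]mulr_natl.
apply/eqP; rewrite -subr_eq0 -normr_le0; apply/ler_addgt0Pl => e e0; rewrite addr0.
have [N N0 Ne] : exists2 N, (0 < N)%N & err N + err N <= e.
  have [N N0 Ne] := exists_natdiv_le (M.+1%:R + M.+1%:R) e0.
  by exists N => //; rewrite /err -mulrDl.
rewrite (le_trans (ler_distD (\int[P]_w (fN N (data rm n w) *
  \prod_j hN N j (rep rm n j w))) _ _))// (le_trans _ Ne)// lerD//.
  apply: (le_dist_bmRintegral P1); [exact: bprodS|exact: bprodS|].
  move=> w; apply: distP => //.
  - exact: level_sum01.
  - by move=> j; exact: level_sum01.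
  - exact: dist_level_sum.
  - by move=> j; exact: dist_level_sum.
rewrite step; apply: (le_dist_bmRintegral P1); [exact: bprodX|exact: bprodX|].
move=> w; apply: distP => //.
- exact: level_sum01.
- by move=> j; apply: mean01 => // y; exact: level_sum01.
- by move=> j; exact: mean01.
- by rewrite distrC; exact: dist_level_sum.
- move=> j; rewrite distrC; apply: le_dist_bmRintegral => //.
    exact: cond_dist1.
  by move=> y; exact: dist_level_sum.
Qed.

End mechanism.
Arguments cond_mean {dO Omega R P dD D} rm n h x.

(** * Moments of the replicates and of the empirical measure *)

Section moments.
Context dO (Omega : measurableType dO) (R : realType) (P : probability Omega R).
Context dD (D : borelMetricType dD R) (rm : resampling_mechanism P D).
Implicit Types h : D -> R.

Let P1 : P setT = 1%E := probability_setT P.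

Lemma cond_mean_cst n c x : cond_mean rm n (fun=> c) x = c.
Proof. by rewrite /cond_mean bmRintegral_cst//; exact: cond_dist1. Qed.

Lemma cond_mean01 n h x : measurable_fun setT h -> (forall y, 0 <= h y <= 1) ->
  0 <= cond_mean rm n h x <= 1.
Proof.
move=> mh h01; apply: bmRintegral01 => //; first exact: cond_dist1.
exact: bounded_measurable01.
Qed.

Lemma bounded_measurable_rep n i h : bounded_measurable h ->
  bounded_measurable (fun w => h (rep rm n i w)).
Proof. exact: (bounded_measurable_comp (measurable_funPT (rep rm n i))). Qed.

Lemma bounded_measurable_cond_mean_data n h : bounded_measurable h ->
  bounded_measurable (fun w => cond_mean rm n h (data rm n w)).
Proof.
move=> bh; apply: (bounded_measurable_comp (measurable_funPT (data rm n))).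
exact: bounded_measurable_cond_mean.
Qed.

Lemma integral_rep n i h : measurable_fun setT h -> (forall y, 0 <= h y <= 1) ->
  \int[P]_w h (rep rm n i w) = \int[P]_w cond_mean rm n h (data rm n w).
Proof.
move=> mh h01.
(* Conditional independence speaks of the first [i.+1] replicates; the ones before [i] are filled
   with the constant 1, whose conditional mean is 1. *)
pose g (k : 'I_i.+1) : D -> R := if k == ord_max then h else (fun=> 1).
have := @rep_cond_independentE _ _ _ P _ _ rm n i.+1 (fun=> 1) g.
move=> /(_ (measurable_cst _)) /(_ (fun=> ltac:(by rewrite ler01 lexx))).
have mg k : measurable_fun setT (g k) by rewrite /g; case: ifP.
have g01 k y : 0 <= g k y <= 1.
  by rewrite /g; case: ifP => // _; rewrite ler01 lexx.
move=> /(_ mg g01) H.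
rewrite -[LHS](_ : \int[P]_w (1 * \prod_j g j (rep rm n j w)) = _); last first.
  apply: eq_Rintegral => w _; rewrite mul1r (bigD1 ord_max)//= {1}/g eqxx.
  by rewrite big1 ?mulr1// => j /negPf jn; rewrite /g jn.
rewrite H; apply: eq_Rintegral => w _; rewrite mul1r (bigD1 ord_max)//= {1}/g eqxx.
by rewrite big1 ?mulr1// => j /negPf jn; rewrite /g jn cond_mean_cst.
Qed.

(** Given the data, two distinct replicates are independent with the same law, so the conditional
    mean of the product is the square of [cond_mean]. *)
Lemma integral_rep2 n i j h : i != j ->
  measurable_fun setT h -> (forall y, 0 <= h y <= 1) ->
  \int[P]_w (h (rep rm n i w) * h (rep rm n j w)) =
  \int[P]_w (cond_mean rm n h (data rm n w)) ^+ 2.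
Proof.
move=> ij mh h01; pose M := (maxn i j).+1.
have iM : (i < M)%N by rewrite ltnS leq_maxl.
have jM : (j < M)%N by rewrite ltnS leq_maxr.
pose oi := Ordinal iM; pose oj := Ordinal jM.
have oij : oj != oi by rewrite eq_sym.
pose g (k : 'I_M) : D -> R := if (k == oi) || (k == oj) then h else (fun=> 1).
have := @rep_cond_independentE _ _ _ P _ _ rm n M (fun=> 1) g.
move=> /(_ (measurable_cst _)) /(_ (fun=> ltac:(by rewrite ler01 lexx))).
have mg k : measurable_fun setT (g k) by rewrite /g; case: ifP.
have g01 k y : 0 <= g k y <= 1.
  by rewrite /g; case: ifP => // _; rewrite ler01 lexx.
move=> /(_ mg g01) H.
rewrite -[LHS](_ : \int[P]_w (1 * \prod_j g j (rep rm n j w)) = _); last first.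
  apply: eq_Rintegral => w _; rewrite mul1r (bigD1 oi)//= (bigD1 oj)//= mulrA.
  rewrite {1 2}/g !eqxx orbT/= big1 ?mulr1// => k /andP[/negPf ki /negPf kj].
  by rewrite /g ki kj.
rewrite H; apply: eq_Rintegral => w _; rewrite mul1r (bigD1 oi)//= (bigD1 oj)//= mulrA.
rewrite {1 2}/g !eqxx orbT/= big1 ?mulr1// => k /andP[/negPf ki /negPf kj].
by rewrite /g ki kj cond_mean_cst.
Qed.

Lemma empirical1 n M w : (0 < M)%N -> empirical rm n M w setT = 1%E.
Proof.
move=> M0; rewrite -[LHS]/((M%:R^-1)%:E * \sum_(i < M) \d_(rep rm n i w) setT)%E.
under eq_bigr do rewrite diracT.
by rewrite sumEFin sumr_const card_ord -EFinM mulVf// pnatr_eq0 -lt0n.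
Qed.

Lemma integral_empirical n M w h : (0 < M)%N -> bounded_measurable h ->
  \int[empirical rm n M w]_y h y = M%:R^-1 * \sum_(i < M) h (rep rm n i w).
Proof.
move=> M0 bh; have [mh [B hB]] := bh.
have e1 := empirical1 n w M0.
(* Sums and multiples of measures are integrated termwise for nonnegative integrands; the shift by
   [B] is cancelled afterwards. *)
have bB := @bounded_measurable_cst _ D R B.
have bhB := bounded_measurableD bh bB.
have hB0 y : (0 <= (h y + B)%:E)%E.
  by rewrite lee_fin -lerBlDr sub0r; have := hB y; rewrite ler_norml => /andP[].
have mhB : measurable_fun setT (fun y => (h y + B)%:E).
  exact/measurable_EFinP/bhB.1.
suff : \int[empirical rm n M w]_y (h y + B) =
    M%:R^-1 * \sum_(i < M) (h (rep rm n i w) + B).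
  rewrite (bmRintegralD e1)// (bmRintegral_cst e1) big_split/= sumr_const card_ord.
  rewrite mulrDr -[X in _ = _ + M%:R^-1 * X]mulr_natl mulKf ?pnatr_eq0 -?lt0n//.
  exact: addIr.
rewrite /Rintegral /empirical ge0_integral_mscale//.
rewrite ge0_integral_measure_sum//.
under eq_bigr => i _.
  rewrite integral_dirac// diracT mul1e; over.
by rewrite sumEFin -EFinM.
Qed.

Lemma random_probability_empirical n M : (0 < M)%N ->
  random_probability (empirical rm n M).
Proof.
move=> M0; split=> [w|h bh]; first exact: empirical1.
have -> : (fun w => \int[empirical rm n M w]_y h y) =
    (fun w => M%:R^-1 * \sum_(i < M) h (rep rm n i w)).
  by apply/funext => w; rewrite integral_empirical.
apply: measurable_funM; first exact: measurable_cst.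
have := bounded_measurable_sum (index_enum 'I_M) (fun i => bounded_measurable_rep n i bh).
by case.
Qed.

(** The square expands into [M ^ 2] terms of weight [1 / M ^ 2]. The off-diagonal ones all equal
    [A], the second integral; each of the [M] diagonal ones lies in [0, 1], as does [A], so it
    differs from [A] by at most 1. *)
Lemma empirical_second_moment n M h c : (0 < M)%N -> measurable_fun setT h ->
  (forall y, 0 <= h y <= 1) -> 0 <= c <= 1 ->
  `|\int[P]_w (\int[empirical rm n M w]_y h y - c) ^+ 2 -
    \int[P]_w (cond_mean rm n h (data rm n w) - c) ^+ 2| <= M%:R^-1.
Proof.
move=> M0 mh h01 c01; have bh := bounded_measurable01 mh h01.
have MN0 : M%:R != 0 :> R by rewrite pnatr_eq0 -lt0n.
set A := \int[P]_w (cond_mean rm n h (data rm n w) - c) ^+ 2.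
have bc := @bounded_measurable_cst _ Omega R c.
have bS i : bounded_measurable (fun w => h (rep rm n i w) - c).
  by apply: bounded_measurableB => //; exact: bounded_measurable_rep.
have bm := bounded_measurable_cond_mean_data n bh.
pose a i j w := (h (rep rm n i w) - c) * (h (rep rm n j w) - c).
have ba i j : bounded_measurable (a i j) by exact: bounded_measurableM.
have bZ k u : @bounded_measurable _ Omega R u ->
    bounded_measurable (fun w => k * u w).
  by move=> bu; apply: bounded_measurableM => //; exact: bounded_measurable_cst.
have quad u v : @bounded_measurable _ Omega R u -> bounded_measurable v ->
    \int[P]_w ((u w - c) * (v w - c)) =
    \int[P]_w (u w * v w) - c * \int[P]_w u w - c * \int[P]_w v w + c ^+ 2.
  move=> bu bv; have buv := bounded_measurableM bu bv.
  rewrite -!(bmRintegralZ P1)// -(bmRintegral_cst P1 (c ^+ 2)).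
  rewrite -(bmRintegralB P1)//; last exact: bZ.
  rewrite -(bmRintegralB P1)//;
    [|by apply: bounded_measurableB => //; exact: bZ|exact: bZ].
  rewrite -(bmRintegralD P1)//; last exact: bounded_measurable_cst.
    by apply: eq_Rintegral => w _; ring.
  by apply: bounded_measurableB; [apply: bounded_measurableB => //|]; exact: bZ.
have offdiag i j : i != j -> \int[P]_w a i j w = A.
  move=> ij; rewrite /a quad; [|exact: bounded_measurable_rep..].
  rewrite integral_rep2// !integral_rep// /A.
  under [RHS]eq_Rintegral do rewrite expr2.
  by rewrite quad//; under [in RHS]eq_Rintegral do rewrite -expr2.
have sq01 (x : R) : 0 <= x <= 1 -> 0 <= (x - c) ^+ 2 <= 1.
  by move=> x01; rewrite sqr_ge0/=; nra.
have A01 : 0 <= A <= 1.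
  apply: (bmRintegral01 P1).
    by apply: bounded_measurableX; exact: bounded_measurableB.
  by move=> w; apply/sq01/cond_mean01.
have diag i : 0 <= \int[P]_w a i i w <= 1.
  apply: (bmRintegral01 P1) => // w; rewrite /a -expr2; exact: sq01.
have -> : \int[P]_w (\int[empirical rm n M w]_y h y - c) ^+ 2 =
    \sum_(i < M) \sum_(j < M) (M%:R ^- 2 * \int[P]_w a i j w).
  transitivity (\int[P]_w \sum_(i < M) \sum_(j < M) (M%:R ^- 2 * a i j w)).
    apply: eq_Rintegral => w _; rewrite integral_empirical//.
    have -> : M%:R^-1 * (\sum_(i < M) h (rep rm n i w)) - c =
        M%:R^-1 * \sum_(i < M) (h (rep rm n i w) - c).
      by rewrite sumrB mulrBr sumr_const card_ord -[X in _ = _ - _ * X]mulr_natl mulKf.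
    rewrite exprMn [X in _ * X]expr2 big_distrlr/= mulr_sumr exprVn.
    apply: eq_bigr => i _.
    by rewrite mulr_sumr.
  rewrite (bmRintegral_sum P1); last first.
    by move=> i; apply: bounded_measurable_sum => j; exact: bZ.
  apply: eq_bigr => i _; rewrite (bmRintegral_sum P1); last by move=> j; exact: bZ.
  by apply: eq_bigr => j _; rewrite (bmRintegralZ P1).
have -> : A = \sum_(i < M) \sum_(j < M) (M%:R ^- 2 * A).
  rewrite !sumr_const card_ord -mulrnA -[RHS]mulr_natl natrM; field.
  exact: MN0.
rewrite -sumrB (le_trans (ler_norm_sum _ _ _))//.
rewrite (@le_trans _ _ (\sum_(i < M) M%:R ^- 2))//; last first.
  rewrite sumr_const card_ord -[leLHS]mulr_natl expr2 invfM mulrA.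
  by rewrite mulfV// mul1r.
apply: ler_sum => i _; rewrite -sumrB (bigD1 i)//= big1 ?addr0; last first.
  by move=> j ji; rewrite offdiag ?subrr// eq_sym.
rewrite -mulrBr normrM ger0_norm ?invr_ge0 ?exprn_ge0//.
rewrite ler_piMr ?invr_ge0 ?exprn_ge0//.
have := diag i; rewrite ler_norml; lra.
Qed.

End moments.

(** * Mean-square convergence, and the exchange of conditional law and empirical measure *)

Section L2_convergence.
Context d (Omega : measurableType d) (R : realType) (P : probability Omega R).
Context I (F : set_system I) {FF : Filter F} d' (T : measurableType d').
Variables (mu : I -> Omega -> {measure set T -> \bar R}).
Hypothesis rmu : \forall i \near F, random_probability (mu i).
Variable Q : probability T R.

Let Q1 : Q setT = 1%E := probability_setT Q.
Let P1 : P setT = 1%E := probability_setT P.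

(** On [-1, 1] squares are below absolute values. Conversely [|y| <= c + y ^ 2 / c] with
    [c = e / 2], seen by comparing [|y|] with [c]; this plays the part of Cauchy-Schwarz, and the
    second moment is taken below [c ^ 2]. *)
Lemma L1_cvg_sqrP (h : T -> R) :
  measurable_fun setT h -> (forall x, 0 <= h x <= 1) ->
  L1_cvg P F mu Q h <-> forall e, 0 < e ->
  \forall i \near F, \int[P]_w (\int[mu i w]_x h x - \int[Q]_x h x) ^+ 2 <= e.
Proof.
move=> mh h01; have bh := bounded_measurable01 mh h01.
have Qh01 := bmRintegral01 Q1 bh h01.
have bd i : random_probability (mu i) ->
    bounded_measurable (fun w => \int[mu i w]_x h x - \int[Q]_x h x).
  move=> ri; apply: bounded_measurableB; last exact: bounded_measurable_cst.
  exact: bounded_measurable_random.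
have d1 i w : random_probability (mu i) ->
    -1 <= \int[mu i w]_x h x - \int[Q]_x h x <= 1.
  by move=> [m1 _]; have := bmRintegral01 (m1 w) bh h01; lra.
split=> [/L1_cvgP c e e0|c].
  apply: filterS2 (c _ e0) rmu => i ie ri; apply: le_trans ie.
  apply: (le_bmRintegral P1).
  - exact/bounded_measurableX/bd.
  - exact/bounded_measurable_norm/bd.
  move=> w; rewrite -real_normK ?num_real// expr2 ler_piMr//.
  by rewrite ler_norml; exact: d1.
apply/L1_cvgP => e e0; have e2 : 0 < e / 2 by rewrite divr_gt0.
have := c _ (mulr_gt0 e2 e2); apply: filterS2 rmu => i ri ie.
have bX := bounded_measurableX 2 (bd _ ri).
have be := @bounded_measurable_cst _ Omega R (e / 2).
have bi := @bounded_measurable_cst _ Omega R (e / 2)^-1.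
apply: (@le_trans _ _ (\int[P]_w (e / 2 +
    (e / 2)^-1 * (\int[mu i w]_x h x - \int[Q]_x h x) ^+ 2))).
  apply: (le_bmRintegral P1).
  - exact/bounded_measurable_norm/bd.
  - by apply: bounded_measurableD => //; exact: bounded_measurableM.
  move=> w; set y := _ - _.
  have [ye|ye] := leP `|y| (e / 2).
    by rewrite (le_trans ye)// lerDl mulr_ge0 ?sqr_ge0// invr_ge0 ltW.
  rewrite (@le_trans _ _ ((e / 2)^-1 * y ^+ 2))//; last by rewrite lerDr ltW.
  rewrite -real_normK ?num_real// mulrC ler_pdivlMr// expr2.
  by rewrite ler_wpM2l// ltW.
rewrite (bmRintegralD P1)//; last exact: bounded_measurableM.
rewrite (bmRintegral_cst P1) (bmRintegralZ P1)// [leRHS]splitr lerD2l.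
by rewrite mulrC ler_pdivrMr.
Qed.

End L2_convergence.

Section replicates.
Context dO (Omega : measurableType dO) (R : realType) (P : probability Omega R).
Context dD (D : borelMetricType dD R) (rm : resampling_mechanism P D).
Variable Q : probability D R.
Implicit Types h : D -> R.

Definition cond_L1_cvg h :=
  L1_cvg P \oo (fun n w => cond_dist rm n (data rm n w)) Q h.

Definition empirical_L1_cvg h :=
  L1_cvg P (filter_prod \oo \oo) (fun nM => empirical rm nM.1 nM.2) Q h.

Lemma near_random_probability_cond :
  \forall n \near \oo, random_probability (fun w => cond_dist rm n (data rm n w)).
Proof. by apply: nearW => n; exact: random_probability_cond. Qed.

Lemma near_random_probability_empirical :
  \forall nM \near filter_prod \oo \oo,
    random_probability (empirical rm nM.1 nM.2).
Proof.
near=> nM; apply: random_probability_empirical; near: nM.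
exact: (cvg_snd (nbhs_infty_gt 0%N)).
Unshelve. all: by end_near. Qed.

Lemma cond_empirical_L1_cvg h :
  measurable_fun setT h -> (forall x, 0 <= h x <= 1) ->
  cond_L1_cvg h <-> empirical_L1_cvg h.
Proof.
move=> mh h01; have bh := bounded_measurable01 mh h01.
have Qh01 := bmRintegral01 (probability_setT Q) bh h01.
split=> /L1_cvg_sqrP H; apply/L1_cvg_sqrP => //.
- exact: near_random_probability_empirical.
- move=> e e0; have e2 : 0 < e / 2 by rewrite divr_gt0.
  have {}H := H (near_random_probability_cond) mh h01 _ e2.
  have [N N0 Ne] := exists_natdiv_le 1 e2.
  near=> nM.
  have M0 : (0 < nM.2)%N by near: nM; exact: (cvg_snd (nbhs_infty_gt 0%N)).
  have := empirical_second_moment rm nM.1 M0 mh h01 Qh01.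
  have Me : nM.2%:R^-1 <= e / 2.
    rewrite (le_trans _ Ne)// mul1r lef_pV2 ?posrE ?ltr0n// ler_nat.
    by near: nM; exact: (cvg_snd (nbhs_infty_ge N)).
  have He : \int[P]_w (cond_mean rm nM.1 h (data rm nM.1 w) - \int[Q]_x h x) ^+ 2
      <= e / 2.
    by near: nM; exact: (cvg_fst H).
  by rewrite ler_norml => /andP[_]; lra.
- exact: near_random_probability_cond.
move=> e e0; have e2 : 0 < e / 2 by rewrite divr_gt0.
have := H near_random_probability_empirical mh h01 _ e2.
move=> [[A B] /= [Aoo Boo] AB].
have [N N0 Ne] := exists_natdiv_le 1 e2.
(* One fixed sample size suffices: [M] is eventual for the net and has [1 / M <= e / 2], after which
   only [n] tends to infinity. *)
have [M [BM NM M0]] : exists M, [/\ B M, (N <= M)%N & (0 < M)%N].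
  have [K _ BK] := Boo; exists (K + N)%N; split.
  - by apply: BK; exact: leq_addr.
  - exact: leq_addl.
  - by rewrite addn_gt0 N0 orbT.
near=> n.
have An : A n by near: n.
have := AB (n, M) (conj An BM) => /= He.
have := empirical_second_moment rm n M0 mh h01 Qh01.
have Me : M%:R^-1 <= e / 2.
  by rewrite (le_trans _ Ne)// mul1r lef_pV2 ?posrE ?ltr0n// ler_nat.
by rewrite ler_norml => /andP[+ _]; rewrite /cond_mean; lra.
Unshelve. all: by end_near. Qed.

End replicates.

(** * Bounded Lipschitz functions *)

Section running_max.
Context (T : Type) (R : realType) (b : R) (v : nat -> T -> R).

Fixpoint running_max N (x : T) : R :=
  if N is M.+1 then Num.max (running_max M x) (v M x) else b.

Lemma le_running_max N x c : b <= c -> (forall i, v i x <= c) ->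
  running_max N x <= c.
Proof. by move=> bc vc; elim: N => //= N ih; rewrite ge_max ih vc. Qed.

Lemma running_max_ge N x : b <= running_max N x.
Proof. by elim: N => //= N ih; rewrite le_max ih. Qed.

Lemma running_max_ge_nth N i x : (i < N)%N -> v i x <= running_max N x.
Proof.
elim: N => // N ih; rewrite ltnS leq_eqVlt => /predU1P[->|/ih h] /=.
  by rewrite le_max lexx orbT.
by rewrite le_max h.
Qed.

(** A nonzero increment means that [v N x] has become the new maximum. Hence the increments of a
    running maximum of bumps inherit the supports of the bumps. *)
Lemma running_maxS_neq N x :
  running_max N.+1 x - running_max N x != 0 -> b < v N x.
Proof.
rewrite /= maxEle; case: ifPn => [le|]; last by rewrite subrr eqxx.
rewrite subr_eq0 => ne; apply: (le_lt_trans (running_max_ge N x)).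
by rewrite lt_neqAle eq_sym ne.
Qed.

End running_max.

Section lipschitz.
Context (R : realType) (T : metricType R).

Definition lipschitz_fun (K : R) (h : T -> R) :=
  forall x y, `|h x - h y| <= K * mdist x y.

Definition lip01 : set (T -> R) :=
  [set h | (forall x, 0 <= h x <= 1) /\ exists K, lipschitz_fun K h].

Lemma lipschitz_continuous K h : lipschitz_fun K h -> continuous h.
Proof.
move=> hK x; apply/cvgrPdist_le => e e0.
(* The sign of [K] is unrestricted; [K1] is a positive constant above it. *)
pose K1 := `|K| + 1; have K10 : 0 < K1 by rewrite ltr_wpDl.
have : \forall y \near nbhs x, mdist x y < e / K1.
  apply/metricType_numDomainType.nbhs_mdistP.
  by exists (e / K1) => //=; rewrite divr_gt0.
apply: filterS => y; rewrite ltr_pdivlMr// => xy.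
rewrite (le_trans (hK x y))// (le_trans _ (ltW xy))// mulrC ler_wpM2l ?mdist_ge0//.
by rewrite (le_trans (ler_norm K))// lerDl.
Qed.

Lemma lipschitz_max K f g : lipschitz_fun K f -> lipschitz_fun K g ->
  lipschitz_fun K (fun x => Num.max (f x) (g x)).
Proof.
move=> fK gK x y; have := fK x y; have := gK x y; rewrite !ler_norml !maxEle.
by case: ifPn; case: ifPn; rewrite -?ltNge; lra.
Qed.

Lemma lipschitz_min K f g : lipschitz_fun K f -> lipschitz_fun K g ->
  lipschitz_fun K (fun x => Num.min (f x) (g x)).
Proof.
move=> fK gK x y; have := fK x y; have := gK x y; rewrite !ler_norml !minEle.
by case: ifPn; case: ifPn; rewrite -?ltNge; lra.
Qed.

Lemma lipschitz_cst K c : 0 <= K -> lipschitz_fun K (fun=> c).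
Proof. by move=> K0 x y; rewrite subrr normr0 mulr_ge0// mdist_ge0. Qed.

Lemma lipschitz_running_max K b v N : 0 <= K ->
  (forall i, lipschitz_fun K (v i)) -> lipschitz_fun K (running_max b v N).
Proof.
move=> K0 vK; elim: N => [|N ih] /=; first exact: lipschitz_cst.
exact: (lipschitz_max ih (vK N)).
Qed.

Lemma lipschitz_affine_mdist c K a : 0 <= K ->
  lipschitz_fun K (fun x => c - K * mdist x a).
Proof.
move=> K0 x y.
have -> : c - K * mdist x a - (c - K * mdist y a) =
  K * (mdist y a - mdist x a) by ring.
rewrite normrM ger0_norm// ler_wpM2l// ler_norml.
have := metric_triangle x y a; have := metric_triangle y x a.
by rewrite (metric_sym y x); lra.
Qed.

Lemma lipschitzB K L f g : lipschitz_fun K f -> lipschitz_fun L g ->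
  lipschitz_fun (K + L) (fun x => f x - g x).
Proof.
move=> fK gL x y; have := fK x y; have := gL x y.
by rewrite !ler_norml mulrDl; lra.
Qed.

Lemma lip01_BL1 h K : 1 <= K -> (forall x, 0 <= h x <= 1) ->
  lipschitz_fun K h -> BL1 (fun x => K^-1 * h x).
Proof.
move=> K1 h01 hK; have K0 : 0 < K by exact: lt_le_trans K1.
have iK : 0 <= K^-1 <= 1 by rewrite invr_ge0 ltW//= invf_le1.
split=> [x|x y]; first by have := h01 x; nra.
rewrite -mulrBr normrM ger0_norm; last by case/andP: iK.
by rewrite mulrC ler_pdivrMr// mulrC.
Qed.

Lemma separable_dense_seq (x0 : T) : separable T ->
  exists a : nat -> T, forall x e, 0 < e -> exists i, mdist x (a i) < e.
Proof.
move=> [A cA dA].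
have near x e : 0 < e -> exists2 y, A y & mdist x y < e.
  move=> e0; have [|y [xy Ay]] := dA (ball x e)° _ (@open_interior _ _).
    exists x; exact: nbhsx_ballx.
  exists y => //; have := interior_subset xy.
  by rewrite ballEmdist.
have A0 : A !=set0 by have [y Ay _] := near x0 1 ltr01; exists y.
have [a aA] : exists a : nat -> T, A `<=` range a.
  have /countable_injP[f finj] := cA.
  have /choice[a aP] : forall n, exists y,
      (exists2 z, A z & f z = n) -> A y /\ f y = n.
    move=> n; have [[z Az fz]|nz] := pselect (exists2 z, A z & f z = n).
      by exists z.
    by exists x0 => /nz.
  exists a => y Ay; exists (f y) => //.
  have [|Ay' fy'] := aP (f y); first by exists y.
  by apply: finj; rewrite ?inE.
exists a => x e e0; have [y Ay xy] := near x e e0.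
by have [i _ ai] := aA _ Ay; exists i; rewrite ai.
Qed.

End lipschitz.

(** The missing mass is expressed through integrals of the [phi k]. It can therefore be carried from
    [Q] to another measure by the same finitely many integrals that control the distance. *)
Definition has_partition d (R : realType) (D : borelMetricType d R)
    (G : set (D -> R)) (Q : {measure set D -> \bar R}) :=
  forall e : R, 0 < e ->
  exists (K : finType) (phi : K -> D -> R) (a : K -> D),
    [/\ forall k, G (phi k), forall k x, 0 <= phi k x,
        forall x, \sum_k phi k x <= 1,
        forall k x, phi k x != 0 -> mdist x (a k) <= e &
        1 - e <= \sum_k \int[Q]_x phi k x].

Section partition_bound.
Context d (T : measurableType d) (R : realType).
Variables (K : finType) (phi : K -> T -> R) (F : T -> R) (c : K -> R) (e B : R).
Hypotheses (bF : bounded_measurable F) (bphi : forall k, bounded_measurable (phi k)).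
Hypothesis FB : forall x, `|F x| <= B.
Hypothesis cB : forall k, `|c k| <= B.
Hypothesis e0 : 0 <= e.
Hypothesis phi0 : forall k x, 0 <= phi k x.
Hypothesis phi1 : forall x, \sum_k phi k x <= 1.
Hypothesis phiF : forall k x, phi k x != 0 -> `|F x - c k| <= e.

Let B0 (x : T) : 0 <= B := le_trans (normr_ge0 _) (FB x).

Let bphic k : bounded_measurable (fun x => c k * phi k x).
Proof. by apply: bounded_measurableM => //; exact: bounded_measurable_cst. Qed.

Let bsum : bounded_measurable (fun x => \sum_k phi k x).
Proof. exact: bounded_measurable_sum. Qed.

(* [F - sum_k c_k phi_k = sum_k (F - c_k) phi_k + F (1 - sum_k phi_k)] *)
Let partition_pointwise x :
  `|F x - \sum_k c k * phi k x| <= e + B * (1 - \sum_k phi k x).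
Proof.
have -> : F x - \sum_k c k * phi k x =
    \sum_k (F x - c k) * phi k x + F x * (1 - \sum_k phi k x).
  under [in RHS]eq_bigr do rewrite mulrBl.
  by rewrite sumrB -mulr_sumr; ring.
rewrite (le_trans (ler_normD _ _))// lerD//; last first.
  by rewrite normrM [X in _ * X]ger0_norm ?subr_ge0// ler_wpM2r// subr_ge0.
rewrite (le_trans (ler_norm_sum _ _ _))//.
rewrite (@le_trans _ _ (\sum_k e * phi k x))//.
  apply: ler_sum => k _; rewrite normrM [X in _ * X]ger0_norm//.
  have [->|k0] := eqVneq (phi k x) 0; first by rewrite !mulr0.
  by rewrite ler_wpM2r// phiF.
by rewrite -mulr_sumr ler_piMr.
Qed.

Let partition_integral (P : {measure set T -> \bar R}) : P setT = 1%E ->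
  `|\int[P]_x F x - \sum_k c k * \int[P]_x phi k x| <=
  e + B * (1 - \sum_k \int[P]_x phi k x).
Proof.
move=> P1.
have -> : \sum_k c k * \int[P]_x phi k x = \int[P]_x \sum_k c k * phi k x.
  by rewrite bmRintegral_sum//; apply: eq_bigr => k _; rewrite bmRintegralZ.
have bcst u := @bounded_measurable_cst _ T R u.
have b1 : bounded_measurable (fun x => 1 - \sum_k phi k x).
  exact: bounded_measurableB.
have -> : e + B * (1 - \sum_k \int[P]_x phi k x) =
    \int[P]_x (e + B * (1 - \sum_k phi k x)).
  rewrite bmRintegralD//; last exact: bounded_measurableM.
  rewrite bmRintegralZ// bmRintegralB// bmRintegral_sum//.
  by rewrite !bmRintegral_cst.
have bs : bounded_measurable (fun x => \sum_k c k * phi k x).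
  exact: bounded_measurable_sum.
rewrite -bmRintegralB// (le_trans (le_norm_bmRintegral P1 _))//.
  exact: bounded_measurableB.
apply: le_bmRintegral => //.
  by apply: bounded_measurable_norm; exact: bounded_measurableB.
by apply: bounded_measurableD => //; exact: bounded_measurableM.
Qed.

(** [partition_integral] is used for both measures. The missing mass of [P] exceeds that of [Q] by
    at most the last sum, and the integrals of the step approximation differ by at most [B] times
    it: hence the factor [2 * B]. *)
Lemma partition_dist (P Q : {measure set T -> \bar R}) :
  P setT = 1%E -> Q setT = 1%E ->
  `|\int[P]_x F x - \int[Q]_x F x| <=
  2 * e + 2 * B * (1 - \sum_k \int[Q]_x phi k x) +
  2 * B * \sum_k `|\int[P]_x phi k x - \int[Q]_x phi k x|.
Proof.
move=> P1 Q1; have [x _] := nonempty_of_probability P1.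
have Bge0 := B0 x.
set S := \sum_k `|_|.
have PS : `|\sum_k \int[P]_x phi k x - \sum_k \int[Q]_x phi k x| <= S.
  by rewrite -sumrB ler_norm_sum.
have cS : `|\sum_k c k * \int[P]_x phi k x - \sum_k c k * \int[Q]_x phi k x| <= B * S.
  rewrite -sumrB (le_trans (ler_norm_sum _ _ _))// mulr_sumr.
  by apply: ler_sum => k _; rewrite -mulrBr normrM ler_wpM2r.
have := partition_integral P1; have := partition_integral Q1.
have : B * `|\sum_k \int[P]_x phi k x - \sum_k \int[Q]_x phi k x| <= B * S.
  by rewrite ler_wpM2l.
set p := \sum_k \int[P]_x phi k x; set q := \sum_k \int[Q]_x phi k x.
have : B * (q - p) <= B * `|p - q| by rewrite ler_wpM2l// distrC ler_norm.
move: cS; rewrite !ler_norml; set pc := \sum_k _; set qc := \sum_k _.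
rewrite -!mulrA !mulrBr; lra.
Qed.

End partition_bound.

(** * Separability and partitions for bounded Lipschitz functions *)

Section bounded_lipschitz.
Context d (R : realType) (D : borelMetricType d R).

Lemma continuous_measurable_borel (h : D -> R) :
  continuous h -> measurable_fun setT h.
Proof.
move=> /continuousP ch; apply: (measurability _ (RGenOInfty.measurableE R)) => //.
move=> _ [_ [a ->] <-]; rewrite setTI measurable_borel.
by apply: sub_sigma_algebra; apply: ch; exact: rray_open.
Qed.

Lemma lipschitz_measurable K (h : D -> R) :
  lipschitz_fun K h -> measurable_fun setT h.
Proof. by move=> /lipschitz_continuous /continuous_measurable_borel. Qed.

Lemma lip01_measurable (h : D -> R) : lip01 h -> measurable_fun setT h.
Proof. by move=> [_ [K /lipschitz_measurable]]. Qed.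

Lemma lip01_bounded_measurable (h : D -> R) : lip01 h -> bounded_measurable h.
Proof.
by move=> h01; apply: bounded_measurable01; [exact: lip01_measurable|case: h01].
Qed.

Lemma BL1_lipschitz (h : D -> R) : BL1 h -> lipschitz_fun 1 h.
Proof. by move=> [_ hl] x y; rewrite mul1r. Qed.

Lemma BL1_measurable (h : D -> R) : BL1 h -> measurable_fun setT h.
Proof. by move=> /BL1_lipschitz/lipschitz_measurable. Qed.

Lemma BL1_le1 (h : D -> R) : BL1 h -> forall x, `|h x| <= 1.
Proof. by move=> [h1 _] x; rewrite ler_norml. Qed.

(** A 1-Lipschitz [h] is the supremum of the cones [h a_i - mdist x a_i] over a dense sequence. The
    countable family consists of finite maxima of such cones with rational heights, cut off at 1
    and, through the initial value of the running maximum, at -1. *)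
Lemma pointwise_separable_BL1 (x0 : D) : separable D ->
  pointwise_separable (@BL1 R D).
Proof.
move=> /(separable_dense_seq x0)[a aP].
pose v (q : seq rat) i x : R := Num.min 1 (ratr (nth 0 q i) - 1 * mdist x (a i)).
pose gq q := running_max (-1) (v q) (size q).
have vl q i : lipschitz_fun 1 (v q i).
  exact: (lipschitz_min (lipschitz_cst _ ler01) (lipschitz_affine_mdist _ _ ler01)).
have gqBL q : BL1 (gq q).
  split=> [x|x y].
    rewrite running_max_ge/=; apply: le_running_max => [|i].
      exact: (le_trans (lerN10 R) ler01).
    by rewrite /v ge_min lexx.
  by have := lipschitz_running_max (-1) (size q) ler01 (vl q) x y; rewrite mul1r.
exists (fun n => gq (odflt [::] (choice.unpickle n))) => // h [h1 hl].
(* The heights stay below [h (a i)], so no cone exceeds [h], and come within [1 / m.+1] of it. *)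
have /choice[q qP] : forall mi : nat * nat, exists q : rat,
    h (a mi.2) - mi.1.+1%:R^-1 < ratr q < h (a mi.2).
  move=> [m i] /=; have [|q] := @rat_in_itvoo R (h (a i) - m.+1%:R^-1) (h (a i)).
    by rewrite ltrBlDr ltrDl invr_gt0.
  by rewrite in_itv/= => ?; exists q.
pose s m := [seq q (m, i) | i <- iota 0 m].
exists (fun m => choice.pickle (s m)) => x.
under eq_fun do rewrite choice.pickleK/=.
have hx y : `|h x - h y| <= mdist x y by exact: hl.
apply/cvgrPdist_le => e e0; have e4 : 0 < e / 4 by rewrite divr_gt0.
have [i xi] := aP x _ e4.
have [N N0 Ne] : exists2 N : nat, (0 < N)%N & N%:R^-1 <= e / 4.
  exists (Num.truncn (e / 4)^-1).+1 => //.
  by rewrite -[leRHS]invrK lef_pV2 ?posrE ?invr_gt0//; exact/ltW/truncnS_gt.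
near=> m.
have im : (i < m)%N by near: m; exact: nbhs_infty_gt.
have Nm : m.+1%:R^-1 <= e / 4.
  rewrite (le_trans _ Ne)// lef_pV2 ?posrE ?ltr0n// ler_nat.
  by rewrite leqW//; near: m; exact: nbhs_infty_ge.
have ub : gq (s m) x <= h x.
  rewrite /gq size_map size_iota.
  suff H k : (k <= m)%N -> running_max (-1) (v (s m)) k x <= h x by exact: H.
  elim: k => [_|k ih km] /=; first by have /andP[] := h1 x.
  rewrite ge_max ih 1?ltnW//= /v ge_min; apply/orP; right.
  rewrite (nth_map 0%N) ?size_iota// nth_iota// add0n mul1r.
  have := qP (m, k) => /=; have := hx (a k); rewrite ler_norml; lra.
(* The single cone at [a i] is enough: one [e / 4] for the rational height, one for the distance to
   [x]. A third is lost between [h (a i)] and [h x]. *)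
have lb : Num.min 1 (h (a i) - e / 4 - e / 4) <= gq (s m) x.
  apply: le_trans (running_max_ge_nth (-1) (v (s m)) x (_ : (i < size (s m))%N)).
    rewrite /v (nth_map 0%N) ?size_iota// nth_iota// add0n mul1r.
    rewrite le_min !ge_min lexx/=; apply/orP; right.
    have := qP (m, i) => /=; move: Nm; set t := _^-1; lra.
  by rewrite size_map size_iota.
have := hx (a i); have := h1 x; move: lb; rewrite minEle !ler_norml.
by case: ifPn => _; lra.
Unshelve. all: by end_near. Qed.

Lemma finitely_controlled_BL1 (G : set (D -> R)) (Q : probability D R) :
  (forall phi, G phi -> bounded_measurable phi) -> has_partition G Q ->
  finitely_controlled (@BL1 R D) G Q.
Proof.
move=> bG pG e e0; have e4 : 0 < e / 4 by rewrite divr_gt0.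
have [K [phi [a [Gphi phi0 phi1 phia phiQ]]]] := pG _ e4.
(* With [B = 1] and [c k = h (a k)], [partition_dist] yields [2 * (e / 4)] for the oscillation, at
   most [2 * (e / 4)] for the missing mass, and the factor 2. *)
exists K, phi, 2; split=> // P P1 h Hh.
have := @partition_dist _ _ R K phi h (h \o a) (e / 4) 1.
have bh : bounded_measurable h.
  by split; [exact: BL1_measurable|exists 1; exact: BL1_le1].
move=> /(_ bh (fun k => bG _ (Gphi k)) (BL1_le1 Hh) (fun k => BL1_le1 Hh _)).
move=> /(_ (ltW e4) phi0 phi1) H.
have {H} := H _ P Q P1 (probability_setT Q).
rewrite !mulr1 => H; apply: (le_trans (H _)); last by lra.
move=> k x /phia; apply: le_trans.
by case: Hh => _ /(_ x (a k)).
Qed.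

(* With bumps [v_i] equal to 1 on the ball of radius [e / 2] around the i-th
   point of a dense sequence and to 0 off the ball of radius [e], the functions
   [max_(j <= i) v_j - max_(j < i) v_j] telescope to [max_j v_j]. *)
Lemma has_partition_lip01 (Q : probability D R) :
  separable D -> has_partition (@lip01 R D) Q.
Proof.
have [x0 _] := nonempty_of_probability (probability_setT Q).
move=> /(separable_dense_seq x0)[a aP] e e0.
pose v i x : R := Num.max 0 (Num.min 1 (2 - (2 / e) * mdist x (a i))).
have K0 : 0 <= 2 / e by rewrite divr_ge0// ltW.
have vl i : lipschitz_fun (2 / e) (v i).
  apply: (lipschitz_max (lipschitz_cst _ K0)).
  exact: (lipschitz_min (lipschitz_cst _ K0) (lipschitz_affine_mdist _ _ K0)).
have v1 i x : v i x <= 1 by rewrite /v ge_max ler01 ge_min lexx.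
pose m := running_max 0 v.
have ml N : lipschitz_fun (2 / e) (m N) by exact: lipschitz_running_max.
have m01 N x : 0 <= m N x <= 1.
  by rewrite running_max_ge le_running_max.
pose phi i x := m i.+1 x - m i x.
have phi0 i x : 0 <= phi i x by rewrite subr_ge0 /m /= le_max lexx.
have sphi N x : \sum_(k < N) phi k x = m N x.
  by rewrite -(big_mkord xpredT (phi ^~ x)) telescope_sumr// /m/= subr0.
pose U N := [set x | 1 <= m N x].
have mU N : measurable (U N).
  rewrite -[X in measurable X]setTI /U -preimage_itvcy.
  by apply: (lipschitz_measurable (ml N)) => //; exact: measurable_itv.
(* By density the increasing sets [U N], on which the first [N] functions sum to 1, exhaust the
   space; continuity of [Q] from below then replaces compactness. *)
have UT : \bigcup_N U N = setT.
  rewrite -subTset => x _; have [|i xi] := aP x (e / 2); first by rewrite divr_gt0.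
  exists i.+1 => //; rewrite /U/= le_max /v le_max le_min lexx/=.
  apply/orP; right; apply/orP; right.
  rewrite lerBrDl -lerBrDr (_ : 2 - 1 = 1 :> R); last by ring.
  by rewrite mulrAC ler_pdivrMr// mul1r mulrC -ler_pdivlMr// ltW.
have Um N x : U N x -> m N x = 1.
  by move=> Ux; apply/eqP; rewrite eq_le; apply/andP; split; [case/andP: (m01 N x)|].
have [N QN] : exists N, 1 - e <= fine (Q (U N)).
  have : Q \o U @ \oo --> Q (\bigcup_N U N).
    apply: nondecreasing_cvg_mu => //; first by rewrite UT.
    move=> N M NM; apply/subsetPset => x /= Ux; apply: (le_trans Ux).
    rewrite -(subnKC NM); elim: (M - N)%N => [|k ih]; first by rewrite addn0.
    by rewrite addnS (le_trans ih)// /m/= le_max lexx.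
  rewrite UT probability_setT => /fine_cvg/cvgrPdist_le/(_ _ e0)[N _ /(_ N (leqnn N))].
  move=> H; exists N; move: H; rewrite /= ler_norml => /andP[_]; lra.
have ilip k : lip01 (phi k).
  split=> [x|]; first by rewrite phi0/= /phi; have := m01 k.+1 x; have := m01 k x; lra.
  by eexists; exact: (lipschitzB (ml k.+1) (ml k)).
exists 'I_N, (fun k : 'I_N => phi k), (fun k : 'I_N => a k); split=> //.
- by move=> x; rewrite sphi; have /andP[] := m01 N x.
- move=> k x kx; have := running_maxS_neq kx; rewrite /v lt_max ltxx/= lt_min ltr01/=.
  rewrite subr_gt0 mulrAC ltr_pdivrMr// ltr_pM2l//; exact: ltW.
rewrite -(bmRintegral_sum (probability_setT Q)); last first.
  by move=> k; exact: lip01_bounded_measurable.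
rewrite (le_trans QN)// -Rintegral_indic//; apply: (le_bmRintegral (probability_setT Q)).
- exact: bounded_measurable_indic.
- by apply: bounded_measurable_sum => k; exact: lip01_bounded_measurable.
move=> x; rewrite sphi indicE; have [|_] := boolP (x \in _).
  by rewrite inE => /Um ->.
by have /andP[] := m01 N x.
Qed.

End bounded_lipschitz.

(** * Joint weak convergence *)

Section tuple_topology.

Lemma cvg_initial (S : choiceType) (T : topologicalType) (f : S -> T)
    (F : set_system S) (s : S) : Filter F ->
  f @ F --> f s -> F --> (s : initial_topology f).
Proof.
move=> FF Ffs A /= [_ [[B Bop <-] Bfs sBfA]].
have FB : F (f @^-1` B) by apply: Ffs; exact: open_nbhs_nbhs.
exact: filterS FB.
Qed.

Lemma tnth_continuous n (T : topologicalType) (j : 'I_n) :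
  continuous (fun t : n.-tuple T => tnth t j).
Proof.
move=> t; pose f (t : n.-tuple T) := tnth t : prod_topology (fun _ : 'I_n => T).
have ct : {for t, continuous f} by exact: (@initial_continuous (n.-tuple T) _ f).
have cj : {for f t, continuous (fun g : prod_topology (fun _ : 'I_n => T) => g j)}.
  exact: (@proj_continuous 'I_n (fun _ => T) j).
exact: (continuous_comp ct cj).
Qed.

(** The filter generated by the boxes around [t] converges to [t] in each coordinate, hence in the
    product topology, so every neighbourhood contains a box. *)
Lemma tuple_nbhs_mdist (R : realType) n (T : metricType R) (t : n.-tuple T)
    (A : set (n.-tuple T)) : nbhs t A ->
  exists2 r : R, 0 < r &
    forall s, (forall j, mdist (tnth t j) (tnth s j) < r) -> A s.
Proof.
pose B (r : R) := [set s : n.-tuple T | forall j, mdist (tnth t j) (tnth s j) < r].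
pose F := filter_from [set r : R | 0 < r] B.
have FF : Filter F.
  apply: filter_from_filter; first by exists 1; exact: ltr01.
  move=> r s /= r0 s0; exists (Num.min r s); first by rewrite /= lt_min r0.
  by move=> u Bu; split=> j; have := Bu j; rewrite lt_min => /andP[].
have Ft : F --> t.
  pose f (t : n.-tuple T) := tnth t : prod_topology (fun _ : 'I_n => T).
  apply: (@cvg_initial (n.-tuple T) _ f F t FF).
  apply/cvg_sup => j; apply: cvg_initial.
  apply/metricType_numDomainType.cvgrPdist_lt => e e0.
  by exists e => // s /(_ j).
by move=> /Ft [r r0 BA]; exists r => // s Bs; exact: BA.
Qed.

End tuple_topology.

Section power_prob_integral.
Context d (T : measurableType d) (R : realType) (Q : probability T R).

Lemma bounded_measurable_tnth n (h : 'I_n -> T -> R) :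
  (forall j, bounded_measurable (h j)) ->
  bounded_measurable (fun t : n.-tuple T => \prod_j h j (tnth t j)).
Proof.
move=> bh; apply: bounded_measurable_prod => j.
exact: (bounded_measurable_comp (measurable_tnth j) (bh j)).
Qed.

Lemma integral_power_prob n (h : 'I_n -> T -> R) :
  (forall j, measurable_fun setT (h j)) -> (forall j x, 0 <= h j x <= 1) ->
  \int[power_prob Q n]_t \prod_j h j (tnth t j) = \prod_j \int[Q]_x h j x.
Proof.
elim: n h => [|n ih] h mh h01.
  have [mP _] : bounded_measurable (fun t : 0.-tuple T => \prod_j h j (tnth t j)).
    by apply: bounded_measurable_tnth => j; exact: bounded_measurable01.
  rewrite /Rintegral [power_prob Q 0]/= integral_dirac//.
    by rewrite diracT mul1e/= !big_ord0.
  exact/measurable_EFinP.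
have bh j : bounded_measurable (h j) by exact: bounded_measurable01.
have bP := bounded_measurable_tnth bh.
rewrite [RHS]big_ord_recl [LHS]/Rintegral [power_prob Q n.+1]/=.
rewrite ge0_integral_distribution; last 2 first.
- by apply/measurable_EFinP; exact: bP.1.
- by move=> t; rewrite lee_fin; apply: prodr_ge0 => j _; have /andP[] := h01 j (tnth t j).
pose g (p : T * n.-tuple T) : R := h ord0 p.1 * \prod_j h (lift ord0 j) (tnth p.2 j).
have bg2 : bounded_measurable (fun t : n.-tuple T => \prod_j h (lift ord0 j) (tnth t j)).
  exact: (@bounded_measurable_tnth n (fun j => h (lift ord0 j))).
have bg : bounded_measurable g.
  apply: bounded_measurableM.
    exact: (bounded_measurable_comp measurable_fst).
  exact: (bounded_measurable_comp measurable_snd bg2).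
rewrite (_ : _ \o _ = EFin \o g); last first.
  apply/funext => -[x t] /=; rewrite big_ord_recl tnth0 /g/=; congr (_ * _)%:E.
  by apply: eq_bigr => j _; rewrite tnthS.
rewrite fubini_tonelli1; last 2 first.
- by apply/measurable_EFinP; exact: bg.1.
- move=> [x t]; rewrite lee_fin mulr_ge0//; first by have /andP[] := h01 ord0 x.
  by apply: prodr_ge0 => j _; have /andP[] := h01 (lift ord0 j) (tnth t j).
pose c := \int[power_prob Q n]_t \prod_j h (lift ord0 j) (tnth t j).
have N1 := probability_setT (power_prob Q n).
transitivity (\int[Q]_x (c * h ord0 x)).
  rewrite /Rintegral; congr fine; apply: eq_integral => x _.
  rewrite /fubini_F/= /g/= (Rintegral_EFin N1); last first.
    by apply: bounded_measurableM => //; exact: bounded_measurable_cst.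
  by rewrite (bmRintegralZ N1)// mulrC.
rewrite (bmRintegralZ (probability_setT Q))// mulrC /c.
by rewrite (ih (fun j => h (lift ord0 j))).
Qed.

End power_prob_integral.

Lemma infs0_le (R : realType) (u : R^nat) i c :
  (forall i, c <= u i) -> infs u 0%N <= u i.
Proof.
move=> cu; apply: ge_inf; last by exists i.
by exists c => _ [j _ <-]; exact: cu.
Qed.

Lemma le_infs0 (R : realType) (u : R^nat) c :
  (forall i, c <= u i) -> c <= infs u 0%N.
Proof.
move=> cu; apply: lb_le_inf; first by exists (u 0%N), 0%N.
by move=> _ [j _ <-]; exact: cu.
Qed.

(** * Reduction of weak convergence on tuples to Lipschitz functions *)

Section tuple_weak_cvg.
Context d (R : realType) (D : borelMetricType d R) (n : nat).
Implicit Types s t : n.-tuple D.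

(** Tuples carry the product topology here; the link between it and this distance is made in
    [near_f]. *)
Definition tdist s t : R := \sum_j mdist (tnth s j) (tnth t j).

Lemma tdist_ge0 s t : 0 <= tdist s t.
Proof. by apply: sumr_ge0 => j _; exact: mdist_ge0. Qed.

Lemma tdist_triangle s t u : tdist s u <= tdist s t + tdist t u.
Proof.
by rewrite /tdist -big_split; apply: ler_sum => j _; exact: metric_triangle.
Qed.

Lemma measurable_tdist s : measurable_fun setT (tdist^~ s).
Proof.
apply: measurable_sum => j.
have l : lipschitz_fun 1 (fun x : D => 0 - 1 * mdist x (tnth s j)).
  exact/lipschitz_affine_mdist.
have m : measurable_fun setT (fun x : D => mdist x (tnth s j)).
  rewrite (_ : (fun x : D => _) = (fun x : D => - (0 - 1 * mdist x (tnth s j)))).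
    by apply: measurable_funN; exact: lipschitz_measurable l.
  by apply/funext => x; rewrite mul1r sub0r opprK.
exact: (measurableT_comp m (measurable_tnth j)).
Qed.

Hypothesis sD : separable D.
Variable x0 : D.

Lemma tuple_dense_seq : exists a : nat -> n.-tuple D,
  forall t e, 0 < e -> exists i, tdist t (a i) < e.
Proof.
have [a aP] := separable_dense_seq x0 sD.
(* The integer [i] codes a list of indices into the dense sequence of [D], one for each
   coordinate. *)
exists (fun i => [tuple a (nth 0%N (odflt [::] (choice.unpickle i)) j) | j < n]).
move=> t e e0; have e1 : 0 < e / n.+1%:R by rewrite divr_gt0.
have /choice[k kP] : forall j : 'I_n, exists i, mdist (tnth t j) (a i) < e / n.+1%:R.
  by move=> j; exact: aP.
exists (choice.pickle (codom k)).
apply: (@le_lt_trans _ _ (\sum_(j < n) e / n.+1%:R)).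
  apply: ler_sum => j _; rewrite tnth_mktuple choice.pickleK/=.
  by rewrite (nth_map j) ?size_enum_ord// nth_ord_enum ltW.
rewrite sumr_const card_ord -[ltLHS]mulr_natl mulrA ltr_pdivrMr//.
by rewrite mulrC ltr_pM2l// ltr_nat.
Qed.

Section regularization.
Variables (a : nat -> n.-tuple D) (f : n.-tuple D -> R) (B : R).
Hypothesis aP : forall t e, 0 < e -> exists i, tdist t (a i) < e.
Hypothesis cf : continuous f.
Hypothesis fB : forall t, `|f t| <= B.

(* the largest [k]-Lipschitz minorant of [f] *)
Let reg (k : nat) t : R := infs (fun i => f (a i) + k%:R * tdist t (a i)) 0%N.

Let reg_lb k t i : - B <= f (a i) + k%:R * tdist t (a i).
Proof.
rewrite -[leLHS]addr0 lerD// ?mulr_ge0 ?tdist_ge0//.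
by have := fB (a i); rewrite ler_norml => /andP[].
Qed.

Let reg_ge k t : - B <= reg k t.
Proof. exact: le_infs0 (reg_lb k t). Qed.

Let near_f t e : 0 < e -> exists2 r, 0 < r &
  forall s, tdist t s < r -> `|f t - f s| < e.
Proof.
move=> e0; have /cvgrPdist_lt/(_ _ e0) := @cf t.
move=> /tuple_nbhs_mdist[r r0 rP]; exists r => // s sr; apply: rP => j.
apply: le_lt_trans sr; rewrite /tdist (bigD1 j)//= lerDl.
by apply: sumr_ge0 => i _; exact: mdist_ge0.
Qed.

Let reg_le k t : reg k t <= f t.
Proof.
apply/ler_addgt0Pr => e e0; have e2 : 0 < e / 2 by rewrite divr_gt0.
have [r r0 rP] := near_f t e2.
(* The first bound keeps [f (a i)] near [f t], the second makes the penalty at most [e / 2]; [k.+1]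
   allows [k = 0]. *)
have c0 : 0 < Num.min r (e / 2 / k.+1%:R) by rewrite lt_min r0 divr_gt0.
have [i] := aP t c0; rewrite lt_min => /andP[ir ik].
apply: (le_trans (infs0_le i (reg_lb k t))).
have := rP _ ir; rewrite ltr_norml => /andP[fa _].
have : k%:R * tdist t (a i) <= e / 2.
  rewrite ltr_pdivlMr// in ik; rewrite (le_trans _ (ltW ik))// mulrC.
  by rewrite ler_wpM2l ?tdist_ge0// ler_nat.
lra.
Qed.

Let reg_lipschitz k s t : `|reg k s - reg k t| <= k%:R * tdist s t.
Proof.
have sym u v : tdist u v = tdist v u by apply: eq_bigr => j _; exact: metric_sym.
have le u v : reg k u - k%:R * tdist u v <= reg k v.
  apply: le_infs0 => i; rewrite lerBlDr (le_trans (infs0_le i (reg_lb k u)))//.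
  rewrite -addrA lerD2l -mulrDr ler_wpM2l// addrC; exact: tdist_triangle.
have := le s t; have := le t s; rewrite (sym t s) ler_norml; lra.
Qed.

Let reg_cvg t : reg k t @[k --> \oo] --> f t.
Proof.
apply/cvgrPdist_le => e e0; have [r r0 rP] := near_f t e0.
near=> k; rewrite ger0_norm ?subr_ge0// lerBlDr -lerBlDl.
apply: le_infs0 => i; have [ir|ir] := ltP (tdist t (a i)) r.
  have := rP _ ir; rewrite ltr_norml => /andP[_ fa].
  have : 0 <= k%:R * tdist t (a i) by rewrite mulr_ge0 ?tdist_ge0.
  lra.
(* At distance [r] or more the penalty is at least [2 * B], so that [f (a i)] plus the penalty is at
   least [B], hence at least [f t]. *)
have kr : 2 * B <= k%:R * r.
  rewrite -ler_pdivrMr//; near: k; exact: nbhs_infty_ger.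
have : k%:R * r <= k%:R * tdist t (a i) by rewrite ler_wpM2l.
have := fB t; have := fB (a i); rewrite !ler_norml => /andP[h1 _] /andP[_ h2].
lra.
Unshelve. all: by end_near. Qed.

Let reg_measurable k : measurable_fun setT (reg k).
Proof.
apply: measurable_fun_infs => [t _|i].
  by exists (- B) => _ [i _ <-]; exact: reg_lb.
apply: measurable_funD; first exact: measurable_cst.
by apply: measurable_funM; [exact: measurable_cst|exact: measurable_tdist].
Qed.

Let regB k t : `|reg k t| <= B.
Proof.
rewrite ler_norml reg_ge/= (le_trans (reg_le k t))//.
exact: (le_trans (ler_norm _) (fB t)).
Qed.

(** Here the product topology meets the product sigma-algebra. Because the infimum in [reg] runs
    over the sequence [a] only, [reg k] is a countable infimum of measurable functions whether or
    not [f] is known to be measurable. *)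
Lemma tuple_continuous_measurable : measurable_fun setT f.
Proof. by apply: (measurable_fun_cvg reg_measurable) => t _; exact: reg_cvg. Qed.

(** One half of the portmanteau argument: [reg k] lies below [f], has a nearby integral under [Q],
    and is among the functions for which convergence is assumed. The other half is this one for
    [- f]. *)
Lemma tuple_liminf (mu : nat -> probability (n.-tuple D) R)
    (Q : probability (n.-tuple D) R) :
  (forall F L, bounded_measurable F ->
    (forall s t, `|F s - F t| <= L * tdist s t) ->
    \int[mu m]_t F t @[m --> \oo] --> \int[Q]_t F t) ->
  forall e, 0 < e ->
    \forall m \near \oo, \int[Q]_t f t - e <= \int[mu m]_t f t.
Proof.
move=> muF e e0; have e2 : 0 < e / 2 by rewrite divr_gt0.
have breg k : bounded_measurable (reg k) by split=> //; exists B.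
have bf : bounded_measurable f.
  by split; [exact: tuple_continuous_measurable|exists B].
have : \int[Q]_t reg k t @[k --> \oo] --> \int[Q]_t f t.
  exact: (cvg_bmRintegral (probability_setT Q) reg_measurable regB reg_cvg).
move=> /cvgrPdist_le/(_ _ e2)[k _ /(_ k (leqnn k))/=].
rewrite ler_norml => /andP[_ Qk].
have /cvgrPdist_le/(_ _ e2) := muF _ _ (breg k) (reg_lipschitz k).
apply: filterS => m; rewrite ler_norml => /andP[_ mk].
have : \int[mu m]_t reg k t <= \int[mu m]_t f t.
  exact: (le_bmRintegral (probability_setT (mu m))).
lra.
Qed.

End regularization.

Lemma tuple_weak_cvg (mu : nat -> probability (n.-tuple D) R)
    (Q : probability (n.-tuple D) R) :
  (forall F L, bounded_measurable F ->
    (forall s t, `|F s - F t| <= L * tdist s t) ->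
    \int[mu m]_t F t @[m --> \oo] --> \int[Q]_t F t) ->
  weak_cvg mu Q.
Proof.
move=> muF f cf bf; have [a aP] := tuple_dense_seq.
have [B fB] : exists B, forall t, `|f t| <= B.
  have [M [_ /(_ (M + 1))]] := bf.
  by rewrite ltrDl ltr01 => /(_ isT) fM; exists (M + 1) => t; exact: fM.
have bmf : bounded_measurable f.
  by split; [exact: (tuple_continuous_measurable aP cf fB)|exists B].
have cNf : continuous (fun t => - f t) by move=> t; exact: (cvgN (cf t)).
have NfB t : `|- f t| <= B by rewrite normrN.
have NE (m : probability (n.-tuple D) R) :
    \int[m]_t (- f t) = - \int[m]_t f t.
  rewrite -mulN1r -(bmRintegralZ (probability_setT m))//.
  by apply: eq_Rintegral => t _; rewrite mulN1r.
rewrite (Rintegral_EFin (probability_setT Q))//.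
under eq_fun do rewrite (Rintegral_EFin (probability_setT (mu _)))//.
apply: cvg_EFin; first exact: nearW.
apply/cvgrPdist_le => e e0.
have := tuple_liminf aP cNf NfB muF e0; have := tuple_liminf aP cf fB muF e0.
by apply: filterS2 => m; rewrite /= !NE ler_norml; lra.
Qed.

End tuple_weak_cvg.

Section product_weak_cvg.
Context d (R : realType) (D : borelMetricType d R).
Variable Q : probability D R.

Let Q1 : Q setT = 1%E := probability_setT Q.

(** Products of members of a partition on [D] form a partition on tuples, and their integrals are
    exactly those assumed to converge; [partition_dist] then handles every bounded Lipschitz [F]. *)
Lemma product_weak_cvg n (mu : nat -> probability (n.-tuple D) R) :
  separable D ->
  (forall h : 'I_n -> D -> R, (forall j, lip01 (h j)) ->
    \int[mu m]_t \prod_j h j (tnth t j) @[m --> \oo] -->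
    \prod_j \int[Q]_x h j x) ->
  weak_cvg mu (power_prob Q n).
Proof.
move=> sD muh; have [x0 _] := nonempty_of_probability Q1.
apply: (tuple_weak_cvg sD x0) => F L [mF [B FB]] FL.
have bF : bounded_measurable F by split=> //; exists B.
have B0 : 0 <= B by apply: (le_trans (normr_ge0 (F [tuple x0 | _ < n]))); exact: FB.
have FL' s t : `|F s - F t| <= `|L| * tdist s t.
  by rewrite (le_trans (FL s t))// ler_wpM2r ?tdist_ge0// ler_norm.
have QN1 := probability_setT (power_prob Q n).
apply/cvgrPdist_le => e e0.
(* In units of [e1], [F] oscillates by at most [|L| * n] on a box and the product partition misses a
   mass of at most [n]. The sum 1 keeps [C] positive, and [C * e1] is [e / 2]; the other half pays
   for the differences of integrals. *)
pose C := 2 * (`|L| * n%:R) + 2 * B * n%:R + 1.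
have C0 : 0 < C by rewrite ltr_wpDl// addr_ge0// !mulr_ge0.
pose e1 := e / 2 / C; have e10 : 0 < e1 by rewrite !divr_gt0.
have [K [phi [a [Gphi phi0 phi1 phia phiQ]]]] := has_partition_lip01 Q sD e10.
pose psi (m : {ffun 'I_n -> K}) (t : n.-tuple D) := \prod_j phi (m j) (tnth t j).
pose b (m : {ffun 'I_n -> K}) : n.-tuple D := [tuple a (m j) | j < n].
have bphi k := lip01_bounded_measurable (Gphi k).
have bpsi m : bounded_measurable (psi m).
  exact: (@bounded_measurable_tnth _ _ _ n (fun j => phi (m j))).
have psi0 m t : 0 <= psi m t by apply: prodr_ge0.
have psiE t : \sum_m psi m t = \prod_(j < n) \sum_k phi k (tnth t j).
  by rewrite bigA_distr_bigA.
have psi1 t : \sum_m psi m t <= 1.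
  have s01 (j : 'I_n) : 0 <= \sum_k phi k (tnth t j) <= 1.
    by rewrite phi1 andbT sumr_ge0.
  by rewrite psiE; have /andP[] := prodr01 (index_enum 'I_n) s01.
have psib m t : psi m t != 0 -> `|F t - F (b m)| <= `|L| * n%:R * e1.
  move=> /prodf_neq0 mt; rewrite (le_trans (FL' _ _))// -mulrA ler_wpM2l//.
  rewrite (@le_trans _ _ (\sum_(j < n) e1))//; last first.
    by rewrite sumr_const card_ord -[leLHS]mulr_natl.
  by apply: ler_sum => j _; rewrite tnth_mktuple; apply: phia; exact: mt.
have psiQ : 1 - n%:R * e1 <= \sum_m \int[power_prob Q n]_t psi m t.
  have -> : \sum_m \int[power_prob Q n]_t psi m t =
      \prod_(j < n) \sum_k \int[Q]_x phi k x.
    rewrite bigA_distr_bigA; apply: eq_bigr => m _.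
    rewrite (integral_power_prob Q (h := fun j => phi (m j)))//.
      by move=> j; exact: lip01_measurable.
    by move=> j; case: (Gphi (m j)).
  set s := \sum_k \int[Q]_x phi k x in phiQ *.
  have s01 : 0 <= s <= 1.
    apply/andP; split; first by apply: sumr_ge0 => k _; exact: Rintegral_ge0.
    rewrite /s -(bmRintegral_sum Q1)// -[leRHS](bmRintegral_cst Q1).
    apply: (le_bmRintegral Q1) => //; first exact: bounded_measurable_sum.
    exact: bounded_measurable_cst.
  (* Bernoulli's inequality [1 - s ^ n <= n * (1 - s)], as a case of the bound on products. *)
  have := @dist_prod_le R _ (index_enum 'I_n) (fun=> 1) (fun=> s).
  move=> /(_ (fun=> ltac:(by rewrite ler01 lexx)) (fun=> s01)).
  rewrite big1_eq sumr_const card_ord -[leRHS]mulr_natl.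
  have : n%:R * `|1 - s| <= n%:R * e1.
    by rewrite ler_wpM2l// ger0_norm ?subr_ge0//; [lra|case/andP: s01].
  move=> h1 h2; have := le_trans h2 h1; rewrite ler_norml => /andP[_]; lra.
have Le : 0 <= `|L| * n%:R * e1 by apply: mulr_ge0 (ltW e10); exact: mulr_ge0.
have H (P : probability (n.-tuple D) R) :=
  partition_dist bF bpsi FB (fun m => FB (b m)) Le psi0 psi1 psib
    (probability_setT P) QN1.
have cS : \sum_m `|\int[mu i]_t psi m t - \int[power_prob Q n]_t psi m t| @[i --> \oo]
    --> (0 : R).
  have : \sum_m `|\int[mu i]_t psi m t - \int[power_prob Q n]_t psi m t| @[i --> \oo]
    --> \sum_m `|\int[power_prob Q n]_t psi m t - \int[power_prob Q n]_t psi m t|.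
    apply: cvg_rsum => m; apply: cvg_norm; apply: cvgB; last exact: cvg_cst.
    rewrite [X in _ --> X](integral_power_prob Q (h := fun j => phi (m j))).
    - by apply: (muh (fun j => phi (m j))) => j; exact: Gphi.
    - by move=> j; exact: lip01_measurable.
    - by move=> j; case: (Gphi (m j)).
  by under [X in _ --> X]eq_bigr do rewrite subrr normr0; rewrite big1_eq.
have B1 : 0 < 2 * B + 1 by rewrite ltr_wpDl// mulr_ge0.
have /cvgrPdist_le/(_ (e / 2 / (2 * B + 1))) := cS.
move=> /(_ (ltac:(by rewrite !divr_gt0))).
apply: filterS => i; rewrite sub0r normrN ger0_norm ?sumr_ge0// => Si.
rewrite distrC; apply: (le_trans (H (mu i))).
set S := \sum_m `|_| in Si *.
have S0 : 0 <= S by apply: sumr_ge0.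
have h1 : (2 * B + 1) * S <= e / 2.
  by rewrite mulrC -ler_pdivlMr.
have h2 : C * e1 = e / 2 by rewrite /e1 mulrC divfK// gt_eqF.
have h3 : B * (1 - \sum_m \int[power_prob Q n]_t psi m t) <= B * (n%:R * e1).
  by rewrite ler_wpM2l//; lra.
rewrite /C !mulrDl mul1r in h2.
move: h1; rewrite mulrDl mul1r -!mulrA in h2 *.
set X := B * (1 - _) in h3 *; set Y := B * (n%:R * e1) in h2 h3 *.
set Z := `|L| * (n%:R * e1) in h2 *; set W := B * S; lra.
Qed.

End product_weak_cvg.

Lemma Rintegral_distribution d (T : measurableType d) d' (T' : measurableType d')
    (R : realType) (P : probability T R) (X : {RV P >-> T'}) (h : T' -> R) :
  bounded_measurable h ->
  \int[distribution P X]_y h y = \int[P]_w h (X w).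
Proof.
move=> bh; rewrite /Rintegral integral_distribution//.
  by apply/measurable_EFinP; exact: bh.1.
apply: (bounded_measurable_integrable (probability_setT P)).
exact: (bounded_measurable_comp (measurable_funPT X)).
Qed.

Lemma weak_cvg_Rintegral d (T : topMeasurableType d) (R : realType)
    (mu : nat -> probability T R) (Q : probability T R) (h : T -> R) :
  weak_cvg mu Q -> continuous h -> bounded_measurable h ->
  \int[mu n]_x h x @[n --> \oo] --> \int[Q]_x h x.
Proof.
move=> muQ ch [mh [B hB]].
have hb : [bounded h x | x in [set: T]].
  exists B; split=> [|M BM x _ /=]; first exact: num_real.
  by rewrite (le_trans (hB x))// ltW.
apply: fine_cvg; have := muQ h ch hb.
by rewrite (Rintegral_EFin (probability_setT Q))//; split=> //; exists B.
Qed.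

(** * Joint convergence against conditional convergence *)

Section joint_convergence.
Context dO (Omega : measurableType dO) (R : realType) (P : probability Omega R).
Context dD (D : borelMetricType dD R) (rm : resampling_mechanism P D).
Variable Q : probability D R.
Hypothesis sQ : stat_weak_cvg rm Q.

Let P1 : P setT = 1%E := probability_setT P.
Let Q1 : Q setT = 1%E := probability_setT Q.

Lemma lip01_continuous (h : D -> R) : lip01 h -> continuous h.
Proof. by move=> [_ [K /lipschitz_continuous]]. Qed.

Lemma stat_cvg_lip01 (h : D -> R) : lip01 h ->
  \int[distribution P (stat rm n)]_x h x @[n --> \oo] --> \int[Q]_x h x.
Proof.
move=> lh; apply: (weak_cvg_Rintegral sQ).
  exact: lip01_continuous.
exact: lip01_bounded_measurable.
Qed.

(** S_n is a function of the data, so it enters conditional independence as the factor [f]. The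
    conditional means are replaced by the constants [q], at the cost of the sum of their L1 errors;
    what remains, [p] times the mean of [f], converges because S_n does. *)
Lemma cond_L1_cvg_joint M : separable D ->
  (forall h, lip01 h -> cond_L1_cvg rm Q h) -> joint_weak_cvg rm Q M.
Proof.
move=> sD cQ; apply: (product_weak_cvg sD) => h lh.
have h01 j y : 0 <= h j y <= 1 by case: (lh j) => + _; apply.
have mh j : measurable_fun setT (h j) by exact: lip01_measurable.
have bh j := lip01_bounded_measurable (lh j).
have bprod := @bounded_measurable_tnth _ _ _ M.+1 h bh.
pose f n x := h ord0 (stat_fun rm n x).
have mf n : measurable_fun setT (f n).
  exact: (measurableT_comp (mh ord0) (measurable_funPT (stat_fun rm n))).
have E n : \int[distribution P (stat_rep rm M n)]_t \prod_j h j (tnth t j) =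
    \int[P]_w (f n (data rm n w) *
      \prod_(j < M) cond_mean rm n (h (lift ord0 j)) (data rm n w)).
  rewrite Rintegral_distribution// -rep_cond_independentE//; last first.
    by move=> x; exact: h01.
  apply: eq_Rintegral => w _; rewrite big_ord_recl; congr (_ * _).
  apply: eq_bigr => j _; congr (h _ _).
  by rewrite /stat_rep tnthS tnth_mktuple.
under eq_fun do rewrite E.
pose q j := \int[Q]_x h j x.
have q01 j : 0 <= q j <= 1 by exact: bmRintegral01.
rewrite big_ord_recl -/(q ord0).
have cf : \int[P]_w f n (data rm n w) @[n --> \oo] --> q ord0.
  have := stat_cvg_lip01 (lh ord0); apply: cvg_trans; apply: near_eq_cvg.
  by apply: nearW => n; rewrite Rintegral_distribution.
have cm : \sum_(j < M) \int[P]_w `|cond_mean rm n (h (lift ord0 j)) (data rm n w) -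
    q (lift ord0 j)| @[n --> \oo] --> \sum_(j < M) (0 : R).
  by apply: cvg_rsum => j; exact: cQ.
rewrite big1_eq in cm.
apply/cvgrPdist_le => e e0; have e2 : 0 < e / 2 by rewrite divr_gt0.
have /cvgrPdist_le/(_ _ e2) := cf; have /cvgrPdist_le/(_ _ e2) := cm.
apply: filterS2 => n; rewrite sub0r normrN => cmn cfn.
set p := \prod_(j < M) \int[Q]_x h (lift ord0 j) x.
have p01 : 0 <= p <= 1 by apply: prodr01 => j; exact: q01.
have bf : bounded_measurable (fun w => f n (data rm n w)).
  apply: (bounded_measurable_comp (measurable_funPT (data rm n))).
  by apply: bounded_measurable01 => // x; exact: h01.
have bm j : bounded_measurable
    (fun w => cond_mean rm n (h (lift ord0 j)) (data rm n w)).
  exact: bounded_measurable_cond_mean_data.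
have bmp : bounded_measurable (fun w =>
    \prod_(j < M) cond_mean rm n (h (lift ord0 j)) (data rm n w)).
  exact: bounded_measurable_prod.
rewrite (le_trans (ler_distD (p * \int[P]_w f n (data rm n w)) _ _))//.
rewrite [leRHS]splitr lerD//.
  rewrite mulrC -mulrBr normrM ger0_norm; last by case/andP: p01.
  by rewrite (le_trans _ cfn)// ler_piMl//; case/andP: p01.
rewrite -(bmRintegralZ P1)// -(bmRintegralB P1); last 2 first.
- by apply: bounded_measurableM => //; exact: bounded_measurable_cst.
- exact: bounded_measurableM.
apply: le_trans (le_trans (ler_norm _) cmn).
rewrite -(bmRintegral_sum P1); last first.
  move=> j; apply/bounded_measurable_norm/bounded_measurableB => //.
  exact: bounded_measurable_cst.
have bbig : bounded_measurable (fun w => p * f n (data rm n w) -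
   f n (data rm n w) *
   \prod_(j < M) cond_mean rm n (h (lift ord0 j)) (data rm n w)).
  apply: bounded_measurableB; last exact: bounded_measurableM.
  by apply: bounded_measurableM => //; exact: bounded_measurable_cst.
apply: (le_trans (le_norm_bmRintegral P1 bbig)); apply: (le_bmRintegral P1).
- exact: bounded_measurable_norm.
- apply: bounded_measurable_sum => j.
  apply/bounded_measurable_norm/bounded_measurableB => //.
  exact: bounded_measurable_cst.
move=> w; rewrite mulrC -mulrBr normrM.
have /andP[f0 f1] : 0 <= f n (data rm n w) <= 1 by exact: h01.
rewrite (ger0_norm f0) (le_trans (ler_piMl _ f1))// distrC.
apply: dist_prod_le => j; first exact: cond_mean01.
exact: q01.
Qed.

(** One replicate gives the mean of the conditional mean and a pair gives its second moment. Their
    limits [q] and [q * q] are those of a constant, which forces mean-square convergence. *)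
Lemma joint_cond_L1_cvg (h : D -> R) :
  joint_weak_cvg rm Q 2 -> lip01 h -> cond_L1_cvg rm Q h.
Proof.
move=> jQ lh; have h01 y : 0 <= h y <= 1 by case: lh => + _; apply.
have mh := lip01_measurable lh; have bh := lip01_bounded_measurable lh.
have ch := lip01_continuous lh.
pose q := \int[Q]_x h x; have q01 : 0 <= q <= 1 by exact: bmRintegral01.
(* Position 0 of the tuple is S_n; positions 1 and 2 hold the replicates of index 0 and 1. *)
pose i1 : 'I_3 := @Ordinal 3 1 isT; pose i2 : 'I_3 := @Ordinal 3 2 isT.
have btn (j : 'I_3) : bounded_measurable (fun t : 3.-tuple D => h (tnth t j)).
  exact: (bounded_measurable_comp (measurable_tnth j)).
have ctn (j : 'I_3) : continuous (fun t : 3.-tuple D => h (tnth t j)).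
  by move=> t; apply: (continuous_comp (@tnth_continuous 3 D j t)); exact: ch.
have ii1 : lift ord0 ord0 = i1 by exact: val_inj.
have ii2 : lift ord0 (lift ord0 ord0) = i2 by exact: val_inj.
have rep1 n w : tnth (stat_rep rm 2 n w) i1 = rep rm n 0 w.
  by rewrite /stat_rep -ii1 tnthS tnth_mktuple.
have rep2 n w : tnth (stat_rep rm 2 n w) i2 = rep rm n 1 w.
  by rewrite /stat_rep -ii2 tnthS tnth_mktuple.
have QE (g : 'I_3 -> D -> R) : (forall j, measurable_fun setT (g j)) ->
    (forall j y, 0 <= g j y <= 1) ->
    \int[power_prob Q 3]_t (g ord0 (tnth t ord0) * (g i1 (tnth t i1) *
      g i2 (tnth t i2))) =
    \int[Q]_x g ord0 x * (\int[Q]_x g i1 x * \int[Q]_x g i2 x).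
  move=> mg g01; have := integral_power_prob Q mg g01.
  rewrite !big_ord_recl big_ord0 mulr1 ii1 ii2 => <-.
  apply: eq_Rintegral => t _.
  by rewrite !big_ord_recl big_ord0 mulr1 ii1 ii2.
have c1 : \int[P]_w cond_mean rm n h (data rm n w) @[n --> \oo] --> q.
  have := weak_cvg_Rintegral jQ (ctn i1) (btn i1).
  have -> : \int[power_prob Q 3]_t h (tnth t i1) = q.
    have := QE (fun j => if j == i1 then h else (fun=> 1)).
    move=> /(_ _ _)/=; rewrite !(bmRintegral_cst Q1) mul1r mulr1 /q => <-.
    - by apply: eq_Rintegral => t _; rewrite mul1r mulr1.
    - by move=> j; case: ifP.
    - by move=> j y; case: ifP => // _; rewrite ler01 lexx.
  apply: cvg_trans; apply: near_eq_cvg; apply: nearW => n.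
  rewrite Rintegral_distribution// -(integral_rep rm n 0 mh h01).
  by apply: eq_Rintegral => w _; rewrite rep1.
have c2 : \int[P]_w (cond_mean rm n h (data rm n w)) ^+ 2 @[n --> \oo] --> q * q.
  have ctn2 : continuous (fun t : 3.-tuple D => h (tnth t i1) * h (tnth t i2)).
    by move=> t; exact: (cvgM (ctn i1 t) (ctn i2 t)).
  have := weak_cvg_Rintegral jQ ctn2 (bounded_measurableM (btn i1) (btn i2)).
  have -> : \int[power_prob Q 3]_t (h (tnth t i1) * h (tnth t i2)) = q * q.
    have := QE (fun j => if j == ord0 then (fun=> 1) else h).
    move=> /(_ _ _)/=; rewrite !(bmRintegral_cst Q1) mul1r /q => <-.
    - by apply: eq_Rintegral => t _; rewrite mul1r.
    - by move=> j; case: ifP.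
    - by move=> j y; case: ifP => // _; rewrite ler01 lexx.
  apply: cvg_trans; apply: near_eq_cvg; apply: nearW => n.
  rewrite Rintegral_distribution//; last exact: bounded_measurableM.
  rewrite -(@integral_rep2 _ _ _ _ _ _ rm n 0 1 h isT mh h01).
  by apply: eq_Rintegral => w _; rewrite rep1 rep2.
apply/L1_cvg_sqrP => //; first exact: near_random_probability_cond.
move=> e e0.
have : \int[P]_w (cond_mean rm n h (data rm n w)) ^+ 2 -
    2 * q * \int[P]_w cond_mean rm n h (data rm n w) + q * q @[n --> \oo] -->
    q * q - 2 * q * q + q * q.
  apply: cvgD; last exact: cvg_cst.
  by apply: cvgB => //; apply: cvgM => //; exact: cvg_cst.
have -> : q * q - 2 * q * q + q * q = 0 by ring.
move=> /cvgrPdist_le/(_ _ e0); apply: filterS => n.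
rewrite sub0r normrN => /(le_trans (ler_norm _)); apply: le_trans.
have bm := bounded_measurable_cond_mean_data rm n bh.
have bq := @bounded_measurable_cst _ Omega R (2 * q).
have bqq := @bounded_measurable_cst _ Omega R (q * q).
have bm2 := bounded_measurableX 2 bm.
rewrite -(bmRintegralZ P1)// -(bmRintegralB P1)//; last exact: bounded_measurableM.
rewrite -[X in _ + X](bmRintegral_cst P1) -(bmRintegralD P1)//; last first.
  by apply: bounded_measurableB => //; exact: bounded_measurableM.
rewrite le_eqVlt; apply/orP; left; apply/eqP; apply: eq_Rintegral => w _.
by rewrite -/(cond_mean rm n h (data rm n w)) -/q; ring.
Qed.

End joint_convergence.

(** * Equivalences for a general class, then for the bounded Lipschitz distance *)

Section ipm_equivalence.
Context dO (Omega : measurableType dO) (R : realType) (P : probability Omega R).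
Context dD (D : borelMetricType dD R) (rm : resampling_mechanism P D).
Variable Q : probability D R.

Section class.
Variable H : set (D -> R).
Hypothesis mH : forall h, H h -> measurable_fun [set: D] h.
Hypothesis H1 : forall h, H h -> forall x, `|h x| <= 1.
Hypothesis sH : pointwise_separable H.

Definition cond_ipm_cvg := cvg_in_probability0 P \oo
  (fun n w => ipm H (cond_dist rm n (data rm n w)) (distribution P (stat rm n))).

Definition empirical_ipm_cvg := cvg_in_probability0 P (filter_prod \oo \oo)
  (fun nM w => ipm H (empirical rm nM.1 nM.2 w) (distribution P (stat rm nM.1))).

Let nuprod (h : D -> R) :
  \int[distribution P (stat rm n)]_x h x @[n --> \oo] --> \int[Q]_x h x ->
  \int[distribution P (stat rm nM.1)]_x h x @[nM --> filter_prod \oo \oo] -->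
    \int[Q]_x h x.
Proof. by move=> c; apply: (cvg_comp _ _ _ c); exact: cvg_fst. Qed.

Lemma L1_cvg_ipm (G : set (D -> R)) : finitely_controlled H G Q ->
  (forall g, G g -> measurable_fun setT g /\ forall x, 0 <= g x <= 1) ->
  (forall g, G g ->
    \int[distribution P (stat rm n)]_x g x @[n --> \oo] --> \int[Q]_x g x) ->
  (forall g, G g -> cond_L1_cvg rm Q g) ->
  cond_ipm_cvg /\ empirical_ipm_cvg.
Proof.
move=> cH G01 nuG cG.
have bG g : G g -> bounded_measurable g.
  by move=> /G01[mg g01]; exact: bounded_measurable01.
split.
  exact: (ipm_cvg (near_random_probability_cond rm) mH H1 sH cH bG cG nuG).
apply: (ipm_cvg (near_random_probability_empirical rm) mH H1 sH cH bG).
  by move=> g Gg; have [mg g01] := G01 _ Gg; apply/cond_empirical_L1_cvg => //; exact: cG.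
by move=> g Gg; exact/nuprod/nuG.
Qed.

(** The disjunction lets conditional and empirical assertions share every later implication; the
    empirical case is first turned into the conditional one by second moments. *)
Lemma ipm_L1_cvg h : H h -> (forall x, 0 <= h x <= 1) ->
  \int[distribution P (stat rm n)]_x h x @[n --> \oo] --> \int[Q]_x h x ->
  cond_ipm_cvg \/ empirical_ipm_cvg -> cond_L1_cvg rm Q h.
Proof.
move=> Hh h01 nuh [c|c].
  exact: (ipm_cvg_L1_cvg (near_random_probability_cond rm) mH H1 sH Hh c nuh).
apply/cond_empirical_L1_cvg => //; first exact: mH.
exact: (ipm_cvg_L1_cvg (near_random_probability_empirical rm) mH H1 sH Hh c (nuprod nuh)).
Qed.

End class.

Hypothesis sD : separable D.

Let sBL : pointwise_separable (@BL1 R D).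
Proof.
have [x0 _] := nonempty_of_probability (probability_setT Q).
exact: pointwise_separable_BL1 x0 sD.
Qed.

(** [G] is left free because two classes are used: [lip01] on a general space, [cubes] when starting
    from the Kolmogorov distance. *)
Lemma L1_cvg_BL (G : set (D -> R)) : has_partition G Q ->
  (forall g, G g -> measurable_fun setT g /\ forall x, 0 <= g x <= 1) ->
  (forall g, G g ->
    \int[distribution P (stat rm n)]_x g x @[n --> \oo] --> \int[Q]_x g x) ->
  (forall g, G g -> cond_L1_cvg rm Q g) ->
  cond_cvg_BL rm /\ empirical_cvg_BL rm.
Proof.
move=> pG G01; apply: (L1_cvg_ipm (@BL1_measurable _ _ D) (@BL1_le1 _ _ D) sBL) => //.
apply: finitely_controlled_BL1 => // g /G01[mg g01]; exact: bounded_measurable01.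
Qed.

Hypothesis sQ : stat_weak_cvg rm Q.

Lemma lip01_cvg_BL : (forall h, lip01 h -> cond_L1_cvg rm Q h) ->
  cond_cvg_BL rm /\ empirical_cvg_BL rm.
Proof.
apply: L1_cvg_BL; first exact: has_partition_lip01.
  by move=> g lg; split; [exact: lip01_measurable|case: lg].
exact: stat_cvg_lip01.
Qed.

Lemma BL_L1_cvg h : cond_cvg_BL rm \/ empirical_cvg_BL rm -> lip01 h ->
  cond_L1_cvg rm Q h.
Proof.
move=> c lh; have [h01 [K hK]] := lh.
pose K1 := `|K| + 1; have K11 : 1 <= K1 by rewrite lerDr.
have K10 : 0 < K1 by exact: lt_le_trans K11.
have hK1 : lipschitz_fun K1 h.
  move=> x y; rewrite (le_trans (hK x y))// ler_wpM2r ?mdist_ge0//.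
  by rewrite (le_trans (ler_norm K))// lerDl.
have gBL := lip01_BL1 K11 h01 hK1; set g := (fun x => _) in gBL.
have g01 x : 0 <= g x <= 1.
  have /andP[h0 h1] := h01 x; rewrite /g; apply/andP; split.
    by rewrite mulr_ge0// invr_ge0 ltW.
  by rewrite ler_pdivrMl// mulr1 (le_trans h1).
have lg : lip01 g by split=> //; exists 1; exact: BL1_lipschitz.
have gL1 : cond_L1_cvg rm Q g.
  apply: (ipm_L1_cvg (@BL1_measurable _ _ D) (@BL1_le1 _ _ D) sBL gBL g01 _ c).
  exact: stat_cvg_lip01.
apply: (@L1_cvg_lincomb _ _ _ P _ _ _ _ _ _ (near_random_probability_cond rm) Q
  'I_1 (fun=> g) (fun=> K1)) => //.
  by move=> _; exact: lip01_bounded_measurable.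
by move=> x; rewrite big_ord1 mulVKf// gt_eqF.
Qed.

End ipm_equivalence.

(** * Euclidean spaces and the Kolmogorov distance *)

Section euclid_space.
Context {R : realType} {k : nat}.
Implicit Types x y : euclid R k.

Lemma euclid_dist_le_sum x y : mdist x y <= \sum_i `|x ord0 i - y ord0 i|.
Proof.
rewrite -[leRHS]ger0_norm ?sumr_ge0// -sqrtr_sqr; apply: ler_wsqrtr.
rewrite expr2 big_distrl/=; apply: ler_sum => i _.
rewrite -real_normK ?num_real// expr2 ler_wpM2l// (bigD1 i)//= lerDl.
exact: sumr_ge0.
Qed.

Lemma coord_le_euclid_dist x y i : `|x ord0 i - y ord0 i| <= mdist x y.
Proof.
rewrite -sqrtr_sqr; apply: ler_wsqrtr; rewrite (bigD1 i)//= lerDl.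
by apply: sumr_ge0 => j _; exact: sqr_ge0.
Qed.

Lemma euclid_dist_lt x y e : 0 < e ->
  (forall i, `|x ord0 i - y ord0 i| < e / k.+1%:R) -> mdist x y < e.
Proof.
move=> e0 xy; apply: (le_lt_trans (euclid_dist_le_sum x y)).
apply: (@le_lt_trans _ _ (\sum_(i < k) e / k.+1%:R)).
  by apply: ler_sum => i _; exact/ltW/xy.
rewrite sumr_const card_ord -[ltLHS]mulr_natl mulrA ltr_pdivrMr//.
by rewrite mulrC ltr_pM2l// ltr_nat.
Qed.

Lemma lipschitz_coord i : lipschitz_fun 1 (fun x => x ord0 i : R).
Proof. by move=> x y; rewrite mul1r; exact: coord_le_euclid_dist. Qed.

Definition rat_point (q : seq rat) : euclid R k := \row_i ratr (nth 0 q i).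

Lemma rat_point_above x e : 0 < e ->
  exists q, forall i, x ord0 i < rat_point q ord0 i < x ord0 i + e.
Proof.
move=> e0; have /choice[q qP] : forall i : 'I_k, exists q : rat,
    x ord0 i < ratr q < x ord0 i + e.
  move=> i; have [|q] := @rat_in_itvoo R (x ord0 i) (x ord0 i + e).
    by rewrite ltrDl.
  by rewrite in_itv; exists q.
exists (codom q) => i; rewrite mxE (nth_map i) ?size_enum_ord//.
by rewrite nth_ord_enum.
Qed.

Lemma separable_euclid : separable (euclid R k).
Proof.
exists (range rat_point).
  apply: (@card_le_trans _ _ _ [set: seq rat]); first exact: card_image_le.
  exact: countableP.
move=> O [x Ox] oO.
have /metricType_numDomainType.nbhs_mdistP[e /= e0 eO] : nbhs x O.
  by apply: open_nbhs_nbhs.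
have [|q qP] := @rat_point_above x (e / k.+1%:R); first by rewrite divr_gt0.
exists (rat_point q); split; last by exists q.
apply: eO; apply: euclid_dist_lt => // i.
by have := qP i; rewrite distrC ltr_norml; set t := e / _; lra.
Qed.

Lemma measurable_orthant x : measurable (lower_orthant x).
Proof.
have -> : lower_orthant x =
    \bigcap_(i in [set: 'I_k]) [set y | y ord0 i <= x ord0 i].
  by apply/seteqP; split => [y yx i _|y yx i]; exact: yx.
apply: fin_bigcap_measurable => [|i _]; first exact: finite_finset.
rewrite -[X in measurable X]setTI -preimage_itvNyc.
apply: (lipschitz_measurable (lipschitz_coord i)) => //.
Qed.

Definition orthants : set (euclid R k -> R) :=
  range (fun x => \1_(lower_orthant x)).

Lemma orthants01 h : orthants h -> measurable_fun setT h /\ forall y, 0 <= h y <= 1.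
Proof.
move=> [x _ <-]; split; first by apply: measurable_indic; exact: measurable_orthant.
by move=> y; rewrite indicE; case: (_ \in _); rewrite ?lexx ler01.
Qed.

Lemma orthants_measurable h : orthants h -> measurable_fun setT h.
Proof. by move=> /orthants01[]. Qed.

Lemma orthants_le1 h : orthants h -> forall y, `|h y| <= 1.
Proof. by move=> /orthants01[_ h01] y; have /andP[h0 h1] := h01 y; rewrite ger0_norm. Qed.

Lemma dK_ipm (P Q : {measure set (euclid R k) -> \bar R}) :
  dK P Q = ipm orthants P Q.
Proof.
congr ereal_sup; apply/seteqP; split=> [_ [x _ <-]|_ [_ [x _ <-] <-]].
  exists \1_(lower_orthant x); first by exists x.
  by rewrite !integral_indic ?setIT//; exact: measurable_orthant.
by exists x => //; rewrite !integral_indic ?setIT//; exact: measurable_orthant.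
Qed.

(** Orthants are closed, so their corners are approached from above: a point of the orthant stays in
    the larger ones, and a point outside exceeds [x] in some coordinate by a positive margin and is
    eventually left out. *)
Lemma pointwise_separable_orthants : pointwise_separable orthants.
Proof.
exists (fun n => \1_(lower_orthant (rat_point (odflt [::] (choice.unpickle n))))).
  by move=> n; eexists.
move=> _ [x _ <-].
have /choice[q qP] : forall m : nat, exists q, forall i,
    x ord0 i < rat_point q ord0 i < x ord0 i + m.+1%:R^-1.
  by move=> m; apply: rat_point_above; rewrite invr_gt0.
exists (fun m => choice.pickle (q m)) => y.
under eq_fun do rewrite choice.pickleK/=.
have [xy|xy] := pselect (lower_orthant x y).
  apply: cvg_near_cst; apply: nearW => m; rewrite !indicE !mem_set//.
  by move=> i; have /andP[/ltW + _] := qP m i; apply: le_trans.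
have [i xyi] : exists i, x ord0 i < y ord0 i.
  by apply: contrapT => /forallNP xyi; apply: xy => i; rewrite leNgt; exact/negP.
have d0 : 0 < y ord0 i - x ord0 i by rewrite subr_gt0.
apply: cvg_near_cst; near=> m; rewrite !indicE !memNset// => yq.
have /andP[_ qm] := qP m i.
have := yq i; apply/negP; rewrite -ltNge (lt_le_trans qm)//.
rewrite -lerBrDl; near: m.
by apply: filterS (near_infty_natSinv_lt (PosNum d0)) => m /ltW.
Unshelve. all: by end_near. Qed.

End euclid_space.

(** * Lipschitz sandwich of orthant indicators *)

Section orthant_sandwich.
Context {R : realType} {k : nat}.
Variable Q : probability (euclid R k) R.
Hypothesis cQ : continuous (joint_cdf Q).
Implicit Types x y z : euclid R k.

Let Q1 : Q setT = 1%E := probability_setT Q.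

Lemma joint_cdfE (P : probability (euclid R k) R) x :
  \int[P]_y \1_(lower_orthant x) y = joint_cdf P x.
Proof. by rewrite Rintegral_indic//; exact: measurable_orthant. Qed.

Definition shift x (r : R) : euclid R k := \row_i (x ord0 i + r).

(** For [r > 0], each factor is 1 up to [x ord0 i], 0 from [x ord0 i + r] on, and affine between the
    two. *)
Definition ramp (r : R) x y : R :=
  \prod_i Num.max 0 (Num.min 1 ((x ord0 i + r) / r - r^-1 * y ord0 i)).

Lemma lip01_ramp r x : 0 < r -> lip01 (ramp r x).
Proof.
move=> r0; have ir0 : 0 <= r^-1 by rewrite invr_ge0 ltW.
pose v i y : R := Num.max 0 (Num.min 1 ((x ord0 i + r) / r - r^-1 * y ord0 i)).
have v01 i y : 0 <= v i y <= 1.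
  by rewrite le_max lexx/= ge_max ler01 ge_min lexx.
have vl i : lipschitz_fun r^-1 (v i).
  apply: (lipschitz_max (lipschitz_cst _ ir0)).
  apply: (lipschitz_min (lipschitz_cst _ ir0)) => y z.
  rewrite [X in `|X|](_ : _ = r^-1 * (z ord0 i - y ord0 i)); last by ring.
  rewrite normrM ger0_norm// ler_wpM2l// distrC.
  exact: coord_le_euclid_dist.
split=> [y|]; first exact: (prodr01 _ (v01^~ y)).
exists (k%:R * r^-1) => y z.
apply: le_trans (dist_prod_le _ (v01^~ y) (v01^~ z)) _.
apply: (le_trans (ler_sum _ (fun i _ => vl i y z))).
by rewrite sumr_const card_ord -[leLHS]mulr_natl mulrA.
Qed.

Lemma indic_orthant x y :
  \1_(lower_orthant x) y = \prod_i ((y ord0 i <= x ord0 i)%R%:R : R).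
Proof.
rewrite indicE; have [yx|yx] := boolP (y \in _).
  by rewrite big1// => i _; rewrite (set_mem yx i).
apply/esym/eqP/prodf_eq0; apply: contrapT => h; move/negP: yx; apply.
apply/mem_set => i; apply: contrapT => /negP yxi; apply: h; exists i => //.
by rewrite (negbTE yxi).
Qed.

Lemma indic_orthant_le_ramp r x y : 0 < r -> \1_(lower_orthant x) y <= ramp r x y.
Proof.
move=> r0; rewrite indic_orthant; apply: ler_prod => i _; rewrite ler0n/=.
have [yx|_] := leP (y ord0 i) (x ord0 i); last by rewrite le_max lexx.
rewrite le_max le_min lexx/= mulrC -mulrBr ler_pdivlMl// mulr1.
by rewrite lerBrDr addrC lerD2r yx orbT.
Qed.

Lemma ramp_le_indic_orthant r x y : 0 < r ->
  ramp r x y <= \1_(lower_orthant (shift x r)) y.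
Proof.
move=> r0; rewrite indic_orthant; apply: ler_prod => i _; rewrite le_max lexx/= mxE.
have [yx|yx] := leP (y ord0 i) (x ord0 i + r); first by rewrite ge_max ler01 ge_min lexx.
rewrite ge_max lexx/= ge_min mulrC -mulrBr pmulr_rle0 ?invr_gt0// subr_le0.
by rewrite (ltW yx) orbT.
Qed.

Lemma joint_cdf_near x e : 0 < e -> exists2 r, 0 < r &
  forall y, (forall i, `|x ord0 i - y ord0 i| <= r) ->
    `|joint_cdf Q x - joint_cdf Q y| < e.
Proof.
move=> e0; have /cvgrPdist_lt/(_ _ e0) := @cQ x.
move=> /metricType_numDomainType.nbhs_mdistP[r /= r0 rP].
(* Halving turns the weak coordinate bounds into the strict ones of [euclid_dist_lt]. *)
exists (r / 2 / k.+1%:R); first by rewrite !divr_gt0.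
move=> y xy; apply: rP; apply: euclid_dist_lt => // i.
rewrite (le_lt_trans (xy i))// ltr_pM2r ?invr_gt0//.
by rewrite ltr_pdivrMr// ltr_pMr// ltr1n.
Qed.

Lemma orthant_sandwich x e : 0 < e -> exists l u : euclid R k -> R,
  [/\ lip01 l, lip01 u, (forall y, l y <= \1_(lower_orthant x) y <= u y) &
      \int[Q]_y u y - \int[Q]_y l y <= e].
Proof.
move=> e0; have e2 : 0 < e / 2 by rewrite divr_gt0.
have [r r0 rP] := joint_cdf_near x e2.
(* The lower ramp ends at [x] and the upper one starts there. Their integrals lie between the
   distribution function at [x - r] and at [x + r], each within [e / 2] of its value at [x]. *)
have ll := lip01_ramp (shift x (- r)) r0; have lu := lip01_ramp x r0.
have sx : shift (shift x (- r)) r = x by apply/rowP => i; rewrite !mxE subrK.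
exists (ramp r (shift x (- r))), (ramp r x); split=> //.
  move=> y; rewrite indic_orthant_le_ramp// andbT.
  by have := ramp_le_indic_orthant (shift x (- r)) y r0; rewrite sx.
have bO z : bounded_measurable (\1_(lower_orthant z) : euclid R k -> R).
  by apply: bounded_measurable_indic; exact: measurable_orthant.
have : \int[Q]_y ramp r x y <= joint_cdf Q (shift x r).
  rewrite -joint_cdfE; apply: (le_bmRintegral Q1) => //.
    exact: lip01_bounded_measurable.
  by move=> y; exact: ramp_le_indic_orthant.
have : joint_cdf Q (shift x (- r)) <= \int[Q]_y ramp r (shift x (- r)) y.
  rewrite -joint_cdfE; apply: (le_bmRintegral Q1) => //.
    exact: lip01_bounded_measurable.
  by move=> y; exact: indic_orthant_le_ramp.
have := rP (shift x r); have := rP (shift x (- r)).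
have h1 i : `|x ord0 i - shift x r ord0 i| <= r.
  by rewrite mxE opprD addrA subrr sub0r normrN gtr0_norm.
have h2 i : `|x ord0 i - shift x (- r) ord0 i| <= r.
  by rewrite mxE opprD addrA subrr sub0r normrN normrN gtr0_norm.
by move=> /(_ h2) + /(_ h1); rewrite !ltr_norml; lra.
Qed.

End orthant_sandwich.

(** The difference for [h] is at most the [P]-integral of [u] minus the [Q]-integral of [l];
    inserting the [Q]-integral of [u] splits off [e]. The lower bound is symmetric. *)
Lemma integral_sandwich d (T : measurableType d) (R : realType)
    (P Q : {measure set T -> \bar R}) (l h u : T -> R) (e : R) :
  P setT = 1%E -> Q setT = 1%E ->
  bounded_measurable l -> bounded_measurable h -> bounded_measurable u ->
  (forall x, l x <= h x <= u x) -> \int[Q]_x u x - \int[Q]_x l x <= e ->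
  `|\int[P]_x h x - \int[Q]_x h x| <=
  `|\int[P]_x l x - \int[Q]_x l x| + `|\int[P]_x u x - \int[Q]_x u x| + e.
Proof.
move=> P1 Q1 bl bh bu lhu Qe.
have lP (m : {measure set T -> \bar R}) : m setT = 1%E ->
    \int[m]_x l x <= \int[m]_x h x <= \int[m]_x u x.
  by move=> m1; rewrite !le_bmRintegral// => x; have /andP[] := lhu x.
have /andP[a1 a2] := lP _ P1; have /andP[b1 b2] := lP _ Q1.
have := ler_norm (\int[P]_x u x - \int[Q]_x u x).
have := ler_norm (\int[Q]_x l x - \int[P]_x l x); rewrite distrC.
have := normr_ge0 (\int[P]_x u x - \int[Q]_x u x).
have := normr_ge0 (\int[P]_x l x - \int[Q]_x l x).
rewrite ler_norml; lra.
Qed.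

Section sandwich_convergence.
Context dO (Omega : measurableType dO) (R : realType) (P : probability Omega R).
Context k (rm : resampling_mechanism P (euclid R k)).
Variable Q : probability (euclid R k) R.
Hypothesis cQ : continuous (joint_cdf Q).
Hypothesis sQ : stat_weak_cvg rm Q.

Let P1 : P setT = 1%E := probability_setT P.
Let Q1 : Q setT = 1%E := probability_setT Q.

Lemma stat_cvg_orthants h : orthants h ->
  \int[distribution P (stat rm n)]_x h x @[n --> \oo] --> \int[Q]_x h x.
Proof.
move=> Hh; have [mh h01] := orthants01 Hh.
have bh := bounded_measurable01 mh h01.
case: Hh => x _ hx; apply/cvgrPdist_le => e e0.
have e3 : 0 < e / 3 by rewrite divr_gt0.
have [l [u [ll lu lhu Qe]]] := orthant_sandwich cQ x e3; rewrite hx in lhu.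
have /cvgrPdist_le/(_ _ e3) := stat_cvg_lip01 sQ ll.
have /cvgrPdist_le/(_ _ e3) := stat_cvg_lip01 sQ lu.
apply: filterS2 => n un ln; rewrite distrC.
have := @integral_sandwich _ _ _ (distribution P (stat rm n)) Q l h u (e / 3)
  (probability_setT _) Q1 (lip01_bounded_measurable ll) bh
  (lip01_bounded_measurable lu).
move=> /(_ lhu Qe) H; apply: (le_trans H).
rewrite distrC in ln; rewrite distrC in un; lra.
Qed.

Lemma cond_L1_cvg_orthants h : (forall g, lip01 g -> cond_L1_cvg rm Q g) ->
  orthants h -> cond_L1_cvg rm Q h.
Proof.
move=> cL Hh; have [mh h01] := orthants01 Hh.
have bh := bounded_measurable01 mh h01.
case: Hh => x _ hx; apply/L1_cvgP => e e0.
have e3 : 0 < e / 3 by rewrite divr_gt0.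
have [l [u [ll lu lhu Qe]]] := orthant_sandwich cQ x e3; rewrite hx in lhu.
have bl := lip01_bounded_measurable ll; have bu := lip01_bounded_measurable lu.
have /L1_cvgP/(_ _ e3) := cL _ ll; have /L1_cvgP/(_ _ e3) := cL _ lu.
apply: filterS2 => n un ln.
have rc := random_probability_cond rm n.
have bd g : bounded_measurable g -> bounded_measurable (fun w =>
    `|\int[cond_dist rm n (data rm n w)]_x g x - \int[Q]_x g x|).
  by move=> bg; exact: bounded_measurable_random_dist.
have be := @bounded_measurable_cst _ Omega R (e / 3).
have blu := bounded_measurableD (bd _ bl) (bd _ bu).
apply: (@le_trans _ _ (\int[P]_w
  (`|\int[cond_dist rm n (data rm n w)]_x l x - \int[Q]_x l x| +
   `|\int[cond_dist rm n (data rm n w)]_x u x - \int[Q]_x u x| + e / 3))).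
  apply: (le_bmRintegral P1); [exact: bd|exact: bounded_measurableD|].
  by move=> w; apply: integral_sandwich => //; exact: rc.1.
rewrite (bmRintegralD P1)// (bmRintegral_cst P1) (bmRintegralD P1); [|exact: bd..].
lra.
Qed.

End sandwich_convergence.

(** * Reduction of all orthants to those with corner in a cube *)

Section box.
Context {R : realType} {k : nat}.
Variable Q : probability (euclid R k) R.
Implicit Types x y z : euclid R k.

Let Q1 : Q setT = 1%E := probability_setT Q.

Definition corner (K : R) : euclid R k := \row_i K.

(** The orthant at this point is the part of the one at [corner K] that lies below [- K] in
    direction [i], for [K] nonnegative. *)
Definition lower_face (K : R) (i : 'I_k) : euclid R k :=
  \row_j (if j == i then - K else K).

(* an upper bound, in terms of lower orthants, of the mass of the complement of
   [(-K, K]^k] *)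
Definition box_defect (P : {measure set (euclid R k) -> \bar R}) (K : R) : R :=
  (1 - \int[P]_y \1_(lower_orthant (corner K)) y) +
  \sum_i \int[P]_y \1_(lower_orthant (lower_face K i)) y.

Let bO z : bounded_measurable (\1_(lower_orthant z) : euclid R k -> R).
Proof. by apply: bounded_measurable_indic; exact: measurable_orthant. Qed.

Lemma exists_box_defect e : 0 < e -> exists2 K, 0 < K & box_defect Q K <= e.
Proof.
move=> e0.
have i1 z y : `|\1_(lower_orthant z) y| <= 1 :> R.
  by rewrite indicE; case: (_ \in _); rewrite ?normr1 ?normr0.
have mO z : measurable_fun setT (\1_(lower_orthant z) : euclid R k -> R) by case: (bO z).
have cK : \int[Q]_y \1_(lower_orthant (corner n.+1%:R)) y @[n --> \oo] --> (1 : R).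
  rewrite -[X in _ --> X](bmRintegral_cst Q1).
  apply: (cvg_bmRintegral (B := 1) Q1) => // y.
  apply: cvg_near_cst; near=> n; rewrite indicE mem_set// => i; rewrite mxE.
  rewrite (@le_trans _ _ (\sum_j `|y ord0 j|))//.
    rewrite (bigD1 i)//= (le_trans (ler_norm _))// lerDl; exact: sumr_ge0.
  by rewrite (@le_trans _ _ n%:R)// ?ler_nat//; near: n; exact: nbhs_infty_ger.
have cF i : \int[Q]_y \1_(lower_orthant (lower_face n.+1%:R i)) y
    @[n --> \oo] --> (0 : R).
  rewrite -[X in _ --> X](bmRintegral_cst Q1).
  apply: (cvg_bmRintegral (B := 1) Q1) => // y.
  apply: cvg_near_cst; near=> n; rewrite indicE memNset// => /(_ i).
  rewrite mxE eqxx; apply/negP; rewrite -ltNge ltrNl.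
  rewrite (@le_lt_trans _ _ n%:R)// ?ltr_nat//.
  by near: n; exact: nbhs_infty_ger.
have : box_defect Q n.+1%:R @[n --> \oo] --> (1 - 1) + \sum_(i < k) (0 : R).
  apply: cvgD; first by apply: cvgB => //; exact: cvg_cst.
  by apply: cvg_rsum => i; exact: cF.
rewrite subrr add0r big1_eq => /cvgrPdist_le/(_ _ e0)[N _ /(_ N (leqnn N))/=].
rewrite sub0r normrN => H; exists N.+1%:R => //.
exact: le_trans (ler_norm _) H.
Unshelve. all: by end_near. Qed.

Definition clip (K : R) x : euclid R k :=
  \row_i Num.max (- K) (Num.min (x ord0 i) K).

Lemma clip_cube K x : 0 < K -> forall i, -K <= clip K x ord0 i <= K.
Proof.
by move=> K0 i; rewrite mxE le_max lexx/= ge_max ge_min lexx orbT andbT; lra.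
Qed.

(** Below [corner K], the orthant at [x] is contained in the one at [clip K x]. If [y] is only in
    the latter, some coordinate has [x < y], so the clipping there acted from below and [y] is at
    most [- K]: [y] lies under a lower face. *)
Let indic_clip K x y : `|\1_(lower_orthant x) y - \1_(lower_orthant (clip K x)) y| <=
  (1 - \1_(lower_orthant (corner K)) y) +
  \sum_i \1_(lower_orthant (lower_face K i)) y :> R.
Proof.
have S0 : 0 <= \sum_i \1_(lower_orthant (lower_face K i)) y :> R.
  by apply: sumr_ge0.
have [yK|yK] := pselect (lower_orthant (corner K) y); last first.
  rewrite [in leRHS]indicE memNset// subr0 -[leLHS]addr0 lerD//.
  rewrite !indicE; do 2 case: (_ \in _);
  by rewrite ?subrr ?subr0 ?sub0r ?normrN ?normr0 ?normr1.
have yKi i : y ord0 i <= K by have := yK i; rewrite mxE.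
rewrite [in leRHS]indicE mem_set// subrr add0r.
have [yx|yx] := pselect (lower_orthant x y).
  rewrite !indicE !mem_set ?subrr ?normr0// => i.
  by rewrite mxE le_max le_min (yx i) yKi orbT.
rewrite indicE memNset// sub0r normrN ger0_norm//.
have [yc|yc] := pselect (lower_orthant (clip K x) y); last first.
  by rewrite indicE memNset.
have [i xyi] : exists i, x ord0 i < y ord0 i.
  by apply: contrapT => /forallNP xyi; apply: yx => i; rewrite leNgt; exact/negP.
rewrite [leLHS]indicE mem_set// (bigD1 i)//= [X in X + _]indicE mem_set//.
  by rewrite lerDl sumr_ge0.
move=> j; rewrite mxE; case: eqP => [->|_]; last exact: yKi.
have := yc i; rewrite mxE le_max => /orP[//|]; rewrite le_min => /andP[].
by rewrite leNgt xyi.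
Qed.

Lemma clip_dist (P : {measure set (euclid R k) -> \bar R}) K x : P setT = 1%E ->
  `|\int[P]_y \1_(lower_orthant x) y - \int[P]_y \1_(lower_orthant (clip K x)) y|
  <= box_defect P K.
Proof.
move=> P1; rewrite /box_defect -{1}(bmRintegral_cst P1 1).
have bs : bounded_measurable
    (fun y => \sum_i \1_(lower_orthant (lower_face K i)) y : R).
  exact: bounded_measurable_sum.
have b1 := @bounded_measurable_cst _ (euclid R k) R 1.
rewrite -!bmRintegralB// -bmRintegral_sum// -bmRintegralD//; last first.
  exact: bounded_measurableB.
apply: (le_trans (le_norm_bmRintegral P1 _)); first exact: bounded_measurableB.
apply: le_bmRintegral => //.
- by apply: bounded_measurable_norm; exact: bounded_measurableB.
- by apply: bounded_measurableD => //; exact: bounded_measurableB.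
Qed.

Lemma box_defect_dist (P : {measure set (euclid R k) -> \bar R}) K :
  box_defect P K <= box_defect Q K +
  (`|\int[P]_y \1_(lower_orthant (corner K)) y -
    \int[Q]_y \1_(lower_orthant (corner K)) y| +
   \sum_i `|\int[P]_y \1_(lower_orthant (lower_face K i)) y -
            \int[Q]_y \1_(lower_orthant (lower_face K i)) y|).
Proof.
rewrite /box_defect.
have : \sum_i \int[P]_y \1_(lower_orthant (lower_face K i)) y -
       \sum_i \int[Q]_y \1_(lower_orthant (lower_face K i)) y <=
   \sum_i `|\int[P]_y \1_(lower_orthant (lower_face K i)) y -
            \int[Q]_y \1_(lower_orthant (lower_face K i)) y|.
  by rewrite -sumrB; apply: ler_sum => i _; exact: ler_norm.
have := ler_norm (\int[Q]_y \1_(lower_orthant (corner K)) y -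
  \int[P]_y \1_(lower_orthant (corner K)) y).
rewrite distrC.
set a := \int[P]_y _; set b := \int[Q]_y _.
set A := \sum_i _; set B := \sum_i _; set C := \sum_i _.
lra.
Qed.

End box.

(** * Finite control of the Kolmogorov distance *)

Section kolmogorov_control.
Context {R : realType} {k : nat}.
Variable Q : probability (euclid R k) R.
Hypothesis cQ : continuous (joint_cdf Q).
Implicit Types x y z : euclid R k.

Let Q1 : Q setT = 1%E := probability_setT Q.

(** Compactness is taken from the max-norm topology of ['rV[R]_k]; the conclusion is coordinatewise
    and so does not mention the metric. *)
Lemma cube_finite_cover (K : R) (r : 'rV[R]_k -> R) : (forall z, 0 < r z) ->
  exists s : {fset 'rV[R]_k}, forall z : 'rV[R]_k,
    (forall i, -K <= z ord0 i <= K) ->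
    exists2 c, c \in s & forall i, `|c ord0 i - z ord0 i| < r c.
Proof.
move=> r0.
have : compact [set v : 'rV[R]_k | forall i, [set` `[-K, K]] (v ord0 i)].
  by apply: (@rV_compact R k (fun=> [set` `[- K, K]])) => i; exact: segment_compact.
rewrite compact_cover => /(_ _ setT (fun v : 'rV[R]_k => (ball v (r v))°)).
case=> [z _|z _|s _ sP].
- exact: open_interior.
- exists z => //; exact: nbhsx_ballx.
exists s => z zK.
have [|c cs zc] := sP z; first by move=> i; rewrite /= in_itv/= zK.
exists c => // i; have zb : ball c (r c) z by exact: interior_subset zc.
exact: (zb.2 ord0 i).
Qed.

Lemma indic_orthant_mono x z y : (forall i, x ord0 i <= z ord0 i) ->
  \1_(lower_orthant x) y <= \1_(lower_orthant z) y :> R.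
Proof.
move=> xz; rewrite !indicE; have [yx|_] := boolP (y \in lower_orthant x) => //.
rewrite mem_set// => i; exact: le_trans (set_mem yx i) (xz i).
Qed.

Lemma finitely_controlled_orthants : finitely_controlled orthants orthants Q.
Proof.
move=> e e0; have e4 : 0 < e / 4 by rewrite divr_gt0.
have e8 : 0 < e / 8 by rewrite divr_gt0.
have [K K0 QK] := exists_box_defect Q e4.
(* Both corners at offset [r z] are within [e / 8] of [z] in distribution function, hence within
   [e / 4] of each other. *)
have /choice[r rP] : forall z : 'rV[R]_k, exists r, 0 < r /\
    forall y, (forall i, `|z ord0 i - y ord0 i| <= r) ->
    `|joint_cdf Q z - joint_cdf Q y| < e / 8.
  by move=> z; have [r r0 H] := joint_cdf_near cQ z e8; exists r.
have [s sP] := @cube_finite_cover K r (fun z => (rP z).1).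
(* Two sandwiching corners for each centre of the cover, and the points that [box_defect]
   evaluates. *)
pose pt (p : (s + s) + (unit + 'I_k)) : euclid R k :=
  match p with
  | inl (inl c) => shift (val c) (r (val c))
  | inl (inr c) => shift (val c) (- r (val c))
  | inr (inl _) => corner K
  | inr (inr i) => lower_face K i
  end.
(* Passing from [x] to [clip K x] costs [e / 4 + S] under [P] and [e / 4] under [Q]; the sandwich of
   [clip K x] costs [S + S + e / 4]. *)
exists ((s + s) + (unit + 'I_k))%type, (fun p => \1_(lower_orthant (pt p))), 3.
split=> [//|p|P P1 _ [x _ <-]]; first by exists (pt p).
pose D z := `|\int[P]_y \1_(lower_orthant z) y - \int[Q]_y \1_(lower_orthant z) y|.
rewrite -/(D x) -[X in e + 3 * X]/(\sum_p D (pt p)); set S := \sum_p D (pt p).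
have leS p : D (pt p) <= S.
  by rewrite /S (bigD1 p)//= lerDl sumr_ge0// => *; exact: normr_ge0.
have boxS : D (corner K) + \sum_i D (lower_face K i) <= S.
  rewrite /S big_sumType/= [X in _ <= _ + X]big_sumType/= big_const/= card_unit/= addr0.
  by rewrite lerDr sumr_ge0// => *; exact: normr_ge0.
have dP : box_defect P K <= e / 4 + S.
  by rewrite (le_trans (box_defect_dist Q P K))// lerD.
have bO z : bounded_measurable (\1_(lower_orthant z) : euclid R k -> R).
  by apply: bounded_measurable_indic; exact: measurable_orthant.
have [c cs cz] := sP _ (clip_cube x K0).
have cS : D (clip K x) <= S + S + e / 4.
  pose l := shift c (- r c); pose u := shift c (r c).
  have lu i : l ord0 i <= clip K x ord0 i <= u ord0 i.
    by have := cz i; rewrite ltr_norml [l ord0 i]mxE [u ord0 i]mxE; lra.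
  have Qlu : \int[Q]_y \1_(lower_orthant u) y - \int[Q]_y \1_(lower_orthant l) y <= e / 4.
    rewrite !joint_cdfE; have [r0 rc] := rP c.
    have := rc u; have := rc l.
    have h1 i : `|c ord0 i - u ord0 i| <= r c.
      by rewrite mxE opprD addrA subrr sub0r normrN gtr0_norm.
    have h2 i : `|c ord0 i - l ord0 i| <= r c.
      by rewrite mxE opprD addrA subrr sub0r normrN normrN gtr0_norm.
    by move=> /(_ h2) + /(_ h1); rewrite !ltr_norml; lra.
  apply: (le_trans (integral_sandwich P1 Q1 (bO l) (bO _) (bO u) _ Qlu)).
    by move=> y; rewrite !indic_orthant_mono// => i; have /andP[] := lu i.
  rewrite lerD2r lerD//; first exact: (leS (inl (inr [` cs]%fset))).
  exact: (leS (inl (inl [` cs]%fset))).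
have := clip_dist K x P1; have := clip_dist K x Q1.
move: cS; rewrite /D => cS hQ hP.
have t1 := ler_distD (\int[P]_y \1_(lower_orthant (clip K x)) y)
  (\int[P]_y \1_(lower_orthant x) y) (\int[Q]_y \1_(lower_orthant x) y).
have t2 := ler_distD (\int[Q]_y \1_(lower_orthant (clip K x)) y)
  (\int[P]_y \1_(lower_orthant (clip K x)) y) (\int[Q]_y \1_(lower_orthant x) y).
rewrite distrC in hQ.
move: t1 t2 hP hQ cS dP QK e0; clear.
set a := `|_ - _|; set b := `|_ - _|; set c := `|_ - _|; set d := `|_ - _|.
set f := `|_ - _|; lra.
Qed.

End kolmogorov_control.

(** * Partitions into half-open cubes *)

Section cubes.
Context {R : realType} {k : nat}.
Implicit Types (l u y z : euclid R k).

(** When [l] is below [u], this is the indicator of the product of the intervals (l_i, u_i].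
    Half-open boxes tile without overlap, and the difference form telescopes along a grid. *)
Definition cube l u y : R :=
  \prod_i ((y ord0 i <= u ord0 i)%R%:R - (y ord0 i <= l ord0 i)%R%:R).

Definition cubes : set (euclid R k -> R) :=
  [set g | exists l u, (forall i, l ord0 i <= u ord0 i) /\ g = cube l u].

Definition cube_vertex l u (A : {ffun 'I_k -> bool}) : euclid R k :=
  \row_i (if A i then l ord0 i else u ord0 i).

(** Distributing the product gives one term for each vertex; [A] marks the coordinates that take the
    lower bound, each of which contributes a sign. *)
Lemma cube_orthants l u y : cube l u y =
  \sum_(A : {ffun 'I_k -> bool})
    (\prod_i (if A i then -1 else 1)) * \1_(lower_orthant (cube_vertex l u A)) y.
Proof.
transitivity (\prod_(i < k) \sum_(b : bool)
    (if b then -1 else 1) * (y ord0 i <= if b then l ord0 i else u ord0 i)%R%:R : R).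
  by apply: eq_bigr => i _; rewrite big_bool/= mulN1r mul1r addrC.
rewrite bigA_distr_bigA; apply: eq_bigr => A _.
by rewrite indic_orthant -big_split; apply: eq_bigr => i _; rewrite mxE.
Qed.

Lemma cube_factor01 (a b t : R) : a <= b ->
  0 <= ((t <= b)%R%:R - (t <= a)%R%:R : R) <= 1.
Proof.
move=> ab; have [ta|_] := leP t a; first by rewrite (le_trans ta ab) subrr lexx ler01.
by rewrite subr0; case: (t <= b); rewrite ?lexx ?ler01.
Qed.

Lemma cubes01 g : cubes g -> measurable_fun setT g /\ forall y, 0 <= g y <= 1.
Proof.
move=> [l [u [lu ->]]]; split.
  have bO (z : euclid R k) := bounded_measurable_indic R (measurable_orthant z).
  have [] : bounded_measurable (fun y => \sum_(A : {ffun 'I_k -> bool})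
    (\prod_i (if A i then -1 else 1)) * \1_(lower_orthant (cube_vertex l u A)) y : R).
    apply: bounded_measurable_sum => A; apply: bounded_measurableM => //.
    exact: bounded_measurable_cst.
  by under eq_fun do rewrite -cube_orthants.
by move=> y; apply: prodr01 => i; exact: cube_factor01.
Qed.

Lemma has_partition_cubes (Q : probability (euclid R k) R) : has_partition cubes Q.
Proof.
move=> e e0; have Q1 := probability_setT Q.
have [K K0 QK] := exists_box_defect Q e0.
(* The [k] edges of a cell, of length [2 * K / N] each, add up to at most [e]; this sum bounds the
   distance from a point of the cell to its upper corner. *)
have [N N0 Ne] := exists_natdiv_le (2 * K * k%:R) e0.
have N0R : 0 < N%:R :> R by rewrite ltr0n.
pose g (m : nat) : R := - K + m%:R * (2 * K / N%:R).
have gS m : g m <= g m.+1.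
  by rewrite lerD2l ler_wpM2r ?ler_nat// divr_ge0// mulr_ge0// ltW.
pose l (m : {ffun 'I_k -> 'I_N}) : euclid R k := \row_i g (m i).
pose u (m : {ffun 'I_k -> 'I_N}) : euclid R k := \row_i g (m i).+1.
have lu m i : l m ord0 i <= u m ord0 i by rewrite !mxE.
(* The sum over cells is a product of one-dimensional sums, and each of these telescopes. *)
have sumE y : \sum_m cube (l m) (u m) y = cube (corner (- K)) (corner K) y.
  transitivity (\prod_(i < k) \sum_(j < N)
      ((y ord0 i <= g j.+1)%R%:R - (y ord0 i <= g j)%R%:R) : R).
    rewrite bigA_distr_bigA; apply: eq_bigr => m _; apply: eq_bigr => i _.
    by rewrite !mxE.
  apply: eq_bigr => i _; rewrite !mxE.
  pose f j : R := (y ord0 i <= g j)%R%:R.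
  rewrite -(big_mkord xpredT (fun j => f j.+1 - f j)) telescope_sumr// /f /g mul0r addr0.
  have -> : - K + N%:R * (2 * K / N%:R) = K.
    by rewrite mulrC divfK ?gt_eqF//; ring.
  by [].
have box01 : cubes (cube (corner (- K)) (corner K)).
  by exists (corner (- K)), (corner K); split=> // i; rewrite !mxE; lra.
have cl m : cubes (cube (l m) (u m)) by exists (l m), (u m).
have bc m : bounded_measurable (cube (l m) (u m)).
  by have [mc c01] := cubes01 (cl m); exact: bounded_measurable01.
exists {ffun 'I_k -> 'I_N}, (fun m => cube (l m) (u m)), u; split => //.
- by move=> m y; have [_ /(_ y) /andP[]] := cubes01 (cl m).
- by move=> y; rewrite sumE; have [_ /(_ y) /andP[]] := cubes01 box01.
- move=> m y /prodf_neq0 my; apply: (le_trans (euclid_dist_le_sum _ _)).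
  apply: (@le_trans _ _ (\sum_(i < k) 2 * K / N%:R)).
    apply: ler_sum => i _; have := my i isT; rewrite !mxE.
    have [yl|yl] := leP (y ord0 i) (g (m i)).
      by rewrite (le_trans yl (gS _)) subrr eqxx.
    have [yu _|_] := leP (y ord0 i) (g (m i).+1); last by rewrite subrr eqxx.
    rewrite ler0_norm ?subr_le0// opprB lerBlDl -lerBlDr ltW//.
    apply: le_lt_trans yl; rewrite /g -natr1 mulrDl mul1r; lra.
  by rewrite sumr_const card_ord -[leLHS]mulr_natl mulrC mulrAC.
rewrite -(bmRintegral_sum Q1)//.
under eq_Rintegral do rewrite sumE.
have b1 := @bounded_measurable_cst _ (euclid R k) R 1.
have bO (z : euclid R k) := bounded_measurable_indic R (measurable_orthant z).
have bs : bounded_measurable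
    (fun y => \sum_i \1_(lower_orthant (lower_face K i)) y : R).
  by apply: bounded_measurable_sum => i.
(* Pointwise, 1 minus the integrand of [box_defect] is at most the indicator of (-K, K]^k. *)
apply: (@le_trans _ _ (1 - box_defect Q K)); first by rewrite lerD2l lerN2.
have bd : bounded_measurable (fun y => 1 - \1_(lower_orthant (corner K)) y +
    \sum_i \1_(lower_orthant (lower_face K i)) y : R).
  by apply: bounded_measurableD => //; exact: bounded_measurableB.
have -> : 1 - box_defect Q K = \int[Q]_y
    (1 - (1 - \1_(lower_orthant (corner K)) y +
          \sum_i \1_(lower_orthant (lower_face K i)) y)).
  rewrite (bmRintegralB Q1)// (bmRintegralD Q1)//; last exact: bounded_measurableB.
  by rewrite (bmRintegralB Q1)// (bmRintegral_sum Q1)// !(bmRintegral_cst Q1).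
have [mb b01] := cubes01 box01.
apply: (le_bmRintegral Q1).
- exact: bounded_measurableB.
- exact: bounded_measurable01.
move=> y; have /andP[c0 _] := b01 y.
have S0 : 0 <= \sum_i \1_(lower_orthant (lower_face K i)) y :> R.
  by apply: sumr_ge0.
have [yK|yK] := pselect (lower_orthant (corner K) y); last first.
  rewrite [in leLHS]indicE memNset// subr0 (le_trans _ c0)//.
  by rewrite subr_le0 lerDl.
rewrite [in leLHS]indicE mem_set// subrr add0r.
have yKi i : y ord0 i <= K by have := yK i; rewrite mxE.
have [[i yi]|yi] := pselect (exists i, y ord0 i <= - K).
  apply: le_trans c0; rewrite subr_le0 (bigD1 i)//= indicE mem_set//.
    by rewrite lerDl sumr_ge0.
  by move=> j; rewrite mxE; case: eqP => [->|_].
have -> : cube (corner (- K)) (corner K) y = 1; last by rewrite gerBl.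
rewrite /cube big1// => i _; rewrite !mxE yKi.
have [yi'|_] := leP (y ord0 i) (- K); last by rewrite subr0.
by exfalso; apply: yi; exists i.
Qed.

End cubes.

Section cube_convergence.
Context dO (Omega : measurableType dO) (R : realType) (P : probability Omega R).
Context k (rm : resampling_mechanism P (euclid R k)).
Variable Q : probability (euclid R k) R.
Implicit Types g h : euclid R k -> R.

Let bO (z : euclid R k) : bounded_measurable (\1_(lower_orthant z) : euclid R k -> R).
Proof. by apply: bounded_measurable_indic; exact: measurable_orthant. Qed.

Lemma cond_L1_cvg_cubes g : (forall h, orthants h -> cond_L1_cvg rm Q h) ->
  cubes g -> cond_L1_cvg rm Q g.
Proof.
move=> cO [l [u [_ ->]]].
apply: (L1_cvg_lincomb (near_random_probability_cond rm) (fun A => bO _)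
  (cube_orthants l u)).
by move=> A; apply: cO; eexists.
Qed.

Lemma stat_cvg_cubes g :
  (forall h, orthants h ->
    \int[distribution P (stat rm n)]_x h x @[n --> \oo] --> \int[Q]_x h x) ->
  cubes g ->
  \int[distribution P (stat rm n)]_x g x @[n --> \oo] --> \int[Q]_x g x.
Proof.
move=> cO [l [u [_ ->]]].
pose c (A : {ffun 'I_k -> bool}) : R := \prod_i (if A i then -1 else 1).
have E (m : probability (euclid R k) R) : \int[m]_y cube l u y =
    \sum_A c A * \int[m]_y \1_(lower_orthant (cube_vertex l u A)) y.
  have m1 := probability_setT m.
  under eq_Rintegral do rewrite cube_orthants.
  rewrite (bmRintegral_sum m1).
    by apply: eq_bigr => A _; rewrite (bmRintegralZ m1).
  by move=> A; apply: bounded_measurableM => //; exact: bounded_measurable_cst.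
rewrite E; under eq_fun do rewrite E.
apply: cvg_rsum => A; apply: cvgM; first exact: cvg_cst.
by apply: cO; eexists.
Qed.

End cube_convergence.

(** * Equivalences for the Kolmogorov distance *)

Section kolmogorov_equivalence.
Context dO (Omega : measurableType dO) (R : realType) (P : probability Omega R).
Context k (rm : resampling_mechanism P (euclid R k)).
Variable Q : probability (euclid R k) R.
Hypothesis cQ : continuous (joint_cdf Q).
Hypothesis sQ : stat_weak_cvg rm Q.

Let cond_KE : cond_cvg_K rm = cond_ipm_cvg rm orthants.
Proof.
rewrite /cond_cvg_K /cond_ipm_cvg; congr cvg_in_probability0.
by apply/funext => n; apply/funext => w; rewrite dK_ipm.
Qed.

Let empirical_KE : empirical_cvg_K rm = empirical_ipm_cvg rm orthants.
Proof.
rewrite /empirical_cvg_K /empirical_ipm_cvg; congr cvg_in_probability0.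
by apply/funext => n; apply/funext => w; rewrite dK_ipm.
Qed.

Lemma lip01_cvg_K : (forall h, lip01 h -> cond_L1_cvg rm Q h) ->
  cond_cvg_K rm /\ empirical_cvg_K rm.
Proof.
move=> cL; rewrite cond_KE empirical_KE.
apply: (L1_cvg_ipm orthants_measurable orthants_le1 pointwise_separable_orthants
  (finitely_controlled_orthants cQ) orthants01).
  by move=> h; exact: stat_cvg_orthants.
by move=> h; exact: cond_L1_cvg_orthants.
Qed.

(** Orthants give cubes by linearity, and cubes give the bounded Lipschitz distance because they
    contain partitions; [BL_L1_cvg] then comes back to a single Lipschitz function. *)
Lemma K_L1_cvg h : cond_cvg_K rm \/ empirical_cvg_K rm -> lip01 h ->
  cond_L1_cvg rm Q h.
Proof.
rewrite cond_KE empirical_KE => c.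
have cO g : orthants g -> cond_L1_cvg rm Q g.
  move=> Og; apply: (ipm_L1_cvg orthants_measurable orthants_le1
    pointwise_separable_orthants Og (orthants01 Og).2 _ c).
  exact: stat_cvg_orthants.
apply: (BL_L1_cvg separable_euclid sQ); left.
have [] // := L1_cvg_BL (rm := rm) separable_euclid (has_partition_cubes Q) cubes01.
  by move=> g; apply: stat_cvg_cubes => h'; exact: stat_cvg_orthants.
by move=> g; exact: cond_L1_cvg_cubes.
Qed.

End kolmogorov_equivalence.

Theorem lemma2p2 (R : realType) (dO : measure_display)
    (Omega : measurableType dO) (P : probability Omega R)
    (dS : measure_display) (OmegaS : measurableType dS)
    (PS : probability OmegaS R) :
  (forall (dD : measure_display) (D : borelMetricType dD R)
      (rm : resampling_mechanism P D) (S : {RV PS >-> D}),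
    separable D ->
    stat_weak_cvg rm (distribution PS S) ->
    [<-> joint_weak_cvg rm (distribution PS S) 2;
         forall M : nat, (2 <= M)%N ->
           joint_weak_cvg rm (distribution PS S) M;
         cond_cvg_BL rm;
         empirical_cvg_BL rm])
  /\
  (forall (k : nat) (rm : resampling_mechanism P (euclid R k))
      (S : {RV PS >-> euclid R k}),
    (0 < k)%N ->
    stat_weak_cvg rm (distribution PS S) ->
    continuous (joint_cdf (distribution PS S)) ->
    [<-> joint_weak_cvg rm (distribution PS S) 2;
         forall M : nat, (2 <= M)%N ->
           joint_weak_cvg rm (distribution PS S) M;
         cond_cvg_BL rm;
         empirical_cvg_BL rm;
         cond_cvg_K rm;
         empirical_cvg_K rm]).
Proof.
split=> [dD D rm S sD sS|k rm S _ sS cS].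
  (* Every arrow of the cycle passes through [cond_L1_cvg] for all functions of [lip01]. *)
  tfae.
  - by move=> jc M _; apply: cond_L1_cvg_joint => // h; exact: joint_cond_L1_cvg.
  - move=> /(_ 2%N isT) jc; apply: (lip01_cvg_BL sD sS _).1 => h.
    exact: joint_cond_L1_cvg.
  - move=> c; apply: (lip01_cvg_BL sD sS _).2 => h.
    by apply: BL_L1_cvg => //; left.
  - move=> c; apply: cond_L1_cvg_joint => // h.
    by apply: BL_L1_cvg => //; right.
have sD := @separable_euclid R k.
tfae.
- by move=> jc M _; apply: cond_L1_cvg_joint => // h; exact: joint_cond_L1_cvg.
- move=> /(_ 2%N isT) jc; apply: (lip01_cvg_BL sD sS _).1 => h.
  exact: joint_cond_L1_cvg.
- move=> c; apply: (lip01_cvg_BL sD sS _).2 => h.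
  by apply: BL_L1_cvg => //; left.
- move=> c; apply: (lip01_cvg_K cS sS _).1 => h.
  by apply: BL_L1_cvg => //; right.
- move=> c; apply: (lip01_cvg_K cS sS _).2 => h.
  by apply: K_L1_cvg => //; left.
- move=> c; apply: cond_L1_cvg_joint => // h.
  by apply: K_L1_cvg => //; right.
Qed.
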